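(* Let $T_1,\dots,T_N : X \to X$ ($1\le N<\infty$) be maps each of which preserves the probability measure $\mu$ supported on the compact space $X$, and let $L : X \to \mathrm{GL}_d(\mathbb{R})$ be a measurable map with $\log^{+}\|L(x)^{\pm 1}\|_{\mathrm{op}} \in \mathscr{L}^1(\mu)$. Consider the map $S$ on $\Sigma_N^+\times X\times\mathbb{R}^d$ given by $S(\omega,x,v) = (\sigma\omega,\, T_{\pi_1(\omega)}x,\, L(x)v)$. Then for $(\mathfrak{B}\times\mu)$-almost every $(\omega,x)\in\Sigma_N^+\times X$ there exist 1. a positive integer $r = r(\omega,x)$; 2. real numbers $\lambda_1(\omega,x) < \lambda_2(\omega,x) < \cdots < \lambda_r(\omega,x)$; and 3. a flag $V^0_{(\omega,x)} = \{0\} \subsetneq V^1_{(\omega,x)} \subsetneq \cdots \subsetneq V^r_{(\omega,x)} = \mathbb{R}^d$ of vector subspaces, such that for all $1\le k\le r$: A. (a) $r(\omega,x) = r(\sigma\omega, T_{\pi_1(\omega)}x) = r(\sigma^2\omega, T_{\pi_2(\omega)}x) = \cdots$; (b) $\lambda_k(\omega,x) = \lambda_k(\sigma\omega,T_{\pi_1(\omega)}x) = \lambda_k(\sigma^2\omega,T_{\pi_2(\omega)}x) = \cdots$; (c) $L(T_{\pi_j(\omega)}x)\, V^k_{(\sigma^j\omega,\,T_{\pi_j(\omega)}x)} = V^k_{(\sigma^{j+1}\omega,\,T_{\pi_{j+1}(\omega)}x)}$ for every $j\ge 0$. B. The maps (a) $(\omega,x)\mapsto r(\omega,x)$, (b)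 $(\omega,x)\mapsto\lambda_k(\omega,x)$ and (c) $(\omega,x)\mapsto V^k_{(\omega,x)}$ are measurable. C. For every $v\in V^k_{(\omega,x)}\setminus V^{k-1}_{(\omega,x)}$, $$\lim_{n\to\infty}\frac1n\log\|L^n_\omega(x)v\| = \lambda_k(\omega,x),\qquad\text{where } L^n_\omega(x)=\prod_{j=0}^{n-1}L(T_{\pi_j(\omega)}x).$$
   Context: $(X,\mathcal{B}_X,\mu)$ is a compact space with a $\sigma$-algebra $\mathcal{B}_X$ and a probability measure $\mu$. $\Sigma_N^+=\{\omega=(\omega_1\omega_2\cdots):\omega_j\in\{1,\dots,N\}\}$ is the space of infinite words, with the topology generated by cylinder sets; $\sigma$ is the left shift on $\Sigma_N^+$ (dropping the first letter), and $\mathfrak{B}$ is the Bernoulli measure on $\Sigma_N^+$ associated with a given probability vector in $\mathbb{R}^N$. For $\omega\in\Sigma_N^+$, $\pi_j(\omega)=(\omega_1\cdots\omega_j)$ for $j\ge1$, $\pi_0(\omega)$ is the empty word, $T_{\pi_j(\omega)} = T_{\omega_j}\circ\cdots\circ T_{\omega_1}$ and $T_{\pi_0(\omega)}x=x$. Matrix products are in dynamical order: $\prod_{j=0}^{n-1}L(T_{\pi_j(\omega)}x) = L(T_{\pi_{n-1}(\omega)}x)\cdots L(T_{\pi_1(\omega)}x)L(x)$. $\|\cdot\|$ is the Euclidean norm, $\|\cdot\|_{\mathrm{op}}$ the operator norm, and $\log^{+}\|A\|_{\mathrm{op}}=\max\{0,\log\|A\|_{\mathrm{op}}\}$; the condition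 $\log^{+}\|L(x)^{\pm1}\|_{\mathrm{op}}\in\mathscr{L}^1(\mu)$ means integrability for both $L(x)$ and $L(x)^{-1}$. Measurability of a subspace-valued map is with respect to the Borel $\sigma$-algebra of the Grassmannian $\mathrm{Gr}(d)$ (disjoint union over $1\le l\le d$ of the sets of $l$-dimensional subspaces of $\mathbb{R}^d$), with metric $d_{\mathrm{Gr}}(V_1,V_2)=d_H(\mathbb{S}^{d-1}\cap V_1,\mathbb{S}^{d-1}\cap V_2)$, where $d_H$ is the Hausdorff metric. For given $k$, the maps $\lambda_k$ and $V^k$ are understood on the set where $r(\omega,x)\ge k$. *)

(* Defs.v *)
From HB Require Import structures.
From mathcomp Require Import all_boot all_order all_algebra.
From mathcomp Require Import all_classical all_reals all_analysis.

Set Implicit Arguments.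
Unset Strict Implicit.
Unset Printing Implicit Defensive.

Import Order.TTheory GRing.Theory Num.Theory.

Local Open Scope classical_set_scope.
Local Open Scope ring_scope.

(* A topological space that also carries a sigma-algebra; no compatibility
   between the two structures is imposed. *)
#[short(type="topMeasurableType")]
HB.structure Definition TopMeasurable (d : measure_display) :=
  {T of Topological T & Measurable d T}.

Definition borel (T : ptopologicalType) := g_sigma_algebraType (@open T).

(* The alphabet {1, ..., N}, N >= 1, is 'I_n.+1 with N = n.+1, and the letter
   omega_j is [omega j.-1]: words are indexed from 0. *)
Definition words (n : nat) : Type := nat -> 'I_n.+1.

Definition prefix_word (n : nat) (omega : words n) (j : nat) : seq 'I_n.+1 :=
  mkseq omega j.

Definition cylinder (n : nat) (w : seq 'I_n.+1) : set (words n) :=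
  [set omega | prefix_word omega (size w) = w].

HB.instance Definition _ (n : nat) := gen_eqMixin (words n).
HB.instance Definition _ (n : nat) := gen_choiceMixin (words n).
HB.instance Definition _ (n : nat) :=
  isPointed.Build (words n) (fun=> ord0).
HB.instance Definition _ (n : nat) :=
  @isSubBaseTopological.Build (words n) (set (words n))
    (range (@cylinder n)) id.
HB.instance Definition _ (n : nat) :=
  Measurable.copy (words n) (borel (words n)).

Definition shift_word (n : nat) (omega : words n) : words n :=
  fun j => omega j.+1.

Definition prob_vector (R : realType) (n : nat) (p : 'I_n.+1 -> R) : Prop :=
  (forall i, 0 <= p i) /\ \sum_i p i = 1.

Definition is_bernoulli (R : realType) (n : nat) (p : 'I_n.+1 -> R)
    (B : probability (words n) R) : Prop :=
  forall w : seq 'I_n.+1, B (cylinder w) = (\prod_(i <- w) p i)%:E.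

Definition measure_preserving (d : measure_display) (X : measurableType d)
    (R : realType) (mu : probability X R) (f : X -> X) : Prop :=
  measurable_fun setT f /\
  forall A : set X, measurable A -> mu (f @^-1` A) = mu A.

(* The first letter of the word acts first. *)
Definition word_map (n : nat) (X : Type) (T : 'I_n.+1 -> X -> X)
    (w : seq 'I_n.+1) (x : X) : X :=
  foldl (fun y i => T i y) x w.

Definition traj_map (n : nat) (X : Type) (T : 'I_n.+1 -> X -> X)
    (omega : words n) (j : nat) (x : X) : X :=
  word_map T (prefix_word omega j) x.

Fixpoint cocycle (n : nat) (X : Type) (R : realType) (m : nat)
    (T : 'I_n.+1 -> X -> X) (L : X -> 'M[R]_m)
    (omega : words n) (x : X) (k : nat) : 'M[R]_m :=
  if k is j.+1 then L (traj_map T omega j x) *m cocycle T L omega x j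
  else 1%:M.

Definition skew_map (n : nat) (X : Type) (R : realType) (m : nat)
    (T : 'I_n.+1 -> X -> X) (L : X -> 'M[R]_m)
    (s : words n * X * 'cV[R]_m) : words n * X * 'cV[R]_m :=
  (shift_word s.1.1, traj_map T s.1.1 1 s.1.2, L s.1.2 *m s.2).

Lemma iter_shift_word (n : nat) (omega : words n) (k : nat) :
  iter k (@shift_word n) omega = (fun i => omega (i + k)%N).
Proof.
elim: k => [|k IHk] /=; apply/funext => i; first by rewrite addn0.
by rewrite IHk /shift_word addSnnS.
Qed.

Lemma traj_mapS (n : nat) (X : Type) (T : 'I_n.+1 -> X -> X)
    (omega : words n) (j : nat) (x : X) :
  traj_map T omega j.+1 x = T (omega j) (traj_map T omega j x).
Proof.
by rewrite /traj_map /word_map /prefix_word mkseqS foldl_rcons.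
Qed.

Lemma iter_skew_map (n : nat) (X : Type) (R : realType) (m : nat)
    (T : 'I_n.+1 -> X -> X) (L : X -> 'M[R]_m)
    (omega : words n) (x : X) (v : 'cV[R]_m) (k : nat) :
  iter k (skew_map T L) (omega, x, v) =
  (iter k (@shift_word n) omega, traj_map T omega k x,
   cocycle T L omega x k *m v).
Proof.
elim: k => [|k IHk]; first by rewrite /= mul1mx.
rewrite iterS IHk /skew_map /= mulmxA traj_mapS; congr (_, _, _).
by rewrite traj_mapS /= iter_shift_word.
Qed.

(* The library norm on matrices is the max norm, hence these definitions. *)
Definition enorm (R : realType) (m : nat) (v : 'cV[R]_m) : R :=
  Num.sqrt (\sum_i v i ord0 ^+ 2).

Definition opnorm (R : realType) (m : nat) (A : 'M[R]_m) : R :=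
  sup [set enorm (A *m v) | v in [set v : 'cV[R]_m | enorm v = 1]].

Definition logp_opnorm (R : realType) (m : nat) (A : 'M[R]_m) : R :=
  Num.max 0 (ln (opnorm A)).

Definition edist_set (R : realType) (m : nat) (a : 'cV[R]_m)
    (B : set 'cV[R]_m) : R :=
  inf [set enorm (a - b) | b in B].

(* Meaningful for nonempty bounded sets only: [sup] and [inf] default to 0. *)
Definition hausdorff_dist (R : realType) (m : nat) (A B : set 'cV[R]_m) : R :=
  Num.max (sup [set edist_set a B | a in A]) (sup [set edist_set b A | b in B]).

Definition Gr (R : realType) (m : nat) : set {vspace 'cV[R]_m} :=
  [set V | (1 <= \dim V <= m)%N].

Definition unit_sphere (R : realType) (m : nat) (V : {vspace 'cV[R]_m}) :
    set 'cV[R]_m :=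
  [set v | v \in V /\ enorm v = 1].

Definition dist_Gr (R : realType) (m : nat) (V W : {vspace 'cV[R]_m}) : R :=
  hausdorff_dist (unit_sphere V) (unit_sphere W).

Definition Gr_open (R : realType) (m : nat) : set (set {vspace 'cV[R]_m}) :=
  [set U | U `<=` @Gr R m /\
    forall V, U V -> exists2 e : R, 0 < e &
      forall W, Gr W -> dist_Gr V W < e -> U W].

Definition Gr_borel (R : realType) (m : nat) : set (set {vspace 'cV[R]_m}) :=
  <<s @Gr R m, @Gr_open R m >>.

Definition Gr_measurable_fun (d : measure_display) (Z : measurableType d)
    (R : realType) (m : nat) (D : set Z) (V : Z -> {vspace 'cV[R]_m}) : Prop :=
  (forall z, D z -> Gr (V z)) /\
  forall A, Gr_borel A -> measurable (D `&` V @^-1` A).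

Definition mx_img (R : realType) (m : nat) (A : 'M[R]_m)
    (V : {vspace 'cV[R]_m}) : {vspace 'cV[R]_m} :=
  (linfun (mulmx A : 'cV[R]_m -> 'cV[R]_m) @: V)%VS.

(* Main.v *)
Require Import Defs.
From HB Require Import structures.
From mathcomp Require Import all_boot all_order all_algebra all_fingroup.
From mathcomp Require Import all_classical all_reals all_analysis.
From mathcomp Require Import measurable_realfun ring lra.

(* The skew product over the shift preserves the product measure, so consider an
   integrable cocycle A^n of m x m matrices over a measure-preserving map.  Let
   vol k be the sum of the absolute values of the k x k minors of a matrix; it is
   submultiplicative by Cauchy-Binet, so (1/n) ln (vol k (A^n)) converges almost
   everywhere by Kingman's theorem.  Let chi be the top rate, k = 1, and j its
   multiplicity, i.e. vol (j + 1) grows slower than exp (n (j + 1) chi).  By this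
   gap the ridge operators (1 + exp (-2 n theta) (A^n)^T A^n)^-1, with theta
   slightly below chi, are exponentially Cauchy; their limit is the orthogonal
   projection onto the vectors that grow slower than chi, and every other vector
   grows at rate chi exactly.  No singular value decomposition and no measurable
   selection of bases is needed, and the projection is visibly measurable.  The
   same argument applied to A^n Q, for Q this projection, gives the next rate;
   after at most m steps the projection is 0, and the images of the successive
   projections form the flag. *)

Set Implicit Arguments.
Unset Strict Implicit.
Unset Printing Implicit Defensive.

Import Order.TTheory GRing.Theory Num.Theory.
Import numFieldNormedType.Exports.

Local Open Scope classical_set_scope.
Local Open Scope ring_scope.

(** * Minors *)

(** The ridge operators [S n] are Cauchy for a reason that needs no spectral theory. A^n sends the
    image of [S n] to vectors of size about exp (n (chi - delta / 2)), and so does A^(n+1), one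
    factor of the cocycle being subexponential; vectors that small are almost fixed by [S n.+1].
    Hence [S n.+1 *m S n] is close to [S n], likewise [S n *m S n.+1] is close to [S n.+1], and by
    symmetry of the operators a transposition identifies the two products. The other obstacle is
    equivariance: the cocycle carries the range of each projection to the range of the next one, but
    it does not intertwine orthogonal projections. The invariance of the ranges is derived from
    growth instead: v and A v have the same rate, and the gap separates slow vectors from all
    others. The base map is only iterated forward, so every exceptional null set is enlarged until
    its complement is forward invariant. *)

Lemma det_mulmx_rows (R : comRingType) (k p : nat) (U : 'M[R]_(k, p))
  (V : 'M[R]_(p, k)) :
  \det (U *m V) =
  \sum_(h : {ffun 'I_k -> 'I_p}) (\prod_i U i (h i)) * \det (rowsub h V).
Proof.
rewrite /determinant.
under eq_bigr => s _.
  under eq_bigr => i _ do rewrite mxE.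
  rewrite bigA_distr_bigA mulr_sumr; over.
rewrite exchange_big; apply: eq_bigr => h _; rewrite mulr_sumr.
apply: eq_bigr => s _; rewrite big_split mulrCA; congr (_ * (_ * _)).
by apply: eq_bigr => i _; rewrite mxE.
Qed.

(* Cauchy-Binet with the sum ranging over all maps instead of the increasing
   ones, whence the factorial. *)
Lemma cauchy_binet (R : comRingType) (k p : nat) (U : 'M[R]_(k, p))
  (V : 'M[R]_(p, k)) :
  k`!%:R * \det (U *m V) =
  \sum_(h : {ffun 'I_k -> 'I_p}) \det (colsub h U) * \det (rowsub h V).
Proof.
(* Replacing [h] by its composition with [s] permutes the rows of [rowsub h V] and costs the sign of
   [s], so the expansion has one version for each [s]. Adding up the k! versions turns the products
   into [\det (colsub h U)]. *)
have permE (s : 'S_k) : \det (U *m V) = \sum_(h : {ffun 'I_k -> 'I_p})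
    ((-1) ^+ s * \prod_i colsub h U i (s i)) * \det (rowsub h V).
  rewrite det_mulmx_rows (reindex (fun h : {ffun 'I_k -> 'I_p} =>
    [ffun i => h (s i)])) /=; last first.
    exists (fun h : {ffun 'I_k -> 'I_p} => [ffun i => h ((s^-1)%g i)]) => h _.
      by apply/ffunP => i; rewrite !ffunE permKV.
    by apply/ffunP => i; rewrite !ffunE permK.
  apply: eq_bigr => h _; rewrite [_ * \prod_i _]mulrC -mulrA; congr (_ * _).
    by apply: eq_bigr => i _; rewrite mxE ffunE.
  rewrite -det_perm -det_mulmx -row_permE; congr (\det _).
  by apply/matrixP => i j; rewrite !mxE ffunE.
rewrite mulr_natl -(card_Sn k) -sumr_const.
rewrite (eq_bigr _ (fun s _ => permE s)) exchange_big; apply: eq_bigr => h _ /=.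
by rewrite -mulr_suml.
Qed.

Section Minors.
Variable R : realFieldType.

(** All norms give the same growth rates. This one is the case k = 1 of [vol]; it is
    submultiplicative and visibly measurable. *)
Definition nrm (p q : nat) (A : 'M[R]_(p, q)) : R := \sum_i \sum_j `|A i j|.

Lemma nrm_ge0 p q (A : 'M[R]_(p, q)) : 0 <= nrm A.
Proof. by apply: sumr_ge0 => i _; apply: sumr_ge0. Qed.

Lemma ler_nrm p q (A : 'M[R]_(p, q)) i j : `|A i j| <= nrm A.
Proof.
rewrite /nrm (bigD1 i) //= (bigD1 j) //= -addrA lerDl addr_ge0 //.
  exact: sumr_ge0.
by apply: sumr_ge0 => ? _; apply: sumr_ge0.
Qed.

Lemma nrm0 p q : nrm (0 : 'M[R]_(p, q)) = 0.
Proof. by rewrite /nrm big1 // => i _; rewrite big1 // => j _;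
  rewrite mxE normr0. Qed.

Lemma nrm_eq0 p q (A : 'M[R]_(p, q)) : nrm A = 0 -> A = 0.
Proof.
move=> A0; apply/matrixP => i j; rewrite mxE; apply/normr0_eq0/le_anti.
by rewrite normr_ge0 andbT -A0 ler_nrm.
Qed.

Lemma nrmD p q (A B : 'M[R]_(p, q)) : nrm (A + B) <= nrm A + nrm B.
Proof.
rewrite /nrm -big_split ler_sum // => i _; rewrite -big_split ler_sum //= => j
  _.
by rewrite mxE ler_normD.
Qed.

Lemma nrmZ p q c (A : 'M[R]_(p, q)) : nrm (c *: A) = `|c| * nrm A.
Proof.
rewrite /nrm mulr_sumr; apply: eq_bigr => i _; rewrite mulr_sumr.
by apply: eq_bigr => j _; rewrite mxE normrM.
Qed.

Lemma nrmN p q (A : 'M[R]_(p, q)) : nrm (- A) = nrm A.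
Proof. by rewrite -scaleN1r nrmZ normrN1 mul1r. Qed.

Lemma nrmB p q (A B : 'M[R]_(p, q)) : nrm (A - B) <= nrm A + nrm B.
Proof. by rewrite -[nrm B]nrmN nrmD. Qed.

Lemma nrm_tr p q (A : 'M[R]_(p, q)) : nrm A^T = nrm A.
Proof.
rewrite /nrm exchange_big; apply: eq_bigr => i _; apply: eq_bigr => j _.
by rewrite mxE.
Qed.

Lemma nrmM p q s (A : 'M[R]_(p, q)) (B : 'M[R]_(q, s)) :
  nrm (A *m B) <= nrm A * nrm B.
Proof.
rewrite /nrm mulr_suml ler_sum // => i _.
rewrite mulr_suml (@le_trans _ _ (\sum_j \sum_k `|A i k| * `|B k j|)) //.
  apply: ler_sum => j _; rewrite mxE (le_trans (ler_norm_sum _ _ _)) //.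
  by apply: ler_sum => k _; rewrite normrM.
rewrite exchange_big ler_sum // => k _ /=; rewrite -mulr_sumr ler_wpM2l //.
rewrite (bigD1 k) //= lerDl; apply: sumr_ge0 => ? _; exact: sumr_ge0.
Qed.

Lemma nrm_le p q (A : 'M[R]_(p, q)) c : (forall i j, `|A i j| <= c) ->
  nrm A <= (p * q)%:R * c.
Proof.
move=> Ac; rewrite /nrm (@le_trans _ _ (\sum_(i < p) \sum_(j < q) c)) //.
  by apply: ler_sum => i _; apply: ler_sum.
by rewrite !sumr_const !card_ord -mulrnA mulr_natl mulnC.
Qed.

Lemma nrm_op_le p q (A : 'M[R]_(p, q)) c :
  (forall v : 'cV_q, nrm (A *m v) <= c * nrm v) -> nrm A <= q%:R * c.
Proof.
move=> Ac; rewrite /nrm exchange_big mulr_natl -[q in _ *+ q]card_ord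
  -sumr_const.
apply: ler_sum => j _; have := Ac (delta_mx j ord0).
have -> : nrm (delta_mx j ord0 : 'cV[R]_q) = 1.
  rewrite /nrm (bigD1 j) //= big_ord1 mxE !eqxx normr1 big1 ?addr0 // => i ij.
  by rewrite big_ord1 mxE (negbTE ij) normr0.
rewrite mulr1; apply: le_trans; rewrite -colE /nrm ler_sum // => i _.
by rewrite big_ord1 mxE.
Qed.

(** Up to the factor k! ^ 2, the entrywise l1 norm of the k-th exterior power of [A]: maps that are
    not injective contribute zero, and every genuine minor is counted once for each ordering of its
    rows and of its columns. *)
Definition vol (k p q : nat) (A : 'M[R]_(p, q)) : R :=
  \sum_(f : {ffun 'I_k -> 'I_p}) \sum_(g : {ffun 'I_k -> 'I_q})
    `|\det (mxsub f g A)|.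

Lemma vol_ge0 k p q (A : 'M[R]_(p, q)) : 0 <= vol k A.
Proof. by apply: sumr_ge0 => i _; apply: sumr_ge0. Qed.

Lemma ler_vol k p q (A : 'M[R]_(p, q)) (f : 'I_k -> 'I_p) (g : 'I_k -> 'I_q) :
  `|\det (mxsub f g A)| <= vol k A.
Proof.
have -> : mxsub f g A = mxsub [ffun i => f i] [ffun i => g i] A.
  by apply/matrixP => i j; rewrite !mxE !ffunE.
rewrite /vol (bigD1 [ffun i => f i]) //= (bigD1 [ffun i => g i]) //=.
rewrite -addrA lerDl addr_ge0 //; first exact: sumr_ge0.
by apply: sumr_ge0 => ? _; apply: sumr_ge0.
Qed.

Lemma ler_cauchy_binet k p (U : 'M[R]_(k, p)) (V : 'M[R]_(p, k)) :
  `|\det (U *m V)| <=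
  \sum_(h : {ffun 'I_k -> 'I_p}) `|\det (colsub h U)| * `|\det (rowsub h V)|.
Proof.
apply: (@le_trans _ _ `|k`!%:R * \det (U *m V)|).
  by rewrite normrM normr_nat ler_peMl // ler1n fact_gt0.
rewrite cauchy_binet (le_trans (ler_norm_sum _ _ _)) // ler_sum // => h _.
by rewrite normrM.
Qed.

Lemma vol_mulmx k p q s (A : 'M[R]_(p, q)) (B : 'M[R]_(q, s)) :
  vol k (A *m B) <= vol k A * vol k B.
Proof.
rewrite /vol mulr_suml ler_sum // => f _; rewrite mulr_suml.
rewrite (@le_trans _ _ (\sum_(g : {ffun 'I_k -> 'I_s})
    \sum_(h : {ffun 'I_k -> 'I_q})
    `|\det (mxsub f h A)| * `|\det (mxsub h g B)|)) //.
  apply: ler_sum => g _.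
  have -> : mxsub f g (A *m B) = rowsub f A *m colsub g B.
    apply/matrixP => i j; rewrite !mxE.
    by apply: eq_bigr => l _; rewrite !mxE.
  rewrite (le_trans (ler_cauchy_binet _ _)) //.
  apply: ler_sum => h _; rewrite le_eqVlt; apply/orP; left; apply/eqP.
  by congr (_ * _); congr (Num.norm (determinant _)); apply/matrixP => a b;
    rewrite !mxE.
rewrite exchange_big ler_sum // => h _ /=; rewrite -mulr_sumr ler_wpM2l //.
by rewrite [leRHS](bigD1 h) //= lerDl; apply: sumr_ge0 => ? _; exact: sumr_ge0.
Qed.

Lemma ler_det k (A : 'M[R]_k) c : (forall i j, `|A i j| <= c) ->
  `|\det A| <= k`!%:R * c ^+ k.
Proof.
move=> Ac; rewrite (le_trans (ler_norm_sum _ _ _)) //.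
rewrite (@le_trans _ _ (\sum_(s : 'S_k) c ^+ k)) //; last first.
  by rewrite sumr_const card_Sn mulr_natl.
apply: ler_sum => s _; rewrite normrM normrX normrN1 expr1n mul1r normr_prod.
rewrite -[k in c ^+ k]card_ord -prodr_const ler_prod // => i _.
by rewrite normr_ge0 Ac.
Qed.

Lemma vol_le_nrm k p q : exists2 K : R, 0 < K &
  forall A : 'M[R]_(p, q), vol k A <= K * nrm A ^+ k.
Proof.
pose K : R := (#|{ffun 'I_k -> 'I_p}| * #|{ffun 'I_k -> 'I_q}|)%:R * k`!%:R.
have K0 : 0 <= K by rewrite mulr_ge0.
exists (K + 1) => [|A]; first by rewrite ltr_wpDl.
apply: (@le_trans _ _ (K * nrm A ^+ k)); last first.
  by rewrite ler_wpM2r ?exprn_ge0 ?nrm_ge0 // lerDl.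
apply: (@le_trans _ _ (\sum_(f : {ffun 'I_k -> 'I_p})
  \sum_(g : {ffun 'I_k -> 'I_q}) (k`!%:R * nrm A ^+ k))).
  apply: ler_sum => f _; apply: ler_sum => g _; apply: ler_det => i j.
  by rewrite mxE ler_nrm.
by rewrite !sumr_const -mulrnA /K -mulrA [leRHS]mulr_natl mulnC.
Qed.

Lemma vol1 p q (A : 'M[R]_(p, q)) : vol 1 A = nrm A.
Proof.
have bij n : {on [pred _ | true], bijective
  (fun i : 'I_n => [ffun _ : 'I_1 => i])}.
  exists (fun f : {ffun 'I_1 -> 'I_n} => f ord0) => f _; first by rewrite ffunE.
  by apply/ffunP => i; rewrite ffunE (ord1 i).
rewrite /vol (reindex _ (bij p)); apply: eq_bigr => i _ /=.
rewrite (reindex _ (bij q)); apply: eq_bigr => j _ /=.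
by rewrite det_mx11 mxE !ffunE.
Qed.

Lemma vol_eq0 k p q (A : 'M[R]_(p, q)) : (q < k)%N -> vol k A = 0.
Proof.
move=> qk; rewrite /vol big1 // => f _; rewrite big1 // => g _.
have /injectivePn[i [j ij gij]] : ~~ injectiveb g.
  apply/injectiveP => /leq_card; rewrite !card_ord leqNgt qk //.
by apply/eqP; rewrite normr_eq0 -det_tr;
  apply/eqP/(determinant_alternate ij) => l; rewrite !mxE gij.
Qed.

Lemma nrm_invmx k (M : 'M[R]_k.+1) c : \det M != 0 ->
  (forall i j, `|M i j| <= c) ->
  nrm (invmx M) <= (k.+1 * k.+1)%:R * k`!%:R * c ^+ k / `|\det M|.
Proof.
move=> M0 Mc; rewrite /invmx unitmxE unitfE M0 nrmZ normfV mulrC.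
rewrite ler_wpM2r ?invr_ge0 // -mulrA; apply: nrm_le => i j.
rewrite mxE /cofactor normrM normrX normrN1 expr1n mul1r.
by apply: ler_det => a b; rewrite !mxE.
Qed.

(* Take a j x j minor of [B] of maximal absolute value, on the rows [f] and the
   columns [g]: [u] is the combination of the coordinate vectors [g] for which
   [v - u] is annihilated by the rows [f] of [B].  Bordering that minor bounds
   [B *m (v - u)] by the minors of size j + 1. *)
Lemma minor_split j p q : exists2 K : R, 0 < K &
  forall (B : 'M[R]_(p, q)) (v : 'cV[R]_q), 0 < vol j.+1 B ->
  exists u : 'cV[R]_q,
    nrm u <= K * (nrm B ^+ j / vol j.+1 B) * nrm (B *m v) /\
    nrm (B *m (v - u)) <= K * (vol j.+2 B / vol j.+1 B) * nrm (v - u).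
Proof.
pose N : nat := (#|{ffun 'I_j.+1 -> 'I_p}| * #|{ffun 'I_j.+1 -> 'I_q}|)%N.
pose K1 : R := (q * j.+1)%:R * ((j.+1 * j.+1)%:R * j`!%:R) * (j.+1 * 1)%:R *
  N%:R.
pose K2 : R := (p * 1)%:R * (j.+2%:R * j.+1`!%:R) * N%:R.
have K10 : 0 <= K1 by rewrite !mulr_ge0.
have K20 : 0 <= K2 by rewrite !mulr_ge0.
exists (K1 + K2 + 1) => [|B v volB]; first by rewrite ltr_wpDl // addr_ge0.
(* The largest of [N] minors is at least their mean. There is a minor to choose, since otherwise
   [vol j.+1 B] would be an empty sum. *)
have [[f g] /= Dmax] : exists fg : {ffun 'I_j.+1 -> 'I_p} *
  {ffun 'I_j.+1 -> 'I_q},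
    vol j.+1 B <= N%:R * `|\det (mxsub fg.1 fg.2 B)|.
  pose G (fg : {ffun 'I_j.+1 -> 'I_p} * {ffun 'I_j.+1 -> 'I_q}) :=
    `|\det (mxsub fg.1 fg.2 B)|.
  have volE : vol j.+1 B = \sum_fg G fg by rewrite /vol pair_big.
  have [fg0 _|E] := pickP (@predT ({ffun 'I_j.+1 -> 'I_p} *
    {ffun 'I_j.+1 -> 'I_q})).
    have [fg _ Gmax] := @arg_maxP _ _ _ fg0 xpredT G isT.
    exists fg; rewrite volE /N -card_prod
      (@le_trans _ _ (\sum_(x : {ffun 'I_j.+1 -> 'I_p} * {ffun 'I_j.+1 -> 'I_q})
        G fg)) //.
      by apply: ler_sum => x _; apply: Gmax.
    by rewrite sumr_const mulr_natl.
  by move: volB; rewrite volE big1 ?ltxx // => x; have := E x.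
set M := mxsub f g B in Dmax; set D := `|\det M| in Dmax.
have D0 : 0 < D.
  rewrite lt_neqAle normr_ge0 andbT eq_sym; apply: contraTneq Dmax => ->.
  by rewrite mulr0 -ltNge.
have detM : \det M != 0 by rewrite -normr_gt0.
have Munit : M \in unitmx by rewrite unitmxE unitfE.
have DV : D^-1 <= N%:R / vol j.+1 B.
  by rewrite ler_pdivlMr // mulrC ler_pdivrMr.
pose E : 'M[R]_(q, j.+1) := colsub g 1%:M.
pose u := E *m (invmx M *m (rowsub f (B *m v))).
have BE : B *m E = colsub g B by rewrite mulmx_colsub mulmx1.
have fBE : rowsub f B *m E = M by rewrite mul_rowsub_mx BE;
  apply/matrixP=> a b; rewrite !mxE.
have E1 a b : `|E a b| <= 1.
  by rewrite !mxE; case: eqP => _; rewrite ?normr1 ?normr0.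
exists u; split.
  rewrite (@le_trans _ _ (K1 * (nrm B ^+ j / vol j.+1 B) * nrm (B *m v))) //;
    last first.
    rewrite ler_wpM2r ?nrm_ge0 // ler_wpM2r ?mulr_ge0 ?invr_ge0 ?exprn_ge0
      ?nrm_ge0 ?(ltW volB) //.
    by rewrite -addrA lerDl addr_ge0.
  rewrite /u (le_trans (nrmM _ _)) //.
  have nE : nrm E <= (q * j.+1)%:R by rewrite -[leRHS]mulr1; apply: nrm_le.
  have nr : nrm (rowsub f (B *m v)) <= (j.+1 * 1)%:R * nrm (B *m v).
    by apply: nrm_le => a b; rewrite mxE ler_nrm.
  have nM : nrm (invmx M) <= (j.+1 * j.+1)%:R * j`!%:R * nrm B ^+ j *
    (N%:R / vol j.+1 B).
    apply: le_trans (@nrm_invmx _ _ (nrm B) detM _) _.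
      by move=> a b; rewrite mxE ler_nrm.
    by rewrite ler_wpM2l // !mulr_ge0 // exprn_ge0 // nrm_ge0.
  rewrite (@le_trans _ _ ((q * j.+1)%:R *
    (((j.+1 * j.+1)%:R * j`!%:R * nrm B ^+ j * (N%:R / vol j.+1 B)) *
     ((j.+1 * 1)%:R * nrm (B *m v))))) //.
    apply: ler_pM => //; rewrite ?nrm_ge0 //.
    by rewrite (le_trans (nrmM _ _)) // ler_pM ?nrm_ge0.
  rewrite le_eqVlt; apply/orP; left; apply/eqP; rewrite /K1.
  by move: (_ * _)%:R (_ * _)%:R (_ * 1)%:R N%:R _`!%:R (nrm B ^+ j) (_^-1)
    (nrm _) => *; ring.
set w := v - u.
have fBw : rowsub f B *m w = 0.
  rewrite /w mulmxBr /u mulmxA fBE mulKVmx // mul_rowsub_mx.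
  by rewrite subrr.
rewrite (@le_trans _ _ (K2 * (vol j.+2 B / vol j.+1 B) * nrm w)) //; last first.
  rewrite ler_wpM2r ?nrm_ge0 // ler_wpM2r ?mulr_ge0 ?invr_ge0 ?vol_ge0 //.
  by rewrite [K1 + _]addrC -addrA lerDl addr_ge0.
rewrite /K2 -!mulrA; apply: nrm_le => i j0; rewrite (ord1 j0) {j0}.
(* Since the rows [f] of [B] annihilate [w], the product [U *m V] is block triangular with
   determinant [(B *m w) i ord0 * \det M]. Cauchy-Binet bounds this determinant by the minors of
   [U], which are among those counted in [vol j.+2 B]. *)
pose U : 'M[R]_(1 + j.+1, q) := col_mx (row i B) (rowsub f B).
pose V : 'M[R]_(q, 1 + j.+1) := row_mx w E.
have detUV : \det (U *m V) = (B *m w) i ord0 * \det M.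
  rewrite mul_col_row fBw fBE det_ublock; congr (_ * _).
  by rewrite det_mx11 -row_mul mxE.
have -> : `|(B *m w) i ord0| = `|\det (U *m V)| / D.
  by rewrite detUV normrM mulfK // gt_eqF.
apply: (@le_trans _ _ (vol j.+2 B * (j.+2%:R * (j.+1`!%:R * nrm w)) / D)).
  rewrite ler_wpM2r ?invr_ge0 ?normr_ge0 //.
  rewrite (le_trans (ler_cauchy_binet _ _)) //.
  rewrite (@le_trans _ _ (\sum_(h : {ffun 'I_j.+2 -> 'I_q})
    `|\det (colsub h U)| * (j.+2%:R * (j.+1`!%:R * nrm w)))) //.
    apply: ler_sum => h _; rewrite ler_wpM2l //.
    (* The first column consists of entries of [w]; the cofactors are determinants with entries of
       [E], all at most 1 in absolute value. *)
    rewrite (expand_det_col _ ord0) (le_trans (ler_norm_sum _ _ _)) //.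
    rewrite (@le_trans _ _ (\sum_(a < j.+2) (j.+1`!%:R * nrm w))) //;
      last by rewrite sumr_const card_ord [leRHS]mulr_natl.
    apply: ler_sum => a _.
    rewrite normrM mulrC ler_pM //.
      rewrite /cofactor normrM normrX normrN1 expr1n mul1r -[_%:R]mulr1.
      rewrite -[X in _ * X](expr1n _ j.+1); apply: ler_det => b c.
      rewrite !mxE; case: splitP => [d|d /= _]; last exact: E1.
      by rewrite (ord1 d).
    rewrite !mxE; case: splitP => [d _|d //]; rewrite (ord1 d); exact: ler_nrm.
  rewrite -mulr_suml ler_wpM2r ?mulr_ge0 ?nrm_ge0 //.
  pose F : {ffun 'I_(1 + j.+1) -> 'I_p} :=
    [ffun a => match fintype.split a with inl _ => i | inr b => f b end].
  rewrite /vol [leRHS](bigD1 F) //= -[leLHS]addr0 lerD //; last first.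
    by apply: sumr_ge0 => ? _; exact: sumr_ge0.
  apply: ler_sum => h _; rewrite le_eqVlt; apply/orP; left; apply/eqP.
  congr (Num.norm (determinant _)); apply/matrixP => a b; rewrite !mxE ffunE.
  by case: splitP => c _; rewrite mxE.
rewrite (@le_trans _ _ (vol j.+2 B * (j.+2%:R * (j.+1`!%:R * nrm w)) *
  (N%:R / vol j.+1 B))) //.
  by rewrite ler_wpM2l // !mulr_ge0 ?vol_ge0 ?nrm_ge0.
rewrite le_eqVlt; apply/orP; left; apply/eqP.
by move: (vol _ _) N%:R _%:R _%:R (_^-1) (nrm w) => *; ring.
Qed.

End Minors.

(** * Slow vectors of a sequence of matrices *)

Section Ridge.
Variable R : realFieldType.

Definition sqn (p : nat) (u : 'cV[R]_p) : R := (u^T *m u) ord0 ord0.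

Lemma sqnE p (u : 'cV[R]_p) : sqn u = \sum_i u i ord0 ^+ 2.
Proof. by rewrite /sqn mxE; apply: eq_bigr => i _; rewrite mxE expr2. Qed.

Lemma sqn_ge0 p (u : 'cV[R]_p) : 0 <= sqn u.
Proof. by rewrite sqnE; apply: sumr_ge0 => i _; exact: sqr_ge0. Qed.

Lemma sqn_eq0 p (u : 'cV[R]_p) : sqn u = 0 -> u = 0.
Proof.
rewrite sqnE => /eqP; rewrite psumr_eq0; last by move=> i _; exact: sqr_ge0.
move=> /allP u0; apply/colP => i; rewrite mxE; apply/eqP.
by have := u0 i (mem_index_enum _); rewrite sqrf_eq0.
Qed.

(** Both cross terms of |u + C^T C u|^2 equal |C u|^2. All summands are therefore nonnegative and
    bounded by |w|^2; every estimate on [ridge] is read off from this. *)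
Lemma sqnDmx p q (C : 'M[R]_(p, q)) u (w : 'cV[R]_q) : w = u + C^T *m (C *m u)
  ->
  sqn w = sqn u + sqn (C *m u) *+ 2 + sqn (C^T *m (C *m u)).
Proof.
move=> ->; rewrite /sqn [(_ + _)^T]linearD /= mulmxDl !mulmxDr.
rewrite [LHS]mxE [X in X + _ = _]mxE [X in _ + X = _]mxE mulr2n -!addrA.
congr (_ + (_ + (_ + _))); congr (fun_of_matrix _ ord0 ord0).
  by rewrite trmx_mul !mulmxA.
by rewrite !trmx_mul trmxK !mulmxA.
Qed.

Lemma sqn_le_nrm p (u : 'cV[R]_p) : sqn u <= nrm u ^+ 2.
Proof.
rewrite sqnE expr2 {1}/nrm mulr_suml ler_sum // => i _.
rewrite big_ord1 -(@real_normK _ (u i ord0)) ?num_real // expr2.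
by rewrite ler_wpM2l // ler_nrm.
Qed.

Lemma nrm_le_sqn p (u : 'cV[R]_p) c : 0 <= c -> sqn u <= c ^+ 2 -> nrm u <= p%:R
  * c.
Proof.
move=> c0 uc; rewrite -[p in p%:R]muln1; apply: nrm_le => i j.
rewrite -(@ler_pXn2r _ 2) ?nnegrE // (le_trans _ uc) // (ord1 j) sqnE.
rewrite (bigD1 i) //= real_normK ?num_real // lerDl.
by apply: sumr_ge0 => k _; exact: sqr_ge0.
Qed.

(** A right singular vector of [C] with singular value s is multiplied by 1 / (1 + s ^ 2): a smooth
    cutoff that keeps the directions contracted by [C] and suppresses those it expands. *)
Definition ridge (p q : nat) (C : 'M[R]_(p, q)) : 'M[R]_q :=
  invmx (1%:M + C^T *m C).

Lemma ridge_unit p q (C : 'M[R]_(p, q)) : 1%:M + C^T *m C \in unitmx.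
Proof.
rewrite unitmxE unitfE; apply/det0P => -[v v0 vC]; move/eqP: v0; apply.
have E : 0 = v^T + C^T *m (C *m v^T).
  have := congr1 trmx vC; rewrite trmx0 trmx_mul [(_ + _)^T]linearD /= trmx_mul
    trmxK trmx1.
  by rewrite mulmxDl mul1mx mulmxA => ->.
apply: trmx_inj; rewrite trmx0; apply: sqn_eq0; apply: le_anti.
rewrite sqn_ge0 andbT -[leRHS](_ : sqn (0 : 'cV[R]_q) = 0); last first.
  by rewrite /sqn mulmx0 mxE.
by rewrite (sqnDmx E) -addrA lerDl addr_ge0 ?mulrn_wge0 ?sqn_ge0.
Qed.

Lemma ridgeE p q (C : 'M[R]_(p, q)) v :
  v = ridge C *m v + C^T *m (C *m (ridge C *m v)) :> 'cV_q.
Proof.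
rewrite [C^T *m _]mulmxA -{1}[ridge C *m v]mul1mx -mulmxDl mulKVmx //.
exact: ridge_unit.
Qed.

Lemma ridge_sym p q (C : 'M[R]_(p, q)) : (ridge C)^T = ridge C.
Proof. by rewrite /ridge trmx_inv [(_ + _)^T]linearD /= trmx1 trmx_mul trmxK.
  Qed.

Lemma nrm_ridge p q (C : 'M[R]_(p, q)) (v : 'cV_q) :
  nrm (ridge C *m v) <= q%:R * nrm v.
Proof.
apply: nrm_le_sqn; rewrite ?nrm_ge0 // (le_trans _ (sqn_le_nrm _)) //.
by rewrite [leRHS](sqnDmx (ridgeE C v)) -addrA lerDl addr_ge0 ?mulrn_wge0
  ?sqn_ge0.
Qed.

Lemma nrm_mul_ridge p q (C : 'M[R]_(p, q)) (v : 'cV_q) :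
  nrm (C *m (ridge C *m v)) <= p%:R * nrm v.
Proof.
apply: nrm_le_sqn; rewrite ?nrm_ge0 // (le_trans _ (sqn_le_nrm _)) //.
rewrite [leRHS](sqnDmx (ridgeE C v)) mulr2n.
have := sqn_ge0 (ridge C *m v); have := sqn_ge0 (C *m (ridge C *m v)).
have := sqn_ge0 (C^T *m (C *m (ridge C *m v))); lra.
Qed.

(** With u = ridge C v, the defect is C^T (C u), while C v = C u + C C^T (C u). Thus [sqnDmx]
    applies once more, to the transpose of [C] and the vector C u. *)
Lemma nrm_sub_ridge p q (C : 'M[R]_(p, q)) (v : 'cV_q) :
  nrm (v - ridge C *m v) <= q%:R * nrm (C *m v).
Proof.
apply: nrm_le_sqn; rewrite ?nrm_ge0 // (le_trans _ (sqn_le_nrm _)) //.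
set u := ridge C *m v.
have vE : v - u = C^T *m (C *m u) by rewrite {1}(ridgeE C v) addrC addKr.
have CvE : C *m v = C *m u + (C^T)^T *m (C^T *m (C *m u)).
  by rewrite trmxK -vE -mulmxDr addrC subrK.
rewrite vE [leRHS](sqnDmx CvE) mulr2n.
have := sqn_ge0 (C *m u); have := sqn_ge0 (C^T *m (C *m u)).
have := sqn_ge0 ((C^T)^T *m (C^T *m (C *m u))); lra.
Qed.

End Ridge.

Section Convergence.
Variable R : realType.

Lemma cst_le_expR (c e : R) : 0 < e -> \forall n \near \oo, c <= expR
  (n%:R * e).
Proof.
move=> e0; near=> n; rewrite (le_trans _ (expR_ge1Dx _)) //.
rewrite (@le_trans _ _ (n%:R * e)) // ?lerDr // -ler_pdivrMr //.
by near: n; exact: nbhs_infty_ger.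
Unshelve. all: by end_near. Qed.

Lemma cst_expRN_le (c a e : R) : 0 < a -> 0 < e ->
  \forall n \near \oo, c * expR (n%:R * - a) <= e.
Proof.
move=> a0 e0; apply: filterS (cst_le_expR (c / e) a0) => n.
by move=> h; rewrite mulrN expRN ler_pdivrMr ?expR_gt0 // -ler_pdivrMl // mulrC.
Qed.

Lemma geometric_cauchy (a : nat -> R) (q : R) : 0 < q < 1 ->
  (\forall n \near \oo, `|a n.+1 - a n| <= q ^+ n) ->
  cvgn a /\ (\forall n \near \oo, `|limn a - a n| <= q ^+ n / (1 - q)).
Proof.
move=> /andP[q0 q1] [N _ aN].
have q1' : 0 < 1 - q by rewrite subr_gt0.
have step n k : (N <= n)%N -> `|a (n + k)%N - a n| <= (q ^+ n - q ^+ (n + k)) /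
  (1 - q).
  move=> Nn; elim: k => [|k IH]; first by rewrite addn0 !subrr normr0 mul0r.
  have -> : a (n + k.+1)%N - a n = (a (n + k).+1 - a (n + k)%N) +
    (a (n + k)%N - a n).
    by rewrite addnS; ring.
  rewrite (le_trans (ler_normD _ _)) //.
  have := aN (n + k)%N (leq_trans Nn (leq_addr _ _)) => /lerD /(_ IH) /le_trans;
    apply.
  rewrite le_eqVlt; apply/orP; left; apply/eqP; rewrite addnS exprS.
  by field; rewrite gt_eqF.
have bound n k : (N <= n)%N -> `|a (n + k)%N - a n| <= q ^+ n / (1 - q).
  move=> Nn; apply: (le_trans (step n k Nn)).
  by rewrite ler_pM2r ?invr_gt0 // gerBl exprn_ge0 // ltW.
have small (e : R) : 0 < e -> \forall n \near \oo, q ^+ n / (1 - q) < e.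
  move=> e0; have : (fun n => geometric (1 - q)^-1 q n) @ \oo --> (0 : R).
    by apply: cvg_geometric; rewrite ger0_norm // ltW.
  move=> /cvgr0Pnorm_lt /(_ _ e0); apply: filterS => n.
  by rewrite /= mulrC; apply: le_lt_trans; rewrite ler_norm.
have acvg : cvgn a.
  apply/cauchy_cvgP/cauchy_exP => e /small small_e.
  near \oo => n; exists (a n); exists n => // k /= nk.
  rewrite /ball /= distrC -(subnKC nk) (le_lt_trans (bound n (k - n)%N _)) //.
    by near: n; exists N.
  by near: n.
split => //; exists N => // n /= Nn.
rewrite ler_norml; apply/andP; split.
  rewrite lerBrDr; apply: limr_ge => //; exists n => // k /= nk.
  have := bound n (k - n)%N Nn; rewrite subnKC // ler_norml => /andP[+ _]; lra.
rewrite lerBlDr; apply: limr_le => //; exists n => // k /= nk.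
have := bound n (k - n)%N Nn; rewrite subnKC // ler_norml => /andP[_ +]; lra.
Unshelve. all: by end_near. Qed.

Lemma limn_mx_nrm_le p q (A : nat -> 'M[R]_(p, q)) (r : nat -> R) :
  (forall i j, \forall n \near \oo, `|limn (fun k => A k i j) - A n i j| <= r n)
    ->
  \forall n \near \oo,
    nrm ((\matrix_(i, j) limn (fun k => A k i j)) - A n) <= (p * q)%:R * r n.
Proof.
move=> Ar; have : \forall n \near \oo,
    forall i j, `|limn (fun k => A k i j) - A n i j| <= r n.
  by apply: filter_forall => i; apply: filter_forall => j; exact: Ar.
by apply: filterS => n An; apply: nrm_le => i j; rewrite !mxE.
Qed.

End Convergence.

Lemma near_succ (Q : nat -> Prop) :
  (\forall n \near \oo, Q n) -> \forall n \near \oo, Q n.+1.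
Proof. by case=> N _ QN; exists N => // n /= Nn; apply: QN; exact: leqW. Qed.

(* The regularization threshold [chi - delta / 2] lies in the middle of the gap
   below the top growth rate [chi]: a vector growing slower is almost fixed by
   the ridge operator, and a faster one almost killed. *)
Definition slow_ridge (R : realType) (p q : nat) (chi delta : R)
    (B : nat -> 'M[R]_(p, q)) (n : nat) : 'M[R]_q :=
  ridge (expR (n%:R * (delta / 2 - chi)) *: B n).

(** Taking the limit entrywise makes measurability a matter of pointwise limits of real functions;
    the value has a meaning only where the entries converge. *)
Definition slow_proj (R : realType) (p q : nat) (chi delta : R)
    (B : nat -> 'M[R]_(p, q)) : 'M[R]_q :=
  \matrix_(i, j) limn (fun n => slow_ridge chi delta B n i j).

(** * Limit of the ridge operators under a gap in volume growth *)

Section SlowSubspace.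
Variables (R : realType) (m j : nat) (chi delta : R).
Variables (B L : nat -> 'M[R]_m).
Hypothesis delta0 : 0 < delta.
Hypothesis BL : forall n, B n.+1 = L n *m B n.
Hypothesis Lunit : forall n, L n \in unitmx.
Hypothesis B_le : forall e : R, 0 < e ->
  \forall n \near \oo, nrm (B n) <= expR (n%:R * (chi + e)).
Hypothesis vol_ge : forall e : R, 0 < e ->
  \forall n \near \oo, expR (n%:R * (j.+1%:R * chi - e)) <= vol j.+1 (B n).
Hypothesis vol_le : forall e : R, 0 < e ->
  \forall n \near \oo, vol j.+2 (B n) <= expR
    (n%:R * (j.+2%:R * chi - delta + e)).
Hypothesis L_le : forall e : R, 0 < e -> \forall n \near \oo,
  nrm (L n) <= expR (n%:R * e) /\ nrm (invmx (L n)) <= expR (n%:R * e).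

Let S := slow_ridge chi delta B.
Let P := slow_proj chi delta B.

Lemma slow_ridge_contract n (v : 'cV_m) : nrm (S n *m v) <= m%:R * nrm v.
Proof. exact: nrm_ridge. Qed.

Lemma slow_ridge_img n (v : 'cV_m) :
  nrm (B n *m (S n *m v)) <= m%:R * expR (n%:R * (chi - delta / 2)) * nrm v.
Proof.
have := nrm_mul_ridge (expR (n%:R * (delta / 2 - chi)) *: B n) v.
rewrite -scalemxAl nrmZ ger0_norm ?expR_ge0 // -/(slow_ridge _ _ _ _) -/S.
have -> : n%:R * (delta / 2 - chi) = - (n%:R * (chi - delta / 2)) by ring.
by rewrite expRN ler_pdivrMl ?expR_gt0 // mulrCA mulrA.
Qed.

(** [minor_split] writes v = u + w. The part [u] is at most |B v| times a factor of order exp (- n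
    chi). The part [w] is stretched at a rate of at most chi - delta, below the threshold chi -
    delta / 2, so its defect is small by [nrm_sub_ridge]. *)
Lemma slow_ridge_defect e : 0 < e -> \forall n \near \oo, forall v : 'cV_m,
  nrm (v - S n *m v) <= expR (n%:R * (e - chi)) * nrm (B n *m v)
                        + expR (n%:R * (e - delta / 2)) * nrm v.
Proof.
move=> e0; have [K K0 HK] := @minor_split R j m m.
(* The errors accumulate to (j + 2) e1 for [u] and to 3 e1 for [w], both at most (j + 4) e1 <= e;
   the bound 4 e1 <= delta gives [y <= 1]. *)
pose e1 := Num.min e delta / (4 * j.+4%:R).
have j40 : 0 < (4 * j.+4%:R : R) by rewrite mulr_gt0.
have e10 : 0 < e1 by rewrite divr_gt0 // lt_min e0.
have e1E : (j.+4%:R * e1) * 4 = Num.min e delta.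
  by rewrite mulrC mulrA /e1 mulrC divfK // gt_eqF.
have z0 : 0 <= j.+4%:R * e1 by rewrite mulr_ge0 // ltW.
have e1e : j.+4%:R * e1 <= e.
  have : Num.min e delta <= e by rewrite ge_min lexx.
  by rewrite -e1E; lra.
have e1z : e1 <= j.+4%:R * e1 by rewrite ler_peMl ?(ltW e10) // ler1n.
have e1d : e1 * 4 <= delta.
  have : Num.min e delta <= delta by rewrite ge_min lexx orbT.
  by rewrite -e1E; lra.
pose c := (1 + m%:R) * K + m%:R * (K * K).
near=> n => v.
have cn : c + m%:R * K <= expR (n%:R * e1) by near: n; exact: cst_le_expR.
have Bn : nrm (B n) <= expR (n%:R * (chi + e1)) by near: n; exact: B_le.
have vgn : expR (n%:R * (j.+1%:R * chi - e1)) <= vol j.+1 (B n).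
  by near: n; exact: vol_ge.
have vln : vol j.+2 (B n) <= expR (n%:R * (j.+2%:R * chi - delta + e1)).
  by near: n; exact: vol_le.
have vol0 : 0 < vol j.+1 (B n) by rewrite (lt_le_trans _ vgn) // expR_gt0.
have volV : (vol j.+1 (B n))^-1 <= expR (n%:R * (e1 - j.+1%:R * chi)).
  rewrite -[leRHS]invrK lef_pV2 ?posrE ?invr_gt0 ?expR_gt0 // -expRN.
  by rewrite (le_trans _ vgn) // ler_expR -mulrN opprB.
have [u [u_le w_le]] := HK (B n) v vol0.
set w := v - u in w_le.
(* [x] bounds [nrm (B n) ^+ j / vol j.+1 (B n)], and [y] bounds [vol j.+2 (B n) / vol j.+1 (B n)]
   after rescaling by the ridge threshold. *)
pose x := expR (n%:R * (j.+1%:R * e1 - chi)).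
pose y := expR (n%:R * (2 * e1 - delta / 2)).
have u_le' : nrm u <= K * x * nrm (B n *m v).
  rewrite (le_trans u_le) // ler_wpM2r ?nrm_ge0 // ler_wpM2l ?(ltW K0) //.
  rewrite (@le_trans _ _ (expR (n%:R * (chi + e1)) ^+ j * expR
    (n%:R * (e1 - j.+1%:R * chi)))) //.
    apply: ler_pM; rewrite ?exprn_ge0 ?nrm_ge0 ?invr_ge0 ?vol_ge0 //.
    by rewrite lerXn2r ?nnegrE ?nrm_ge0 ?expR_ge0.
  rewrite -expRM_natl -expRD /x ler_expR le_eqVlt; apply/orP; left; apply/eqP.
  by rewrite -[j.+1]addn1 natrD; ring.
have w_le' : expR (n%:R * (delta / 2 - chi)) * nrm (B n *m w) <= K * y * nrm w.
  rewrite -ler_pdivlMl ?expR_gt0 // (le_trans w_le) // [leRHS]mulrA ler_wpM2r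
    ?nrm_ge0 //.
  rewrite [leRHS]mulrCA ler_wpM2l ?(ltW K0) // -expRN.
  rewrite (@le_trans _ _ (expR (n%:R * (j.+2%:R * chi - delta + e1)) * expR
    (n%:R * (e1 - j.+1%:R * chi)))) //.
    by apply: ler_pM; rewrite ?invr_ge0 ?vol_ge0.
  rewrite -!expRD ler_expR le_eqVlt; apply/orP; left; apply/eqP.
  by rewrite -[j.+2]addn1 natrD; field.
have y1 : y <= 1.
  rewrite -expR0 ler_expR mulr_ge0_le0 //; lra.
have x0 : 0 <= x by exact: expR_ge0.
have y0 : 0 <= y by exact: expR_ge0.
have defect_w : nrm (w - S n *m w) <= m%:R * (K * y * nrm w).
  have := nrm_sub_ridge (expR (n%:R * (delta / 2 - chi)) *: B n) w.
  rewrite -scalemxAl nrmZ ger0_norm ?expR_ge0 // => /le_trans; apply.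
  by rewrite ler_wpM2l.
have defect_u : nrm (u - S n *m u) <= (1 + m%:R) * nrm u.
  rewrite (le_trans (nrmB _ _)) // mulrDl mul1r lerD2l;
    exact: slow_ridge_contract.
have w_nrm : nrm w <= nrm v + nrm u by exact: nrmB.
have -> : v - S n *m v = (u - S n *m u) + (w - S n *m w).
  have uw : u + w = v by rewrite /w addrC subrK.
  by rewrite addrACA -opprD -mulmxDr uw.
rewrite (le_trans (nrmD _ _)) // (le_trans (lerD defect_u defect_w)) //.
rewrite (@le_trans _ _ (c * x * nrm (B n *m v) + m%:R * K * y * nrm v)) //.
  rewrite /c.
  have M0 : 0 <= m%:R * (K * y) by rewrite !mulr_ge0 // ltW.
  have h1 := ler_wpM2l M0 w_nrm.
  have h2 : (1 + m%:R + m%:R * (K * y)) * nrm u <=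
            (1 + m%:R + m%:R * K) * (K * x * nrm (B n *m v)).
    apply: ler_pM => //; rewrite ?nrm_ge0 //.
      by rewrite addr_ge0 // addr_ge0.
    by rewrite lerD2l ler_wpM2l // ler_piMr // ltW.
  move: (nrm (B n *m v)) (nrm u) (nrm v) (nrm w) h1 h2 => a b a' b' h1 h2.
  lra.
have n0 : 0 <= n%:R :> R by [].
apply: lerD; rewrite ler_wpM2r ?nrm_ge0 //.
  rewrite (@le_trans _ _ (expR (n%:R * e1) * x)) //.
    rewrite ler_wpM2r // (le_trans _ cn) // lerDl mulr_ge0 // ltW //.
  rewrite /x -expRD ler_expR -mulrDr ler_wpM2l //.
  have -> : e1 + (j.+1%:R * e1 - chi) = j.+2%:R * e1 - chi.
    by rewrite -[j.+2]addn1 natrD; ring.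
  rewrite lerD2r (le_trans _ e1e) // ler_wpM2r ?(ltW e10) // ler_nat.
  by rewrite !ltnS leqW.
rewrite (@le_trans _ _ (expR (n%:R * e1) * y)) //.
  rewrite ler_wpM2r // (le_trans _ cn) // lerDr /c addr_ge0 ?mulr_ge0 ?addr_ge0
    // ltW //.
rewrite /y -expRD ler_expR -mulrDr ler_wpM2l //.
have : 3 * e1 <= j.+4%:R * e1 by rewrite ler_wpM2r ?(ltW e10) // ler_nat.
move: e1e; lra.
Unshelve. all: by end_near. Qed.

Lemma slow_ridge_cauchy : \forall n \near \oo,
  nrm (S n.+1 - S n) <= expR (n%:R * - (delta / 4)).
Proof.
(* The exponent in [z] is 2 e - delta / 2 = - 3 delta / 8; the constants are absorbed by exp (n
   delta / 8), which leaves - delta / 4. *)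
pose e := delta / 16; have e0 : 0 < e by rewrite divr_gt0.
pose c1 := m%:R * (expR (e - chi) + expR (e - delta / 2)).
pose c2 := m%:R * (expR (chi - delta / 2) + 1).
have G := slow_ridge_defect e0; have G1 := near_succ G.
near=> n.
have Gn : forall v : 'cV_m, nrm (v - S n *m v) <= expR (n%:R * (e - chi)) * nrm
  (B n *m v)
                        + expR (n%:R * (e - delta / 2)) * nrm v by near: n.
have Gn1 : forall v : 'cV_m, nrm (v - S n.+1 *m v) <= expR (n.+1%:R * (e - chi))
  * nrm (B n.+1 *m v)
                        + expR (n.+1%:R * (e - delta / 2)) * nrm v by near: n.
have [Ln LVn] : nrm (L n) <= expR (n%:R * e) /\ nrm (invmx (L n)) <= expR
  (n%:R * e).
  by near: n; exact: L_le.
have cn : m%:R * c1 + m%:R * c2 <= expR (n%:R * (delta / 8)).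
  by near: n; apply: cst_le_expR; rewrite divr_gt0.
pose z := expR (n%:R * (2 * e - delta / 2)).
have z0 : 0 <= z by exact: expR_ge0.
have n0 : 0 <= n%:R :> R by [].
have zE : expR (n%:R * (e - delta / 2)) <= z.
  by rewrite ler_expR ler_wpM2l //; lra.
have nS : n.+1%:R = n%:R + 1 :> R by rewrite -addn1 natrD.
have D1 (v : 'cV_m) : nrm ((S n - S n.+1 *m S n) *m v) <= c1 * z * nrm v.
  rewrite mulmxBl -mulmxA (le_trans (Gn1 _)) //.
  have := slow_ridge_contract n v; have := slow_ridge_img n v.
  have : nrm (B n.+1 *m (S n *m v)) <= expR (n%:R * e) * nrm
    (B n *m (S n *m v)).
    by rewrite BL -mulmxA (le_trans (nrmM _ _)) // ler_wpM2r ?nrm_ge0.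
  move=> h1 h2 h3.
  rewrite (@le_trans _ _ (expR (n.+1%:R * (e - chi)) *
    (expR (n%:R * e) * (m%:R * expR (n%:R * (chi - delta / 2)) * nrm v))
    + expR (n.+1%:R * (e - delta / 2)) * (m%:R * nrm v))) //.
    apply: lerD; rewrite ler_wpM2l ?expR_ge0 // (le_trans h1) //.
    by rewrite ler_wpM2l ?expR_ge0.
  rewrite (@le_trans _ _ (m%:R * (expR (e - chi) * z + expR (e - delta / 2) * z)
    * nrm v)) //; last first.
    by rewrite /c1 -mulrDl mulrA.
  have E1 : expR (n.+1%:R * (e - chi)) * expR (n%:R * e) * expR
    (n%:R * (chi - delta / 2)) = expR (e - chi) * z.
    by rewrite /z -!expRD nS; congr expR; ring.
  have E2 : expR (n.+1%:R * (e - delta / 2)) = expR (e - delta / 2) * expR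
    (n%:R * (e - delta / 2)).
    by rewrite -expRD nS; congr expR; ring.
  have -> : expR (n.+1%:R * (e - chi)) *
    (expR (n%:R * e) * (m%:R * expR (n%:R * (chi - delta / 2)) * nrm v))
    = m%:R * (expR (e - chi) * z) * nrm v.
    by rewrite -E1; ring.
  have -> : m%:R * (expR (e - chi) * z + expR (e - delta / 2) * z) * nrm v =
    m%:R * (expR (e - chi) * z) * nrm v + expR (e - delta / 2) * z *
      (m%:R * nrm v) by ring.
  rewrite lerD2l ler_wpM2r ?mulr_ge0 ?nrm_ge0 //.
  by rewrite E2 ler_wpM2l ?expR_ge0.
have D2 (v : 'cV_m) : nrm ((S n.+1 - S n *m S n.+1) *m v) <= c2 * z * nrm v.
  rewrite mulmxBl -mulmxA (le_trans (Gn _)) //.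
  have := slow_ridge_contract n.+1 v; have := slow_ridge_img n.+1 v.
  have : nrm (B n *m (S n.+1 *m v)) <= expR (n%:R * e) * nrm
    (B n.+1 *m (S n.+1 *m v)).
    have {1}-> : B n = invmx (L n) *m B n.+1 by rewrite BL mulKmx.
    by rewrite -mulmxA (le_trans (nrmM _ _)) // ler_wpM2r ?nrm_ge0.
  move=> h1 h2 h3.
  rewrite (@le_trans _ _ (expR (n%:R * (e - chi)) *
    (expR (n%:R * e) * (m%:R * expR (n.+1%:R * (chi - delta / 2)) * nrm v))
    + expR (n%:R * (e - delta / 2)) * (m%:R * nrm v))) //.
    apply: lerD; rewrite ler_wpM2l ?expR_ge0 // (le_trans h1) //.
    by rewrite ler_wpM2l ?expR_ge0.
  have E1 : expR (n%:R * (e - chi)) * expR (n%:R * e) * expR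
    (n.+1%:R * (chi - delta / 2)) = expR (chi - delta / 2) * z.
    by rewrite /z -!expRD nS; congr expR; ring.
  have -> : expR (n%:R * (e - chi)) *
    (expR (n%:R * e) * (m%:R * expR (n.+1%:R * (chi - delta / 2)) * nrm v))
    = m%:R * (expR (chi - delta / 2) * z) * nrm v.
    by rewrite -E1; ring.
  have -> : c2 * z * nrm v = m%:R * (expR (chi - delta / 2) * z) * nrm v + z *
    (m%:R * nrm v).
    by rewrite /c2; ring.
  by rewrite lerD2l ler_wpM2r // mulr_ge0 ?nrm_ge0.
have {}D1 := nrm_op_le D1; have {}D2 := nrm_op_le D2.
have Ssym k : (S k)^T = S k by exact: ridge_sym.
(* Transposition reverses the product of the two symmetric matrices, so that it cancels against the
   product in [D1]. *)
have {}D2 : nrm (S n.+1 - S n.+1 *m S n) <= m%:R * (c2 * z).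
  rewrite -nrm_tr [(_ - _)^T]linearB /= trmx_mul !Ssym; exact: D2.
have -> : S n.+1 - S n = (S n.+1 - S n.+1 *m S n) - (S n - S n.+1 *m S n).
  by rewrite opprB addrA subrK.
rewrite (le_trans (nrmB _ _)) // (le_trans (lerD D2 D1)) //.
rewrite (@le_trans _ _ (expR (n%:R * (delta / 8)) * z)) //.
  have -> : m%:R * (c2 * z) + m%:R * (c1 * z) = (m%:R * c1 + m%:R * c2) * z by
    ring.
  by rewrite ler_wpM2r.
rewrite /z -expRD ler_expR -mulrDr ler_wpM2l //; rewrite /e; lra.
Unshelve. all: by end_near. Qed.

Lemma slow_proj_near : exists2 c : R, 0 <= c &
  \forall n \near \oo, nrm (P - S n) <= c * expR (n%:R * - (delta / 4)).
Proof.
pose q := expR (- (delta / 4)).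
have q01 : 0 < q < 1 by rewrite expR_gt0 expR_lt1 oppr_lt0 divr_gt0.
have qX n : q ^+ n = expR (n%:R * - (delta / 4)) by rewrite expRM_natl.
exists ((m * m)%:R / (1 - q)).
  by rewrite divr_ge0 // subr_ge0 ltW //; case/andP: q01.
have H : \forall n \near \oo, nrm (P - S n) <= (m * m)%:R * (q ^+ n / (1 - q)).
  apply: limn_mx_nrm_le => i k; apply: (geometric_cauchy q01 _).2.
  apply: filterS slow_ridge_cauchy => n Hn; rewrite qX (le_trans _ Hn) //.
  by have := ler_nrm (S n.+1 - S n) i k; rewrite !mxE.
by apply: filterS H => n; rewrite -qX -mulrA [_^-1 * _]mulrC.
Qed.

Lemma slow_ridge_cvg i k : (fun n => S n i k) @ \oo --> P i k.
Proof.
pose q := expR (- (delta / 4)).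
have q01 : 0 < q < 1 by rewrite expR_gt0 expR_lt1 oppr_lt0 divr_gt0.
have qX n : q ^+ n = expR (n%:R * - (delta / 4)) by rewrite expRM_natl.
rewrite mxE; apply: (geometric_cauchy q01 _).1.
apply: filterS slow_ridge_cauchy => n Hn; rewrite qX (le_trans _ Hn) //.
by have := ler_nrm (S n.+1 - S n) i k; rewrite !mxE.
Qed.

Lemma slow_proj_sym : P^T = P.
Proof.
apply/matrixP => i k; rewrite 3!mxE; congr (lim _).
suff -> : (fun n => S n k i) = (fun n => S n i k) by [].
by apply/funext => n; rewrite -[in RHS](_ : (S n)^T = S n) ?mxE //;
  exact: ridge_sym.
Qed.

(** On its own image [S n] has a small defect: [slow_ridge_img] and [slow_ridge_defect] bound
    [S n - S n *m S n] by a multiple of exp (- n delta / 4), and [P - S n] is of the same order. *)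
Lemma slow_proj_idem : P *m P = P.
Proof.
suff : nrm (P - P *m P) = 0 by move/nrm_eq0/subr0_eq.
apply/eqP; rewrite eq_le nrm_ge0 andbT; apply/ler_addgt0Pr => eta eta0;
  rewrite add0r.
have [c c0 PS] := slow_proj_near.
have a0 : 0 < delta / 4 by rewrite divr_gt0.
have G := slow_ridge_defect a0.
pose M := m%:R * m%:R : R.
pose k := c * (1 + M + nrm P) + m%:R * (m%:R * 2).
near \oo => n.
have PSn : nrm (P - S n) <= c * expR (n%:R * - (delta / 4)) by near: n.
have Gn : forall v : 'cV_m, nrm (v - S n *m v) <= expR
  (n%:R * (delta / 4 - chi)) * nrm (B n *m v)
            + expR (n%:R * (delta / 4 - delta / 2)) * nrm v by near: n.
have kn : k * expR (n%:R * - (delta / 4)) <= eta by near: n;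
  exact: cst_expRN_le.
set z := expR (n%:R * - (delta / 4)) in PSn kn.
have z0 : 0 <= z by exact: expR_ge0.
have Sn : nrm (S n) <= M by apply: nrm_op_le => v; exact: slow_ridge_contract.
have SSn : nrm (S n - S n *m S n) <= m%:R * (m%:R * 2 * z).
  apply: nrm_op_le => v; rewrite mulmxBl -mulmxA (le_trans (Gn _)) //.
  have -> : delta / 4 - delta / 2 = - (delta / 4) by field.
  rewrite -/z; have -> : m%:R * 2 * z * nrm v = m%:R * z * nrm v + z *
    (m%:R * nrm v) by ring.
  apply: lerD; last by rewrite ler_wpM2l ?slow_ridge_contract.
  rewrite (@le_trans _ _ (expR (n%:R * (delta / 4 - chi)) *
     (m%:R * expR (n%:R * (chi - delta / 2)) * nrm v))) //.
    by rewrite ler_wpM2l ?expR_ge0 // slow_ridge_img.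
  rewrite mulrA ler_wpM2r ?nrm_ge0 // mulrCA ler_wpM2l // -expRD.
  by rewrite le_eqVlt; apply/orP; left; apply/eqP; congr expR; field.
have -> : P - P *m P = (P - S n) + (S n - S n *m S n)
    - ((P - S n) *m S n + P *m (P - S n)).
  rewrite mulmxBl mulmxBr; move: (P *m S n) (S n *m S n) (P *m P) => X Y Z.
  by apply/matrixP => a b; rewrite !mxE; ring.
rewrite (le_trans _ kn) // (le_trans (nrmB _ _)) //.
apply: (le_trans (lerD (nrmD _ _) (nrmD _ _))).
have h1 : nrm ((P - S n) *m S n) <= c * z * M.
  by rewrite (le_trans (nrmM _ _)) // ler_pM ?nrm_ge0.
have h2 : nrm (P *m (P - S n)) <= nrm P * (c * z).
  by rewrite (le_trans (nrmM _ _)) // ler_wpM2l ?nrm_ge0.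
have -> : k * z = (c * z + m%:R * (m%:R * 2 * z)) +
  (c * z * M + nrm P * (c * z)).
  by rewrite /k; ring.
by apply: lerD; apply: lerD.
Unshelve. all: by end_near. Qed.

(** In B v = B S v + B (P - S) v the first term has rate at most chi - delta / 2 and the second chi
    + delta / 16 - delta / 4. Both are below chi - delta / 8, and the constants cost a further delta
    / 16. *)
Lemma slow_proj_fixed (v : 'cV_m) : P *m v = v ->
  \forall n \near \oo, nrm (B n *m v) <= expR (n%:R * (chi - delta / 16)).
Proof.
move=> Pv; have [c c0 PS] := slow_proj_near.
have a0 : 0 < delta / 16 by rewrite divr_gt0.
near=> n.
have PSn : nrm (P - S n) <= c * expR (n%:R * - (delta / 4)) by near: n.
have Bn : nrm (B n) <= expR (n%:R * (chi + delta / 16)) by near: n; exact: B_le.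
have kn : (m%:R + c) * nrm v <= expR (n%:R * (delta / 16)).
  by near: n; exact: cst_le_expR.
have n0 : 0 <= n%:R :> R by [].
rewrite -[v]Pv (_ : P = S n + (P - S n)); last by rewrite addrC subrK.
rewrite mulmxDl mulmxDr (le_trans (nrmD _ _)) //.
rewrite (@le_trans _ _ (((m%:R + c) * nrm v) * expR (n%:R * (chi - delta / 8))))
  //.
  rewrite mulrDl mulrDl; apply: lerD.
    rewrite (le_trans (slow_ridge_img _ _)) // mulrAC ler_wpM2l ?mulr_ge0
      ?nrm_ge0 //.
    by rewrite ler_expR ler_wpM2l //; lra.
  rewrite mulmxA (le_trans (nrmM _ _)) // [c * _ * _]mulrAC.
  rewrite ler_wpM2r ?nrm_ge0 //.
  rewrite (@le_trans _ _ (expR (n%:R * (chi + delta / 16)) *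
    (c * expR (n%:R * - (delta / 4))))) //.
    by rewrite (le_trans (nrmM _ _)) // ler_pM ?nrm_ge0.
  rewrite mulrCA ler_wpM2l // -expRD ler_expR -mulrDr ler_wpM2l //; lra.
rewrite (@le_trans _ _ (expR (n%:R * (delta / 16)) * expR
  (n%:R * (chi - delta / 8)))) //.
  by rewrite ler_wpM2r ?expR_ge0.
by rewrite -expRD ler_expR -mulrDr ler_wpM2l //; lra.
Unshelve. all: by end_near. Qed.

(** If [B n] sent [v] below exp (n (chi - e)) for a large n, the defect estimate would bring
    [S n *m v], hence [P *m v], within half of the fixed positive distance [eta] of [v]. *)
Lemma slow_proj_moved (v : 'cV_m) : P *m v != v -> forall e : R, 0 < e ->
  \forall n \near \oo, expR (n%:R * (chi - e)) <= nrm (B n *m v).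
Proof.
move=> Pv e e0; have [c c0 PS] := slow_proj_near.
pose eta := nrm (v - P *m v).
have eta0 : 0 < eta.
  rewrite lt_neqAle nrm_ge0 andbT eq_sym; apply: contra Pv => /eqP.
  by move/nrm_eq0/subr0_eq <-.
pose a := Num.min (e / 2) (delta / 4).
have a0 : 0 < a by rewrite lt_min !divr_gt0.
have [ae ad] : a <= e / 2 /\ a <= delta / 4 by rewrite !ge_min !lexx orbT.
have G := slow_ridge_defect a0.
near=> n.
have PSn : nrm (P - S n) <= c * expR (n%:R * - (delta / 4)) by near: n.
have Gn : forall v : 'cV_m, nrm (v - S n *m v) <= expR (n%:R * (a - chi)) * nrm
  (B n *m v)
            + expR (n%:R * (a - delta / 2)) * nrm v by near: n.
have kn : (1 + nrm v + c * nrm v) * expR (n%:R * - a) <= eta / 2.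
  by near: n; apply: cst_expRN_le => //; rewrite divr_gt0.
have n0 : 0 <= n%:R :> R by [].
rewrite leNgt; apply/negP => Bv.
have : eta <= eta / 2; last by lra.
rewrite (le_trans _ kn) // /eta.
have -> : v - P *m v = (v - S n *m v) - (P - S n) *m v.
  by rewrite mulmxBl opprB addrA subrK.
rewrite (le_trans (nrmB _ _)) // mulrDl; apply: lerD.
  rewrite (le_trans (Gn v)) // mulrDl mul1r; apply: lerD.
    rewrite (@le_trans _ _ (expR (n%:R * (a - chi)) * expR (n%:R * (chi - e))))
      //.
      by rewrite ler_wpM2l ?expR_ge0 // ltW.
    rewrite -expRD ler_expR -mulrDr ler_wpM2l //; lra.
  rewrite mulrC ler_wpM2l ?nrm_ge0 // ler_expR ler_wpM2l //; lra.
rewrite (le_trans (nrmM _ _)) // mulrAC ler_wpM2r ?nrm_ge0 //.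
rewrite (le_trans PSn) // ler_wpM2l // ler_expR ler_wpM2l //; lra.
Unshelve. all: by end_near. Qed.

End SlowSubspace.

(** * Subadditive ergodic theorem *)

Section Ergodic.
Context (d : measure_display) (Z : measurableType d) (R : realType).
Variables (P : probability Z R) (F : Z -> Z).
Hypothesis mF : measurable_fun setT F.
Hypothesis PF : forall A, measurable A -> P (F @^-1` A) = P A.

Definition birkhoff (psi : Z -> R) (n : nat) (x : Z) : R :=
  \sum_(k < n) psi (iter k F x).

Lemma birkhoffS (psi : Z -> R) n x : birkhoff psi n.+1 x = psi x + birkhoff psi
  n (F x).
Proof.
rewrite /birkhoff big_ord_recl /=; congr (_ + _).
by apply: eq_bigr => i _; rewrite /= -iterSr.
Qed.

Lemma birkhoffD (psi : Z -> R) n k x : birkhoff psi (n + k) x = birkhoff psi n x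
  + birkhoff psi k (iter n F x).
Proof.
elim: n x => [|n IH] x; first by rewrite /birkhoff big_ord0 add0r.
by rewrite addSn !birkhoffS IH addrA -iterSr.
Qed.

Lemma birkhoff_ge0 (psi : Z -> R) n x : (forall y, 0 <= psi y) -> 0 <= birkhoff
  psi n x.
Proof. by move=> psi0; apply: sumr_ge0. Qed.

Lemma le_birkhoff (psi : Z -> R) n k x : (forall y, 0 <= psi y) -> (n <= k)%N ->
  birkhoff psi n x <= birkhoff psi k x.
Proof. by move=> psi0 /subnKC <-; rewrite birkhoffD lerDl birkhoff_ge0. Qed.

Lemma measurable_iter k : measurable_fun setT (iter k F).
Proof.
elim: k => [|k IH]; first exact: measurable_id.
by apply: (measurableT_comp mF IH).
Qed.

Lemma measurable_birkhoff (psi : Z -> R) n : measurable_fun setT psi ->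
  measurable_fun setT (birkhoff psi n).
Proof.
move=> mpsi; apply: measurable_sum => i.
exact: measurableT_comp mpsi (measurable_iter i).
Qed.

Lemma iter_preserving k A : measurable A -> P (iter k F @^-1` A) = P A.
Proof.
elim: k A => [//|k IH] A mA; rewrite -[RHS]PF // -[RHS]IH //.
by rewrite -[X in measurable X]setTI; exact: mF.
Qed.

Lemma integral_iter (psi : Z -> R) k : measurable_fun setT psi ->
  (forall y, 0 <= psi y) ->
  (\int[P]_x (psi (iter k F x))%:E = \int[P]_x (psi x)%:E)%E.
Proof.
move=> mpsi psi0.
have := @ge0_integral_pushforward _ _ _ _ R _ (measurable_iter k) P setT
  (EFin \o psi) measurableT.
rewrite preimage_setT /= => <-; last 2 first.
- exact/measurable_EFinP.
- by move=> y _; rewrite lee_fin.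
apply: eq_measure_integral => [|mi A mA _]; first exact: measurable_iter.
exact: iter_preserving.
Qed.

Lemma integral_birkhoff (psi : Z -> R) n : measurable_fun setT psi ->
  (forall y, 0 <= psi y) ->
  (\int[P]_x (birkhoff psi n x)%:E = n%:R%:E * \int[P]_x (psi x)%:E)%E.
Proof.
move=> mpsi psi0; under eq_integral do rewrite /birkhoff -sumEFin.
rewrite ge0_integral_sum //; last 2 first.
- by move=> k; apply/measurable_EFinP; exact: measurableT_comp mpsi
  (measurable_iter k).
- by move=> k x _; rewrite lee_fin.
under eq_bigr do rewrite integral_iter //.
have I0 : (0 <= \int[P]_x (psi x)%:E)%E.
  by apply: integral_ge0 => x _; rewrite lee_fin.
elim: n => [|n IH]; first by rewrite big_ord0 mul0e.
by rewrite big_ord_recr /= IH -natr1 EFinD ge0_muleDl ?lee_fin // mul1e.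
Qed.

Definition excess (psi : Z -> R) (a : R) (N : nat) : set Z :=
  [set x | exists2 n : nat, (0 < n <= N)%N & a * n%:R < birkhoff psi n x].

Lemma measurable_excess (psi : Z -> R) a N : measurable_fun setT psi ->
  measurable (excess psi a N).
Proof.
move=> mpsi; rewrite (_ : excess _ _ _ =
  \bigcup_(n in [set n : nat | (0 < n <= N)%N])
  [set x | a * n%:R < birkhoff psi n x]); last first.
  by apply/seteqP; split=> x [n]; exists n.
apply: bigcup_measurable => n _.
rewrite -[X in measurable X]setTI.
by apply: (@measurable_fun_ltr _ _ _ _ (cst (a * n%:R)) _ _ _ _ [set true]) =>
  //; exact: measurable_birkhoff.
Qed.

(* Greedily cover [0, n[ by windows of length at most N over which [psi] has
   average more than [a], starting at each visit to the excess set. *)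
Lemma excess_cover (psi : Z -> R) a N n x : (forall y, 0 <= psi y) -> 0 <= a ->
  a * birkhoff \1_(excess psi a N) n x <= birkhoff psi (n + N) x.
Proof.
move=> psi0 a0; have [k] := ubnP n; elim: k n x => // k IH [|n] x nk.
  by rewrite /birkhoff big_ord0 mulr0 birkhoff_ge0.
have one_le p y : birkhoff \1_(excess psi a N) p y <= p%:R.
  rewrite /birkhoff (@le_trans _ _ (\sum_(i < p) 1)) //;
    last by rewrite sumr_const card_ord.
  by apply: ler_sum => i _; rewrite indicE lern1 leq_b1.
have [[l /andP[l0 lN] xl]|xE] := pselect (excess psi a N x); last first.
  rewrite birkhoffS addSn birkhoffS indicE memNset // add0r.
  by rewrite (le_trans (IH _ _ _)) // lerDr.
have [nl|ln] := leqP n.+1 l.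
  rewrite (@le_trans _ _ (a * l%:R)) //.
    by rewrite ler_wpM2l // (le_trans (one_le _ _)) // ler_nat.
  by rewrite (le_trans (ltW xl)) // le_birkhoff // (leq_trans lN) // leq_addl.
rewrite -(subnKC (ltnW ln)) -addnA birkhoffD [leRHS]birkhoffD mulrDr lerD //.
  by rewrite (le_trans _ (ltW xl)) // ler_wpM2l.
apply: IH; rewrite -(ltn_add2l l) subnKC ?(ltnW ln) // (leq_trans nk) //.
by rewrite -add1n leq_add2r.
Qed.

(** A maximal inequality of weak type, uniform in the horizon [N]. It integrates [excess_cover] with
    n = N: the left side has N terms and the right side 2 N, whence the factor 2. *)
Lemma excess_measure (psi : Z -> R) a N : measurable_fun setT psi ->
  (forall y, 0 <= psi y) ->
  0 <= a -> (a%:E * P (excess psi a N) <= 2%:E * \int[P]_x (psi x)%:E)%E.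
Proof.
move=> mpsi psi0 a0; case: N => [|N].
  rewrite (_ : excess _ _ _ = set0) ?measure0 ?mule0 //.
    by rewrite mule_ge0 // integral_ge0 // => x _; rewrite lee_fin.
  by apply/seteqP; split=> x [] // [].
have mE := measurable_excess a N.+1 mpsi.
have mI : measurable_fun setT (\1_(excess psi a N.+1) : Z -> R).
  exact: measurable_indic.
have : (\int[P]_x (a * birkhoff \1_(excess psi a N.+1) N.+1 x)%:E <=
        \int[P]_x (birkhoff psi (N.+1 + N.+1) x)%:E)%E.
  apply: ge0_le_integral => //.
  - by move=> x _; rewrite lee_fin mulr_ge0 // birkhoff_ge0 // => y;
    rewrite indicE.
  - apply/measurable_EFinP; apply: measurable_funM => //.
    exact: measurable_birkhoff mI.
  - by apply/measurable_EFinP; exact: measurable_birkhoff.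
  - by move=> x _; rewrite lee_fin excess_cover.
rewrite integral_birkhoff //.
under eq_integral do rewrite EFinM.
rewrite ge0_integralZl_EFin //; last 2 first.
- by move=> x _; rewrite lee_fin birkhoff_ge0 // => y; rewrite indicE.
- by apply/measurable_EFinP; exact: measurable_birkhoff mI.
rewrite integral_birkhoff //.
rewrite integral_indic // setIT addnn -mul2n natrM EFinM -muleA.
rewrite muleCA [(_%:E * (N.+1%:R%:E * _))%E]muleCA.
by rewrite lee_pmul2l // lte_fin ltr0n.
Qed.

Lemma excess_ever (psi : Z -> R) a : measurable_fun setT psi ->
  (forall y, 0 <= psi y) ->
  0 <= a ->
  (a%:E * P (\bigcup_N excess psi a N) <= 2%:E * \int[P]_x (psi x)%:E)%E.
Proof.
move=> mpsi psi0 a0.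
have mE N : measurable (excess psi a N) by exact: measurable_excess.
have cvgE : P \o excess psi a @ \oo --> P (\bigcup_N excess psi a N).
  apply: nondecreasing_cvg_mu => //; first exact: bigcupT_measurable.
  move=> N N' NN'; apply/subsetPset => x [n /andP[n0 nN] xn].
  by exists n; rewrite // n0 (leq_trans nN).
have /cvg_lim <- // : (fun N => a%:E * P (excess psi a N))%E @ \oo -->
    (a%:E * P (\bigcup_N excess psi a N))%E.
  exact: cvgeZl.
apply: lime_le; first by apply/cvg_ex; eexists; apply: cvgeZl => //;
  exact: cvgE.
by near=> N; exact: excess_measure.
Unshelve. all: by end_near. Qed.

(** The integrals of [psi k] tend to 0 by dominated convergence, so by the maximal inequality the
    points where every [psi k] has some average above [e] form a null set. This takes the place of
    Birkhoff's theorem: averages need to be small, not convergent. *)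
Lemma ae_birkhoff_small (psi : nat -> Z -> R) (g : Z -> R) :
  (forall k, measurable_fun setT (psi k)) -> (forall k y, 0 <= psi k y <= g y)
    ->
  P.-integrable setT (EFin \o g) -> (forall y, psi k y @[k --> \oo] --> 0) ->
  {ae P, forall x, forall e : R, 0 < e ->
    exists k, forall n, birkhoff (psi k) n x <= e * n%:R}.
Proof.
move=> mpsi psi_g ig psi_cvg.
have psi0 k y : 0 <= psi k y by case/andP: (psi_g k y).
have int_cvg : (\int[P]_x (psi k x)%:E)%E @[k --> \oo] --> 0%E.
  have := @dominated_convergence _ _ R P setT measurableT
    (fun k => EFin \o psi k) (cst 0%E) (EFin \o g).
  case=> //.
  - by move=> k; exact/measurable_EFinP.
  - by apply: aeW => x _; apply: cvg_EFin; [exact: nearW|exact: psi_cvg].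
  - apply: aeW => x k _ /=; rewrite lee_fin ger0_norm //.
    by case/andP: (psi_g k x).
  - by move=> _ _; rewrite integral0.
have bad (e : R) : 0 < e -> P.-negligible
  (\bigcap_k \bigcup_N excess (psi k) e N).
  move=> e0; have mB : measurable (\bigcap_k \bigcup_N excess (psi k) e N).
    by apply: bigcapT_measurable => k; apply: bigcupT_measurable => N;
      exact: measurable_excess.
  apply/negligibleP => //; apply/eqP; rewrite eq_le measure_ge0 andbT.
  rewrite -(@lee_pmul2l _ e%:E) // mule0.
  have {}int_cvg : (2%:E * \int[P]_x (psi k x)%:E)%E @[k --> \oo] --> 0%E.
    by rewrite -[X in _ --> X](mule0 2%:E); apply: cvgeZl.
  rewrite -(cvg_lim _ int_cvg) //; apply: lime_ge; first by apply/cvg_ex;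
    exists 0%E.
  near=> k; apply: le_trans (excess_ever (mpsi k) (psi0 k) (ltW e0)).
  rewrite lee_pmul2l // le_measure ?inE //.
    by apply: bigcupT_measurable => N; exact: measurable_excess.
  exact: bigcap_inf.
have : P.-negligible (\bigcup_i \bigcap_k \bigcup_N excess (psi k) i.+1%:R^-1
  N).
  by apply: negligible_bigcup => i; apply: bad; rewrite invr_gt0.
apply: negligibleS => x /= /existsNP[e /not_implyP[e0 xe]].
have [i ie] : exists i : nat, i.+1%:R^-1 <= e.
  have /ltW h : e^-1 < (Num.truncn e^-1).+1%:R by exact: truncnS_gt.
  by exists (Num.truncn e^-1); rewrite -[leRHS]invrK lef_pV2 ?posrE ?invr_gt0.
exists i => // k _; apply: contrapT => xk; apply: xe; exists k => n.
rewrite leNgt; apply/negP => nx; apply: xk; exists n => //; exists n.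
  rewrite leqnn andbT lt0n; apply: contraTneq nx => ->.
  by rewrite mulr0 /birkhoff big_ord0 ltxx.
by rewrite (le_lt_trans _ nx) // ler_wpM2r.
Unshelve. all: by end_near. Qed.

Lemma le_birkhoff_fun (f g : Z -> R) n x : (forall y, f y <= g y) ->
  birkhoff f n x <= birkhoff g n x.
Proof. by move=> fg; apply: ler_sum. Qed.

Lemma birkhoff_cstD c (f : Z -> R) n x :
  birkhoff (fun y => c + f y) n x = c * n%:R + birkhoff f n x.
Proof.
by rewrite /birkhoff big_split /= sumr_const card_ord mulr_natr.
Qed.

(** * Birkhoff sums of an integrable function *)

Section Integrable.
Variable phi : Z -> R.
Hypothesis mphi : measurable_fun setT phi.
Hypothesis phi0 : forall y, 0 <= phi y.
Hypothesis iphi : P.-integrable setT (EFin \o phi).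

(** Truncation at height k: the tails are dominated by [phi] and vanish pointwise, so their averages
    are small, and [phi] is at most k plus its tail. *)
Let tail (k : nat) (y : Z) : R := phi y * \1_[set z | k%:R < phi z] y.

Let ae_tail : {ae P, forall x, forall e : R, 0 < e ->
    exists k, forall n, birkhoff (tail k) n x <= e * n%:R}.
Proof.
apply: ae_birkhoff_small iphi _ => [k|k y|y].
- apply: measurable_funM => //; apply: measurable_indic.
  rewrite -[X in measurable X]setTI.
  by apply: (@measurable_fun_ltr _ _ _ _ (cst k%:R) _ _ _ _ [set true]).
- rewrite /tail indicE; case: (_ \in _); rewrite ?mulr1 ?mulr0 ?phi0 ?lexx //.
- apply: (@cvg_near_cst _ _ _ _ _) => //; near=> k.
  rewrite /tail indicE memNset ?mulr0 //=; apply/negP; rewrite -leNgt.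
  by near: k; exact: nbhs_infty_ger.
Unshelve. all: by end_near. Qed.

Let le_tail k y : phi y <= k%:R + tail k y.
Proof.
rewrite /tail indicE; have [yk|ky] := leP (phi y) k%:R.
  by rewrite (le_trans yk) // lerDl mulr_ge0.
by rewrite mem_set // mulr1 lerDr.
Qed.

Lemma ae_birkhoff_bounded :
  {ae P, forall x, exists C : R, forall n, birkhoff phi n x <= C * n%:R}.
Proof.
apply: filterS ae_tail => x /(_ 1 ltr01)[k xk]; exists (k%:R + 1) => n.
by rewrite (le_trans (le_birkhoff_fun _ _ (le_tail k))) // birkhoff_cstD mulrDl
  lerD2l.
Qed.

Lemma ae_sublinear : {ae P, forall x, forall e : R, 0 < e ->
  \forall n \near \oo, phi (iter n F x) <= e * n%:R}.
Proof.
apply: filterS ae_tail => x H e e0; have e20 : 0 < e / 2 by rewrite divr_gt0.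
have [k xk] := H _ e20; near=> n.
(* A single term of a nonnegative Birkhoff sum of length n + 1 is at most the whole sum. *)
rewrite (le_trans (le_tail k _)) // (@le_trans _ _ (k%:R + e / 2 * n.+1%:R)) //.
  rewrite lerD2l (le_trans _ (xk n.+1)) // /birkhoff big_ord_recr /= lerDr.
  by apply: sumr_ge0 => i _; rewrite mulr_ge0.
have : (k%:R + e / 2) / (e / 2) <= n%:R by near: n; exact: nbhs_infty_ger.
rewrite ler_pdivrMr // -[n.+1]addn1 natrD => h.
by rewrite mulrDr mulr1 addrCA -lerBrDl (le_trans h) // mulrC; lra.
Unshelve. all: by end_near. Qed.

(** * Kingman's theorem on a forward invariant set *)

Section Kingman.
Variables (D : set Z) (g : nat -> Z -> R).
Hypothesis mD : measurable D.
Hypothesis DF : forall x, D x -> D (F x).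
Hypothesis mg : forall n, measurable_fun D (g n).
Hypothesis g_sub : forall x n l, D x -> (0 < n)%N -> (0 < l)%N ->
  g (n + l) x <= g n x + g l (iter n F x).
Hypothesis g_step : forall x n, D x -> (0 < n)%N -> `|g n.+1 x - g n (F x)| <=
  phi x.
Hypothesis g_one : forall x, D x -> `|g 1%N x| <= phi x.

Lemma subadditive_bound n x : D x -> (0 < n)%N -> `|g n x| <= birkhoff phi n x.
Proof.
elim: n x => // -[|n] IH x Dx _; first by rewrite /birkhoff big_ord1 g_one.
rewrite birkhoffS -[g _ x](subrK (g n.+1 (F x))) (le_trans (ler_normD _ _)) //.
by rewrite lerD // ?g_step // IH //; exact: DF.
Qed.

(* The set where liminf g_n / n <= b. *)
Definition low (b : R) : set Z := [set y | D y /\ forall k N : nat,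
  exists2 n : nat, (N <= n)%N & g n y < (b + k.+1%:R^-1) * n%:R].

Let mset_lt (c : R) n : measurable (D `&` [set y | g n y < c]).
Proof.
exact: (@measurable_fun_ltr _ _ _ _ (g n) (cst c) _ _ mD [set true]).
Qed.

Let mset_gt (c : R) n : measurable (D `&` [set y | c < g n y]).
Proof.
exact: (@measurable_fun_ltr _ _ _ _ (cst c) (g n) _ _ mD [set true]).
Qed.

Lemma measurable_low b : measurable (low b).
Proof.
rewrite (_ : low b = D `&` \bigcap_k \bigcap_N
  \bigcup_(n in [set n | (N <= n)%N])
    (D `&` [set y | g n y < (b + k.+1%:R^-1) * n%:R])).
  apply: measurableI => //; apply: bigcapT_measurable => k.
  by apply: bigcapT_measurable => N; apply: bigcup_measurable => n _;
    exact: mset_lt.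
apply/seteqP; split=> y /= [Dy H]; split => //.
  by move=> k _ N _; have [n Nn yn] := H k N; exists n.
by move=> k N; have [n Nn [_ yn]] := H k I N I; exists n.
Qed.

Lemma low_invariant b x : low b x -> low b (F x).
Proof.
move=> [Dx H]; split => [|k N]; first exact: DF.
(* Half of the slack 1 / (k + 1) pays for [c], the cost of passing from time n + 1 at [x] to time n
   at [F x]. *)
pose c := b + (2 * k.+1)%:R^-1 + phi x.
have [M HM] : exists M : nat, c * (2 * k.+1)%:R <= M%:R.
  exists (Num.truncn (c * (2 * k.+1)%:R)).+1; exact/ltW/truncnS_gt.
have [[|n] Nn xn] := H (2 * k).+1 (maxn (N + M) 1).+1; first by [].
have k2 : (2 * k).+2%:R = (2 * k.+1)%:R :> R by rewrite mulnS.
have NMn : (N + M <= n)%N by rewrite (leq_trans (leq_maxl _ 1)).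
have n0 : (0 < n)%N by rewrite (leq_trans (leq_maxr (N + M) 1)).
exists n; first by rewrite (leq_trans (leq_addr M N)).
have Mn : (M <= n)%N by rewrite (leq_trans (leq_addl N M)).
have := g_step Dx n0; rewrite ler_norml => /andP[h _].
rewrite k2 in xn.
have {}h : g n (F x) < (b + (2 * k.+1)%:R^-1) * n.+1%:R + phi x.
  by move: h xn; move: ((b + _) * _) => t; lra.
apply: (lt_le_trans h); rewrite -[n.+1]addn1 natrD mulrDr mulr1 -addrA -/c.
have k0 : 0 < (2 * k.+1)%:R :> R by rewrite ltr0n.
have cn : c <= (2 * k.+1)%:R^-1 * n%:R.
  rewrite mulrC ler_pdivlMr // (le_trans HM) // ler_nat //.
have -> : k.+1%:R^-1 = (2 * k.+1)%:R^-1 + (2 * k.+1)%:R^-1 :> R.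
  by rewrite natrM; field; rewrite addrC natr1 pnatr_eq0.
by move: cn; rewrite /c; move: (_%:R^-1) (phi x) (n%:R) => i y z; lra.
Qed.

Section Cover.
Variables (b eps : R).
Hypothesis eps0 : 0 < eps.

(** The summand [|b| + eps] ensures b + eps + h y >= phi y even when b is negative, so a step
    charged to [h] also covers the rate b + eps credited to it. *)
Let h (y : Z) : R := (`|b| + eps) + phi y.

Let h0 y : 0 <= h y.
Proof. by rewrite !addr_ge0 // ltW. Qed.

(** These sets decrease to the empty set: every point of [low b] reaches a rate of at most b + eps
    at some time. *)
Let bad (N : nat) : set Z :=
  low b `&` [set y | forall l, (0 < l <= N)%N -> (b + eps) * l%:R < g l y].

Let mbad N : measurable (bad N).
Proof.
rewrite (_ : bad N = low b `&` \bigcap_(l in [set l | (0 < l <= N)%N])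
    (D `&` [set y | (b + eps) * l%:R < g l y])).
  apply: measurableI; first exact: measurable_low.
  by apply: bigcap_measurableType => l _; exact: mset_gt.
apply/seteqP; split=> y /= [ly H]; split => // l lN.
  by split; [case: ly|exact: H].
by have [] := H l lN.
Qed.

Let w (N : nat) (y : Z) : R := h y * \1_(bad N) y.

Let w0 N y : 0 <= w N y.
Proof. by rewrite mulr_ge0. Qed.

(* Steps of length at most [N] over which [g] grows at rate at most [b + eps]
   cover [0, n[ up to single steps at bad points, charged to [w], and a final
   stretch of length [s]. *)
Lemma low_cover N n x : (0 < n)%N -> low b x -> exists s,
  [/\ (s <= N)%N, (s <= n)%N & g n x <= (b + eps) * n%:R + birkhoff (w N)
    (n - s) x
    + birkhoff h s (iter (n - s) F x)].
Proof.
have b_h : 0 <= b + eps + (`|b| + eps).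
  have := ler_norm (- b); rewrite normrN; move: eps0; lra.
have [k] := ubnP n; elim: k n x => // k IH n x nk n0 lx; have Dx := lx.1.
have [xB|xB] := pselect (bad N x).
  have wx : w N x = h x by rewrite /w indicE mem_set // mulr1.
  have g1 : g 1%N x <= (b + eps) + w N x.
    rewrite wx (le_trans (ler_norm _)) // (le_trans (g_one Dx)) //.
    by rewrite /h addrA lerDr.
  case: n n0 nk => // -[_ _|n _ nk].
    exists 0%N; split => //; rewrite subn0 /birkhoff big_ord0 addr0 big_ord1
      mulr1 //.
  have [|s [sN sn gn]] := IH n.+1 (F x) _ (ltn0Sn _) (low_invariant lx).
    by rewrite -ltnS.
  exists s; split => //; first exact: leqW.
  rewrite subSn // birkhoffS iterSr.
  have := @g_sub x 1 n.+1 Dx isT isT; rewrite add1n => /le_trans; apply.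
  apply: (le_trans (lerD g1 gn)); rewrite -[n.+2]addn1 natrD; lra.
have [l /andP[l0 lN] gl] : exists2 l, (0 < l <= N)%N & g l x <= (b + eps) *
  l%:R.
  apply: contrapT => H; apply: xB; split => // l lN.
  by rewrite ltNge; apply/negP => gl; apply: H; exists l.
have [nl|ln|nl] := ltngtP n l.
- exists n; rewrite subnn (leq_trans (ltnW nl)) //; split => //.
  rewrite (le_trans (ler_norm _)) // (le_trans (subadditive_bound Dx n0)) //.
  rewrite [birkhoff _ 0 _]/birkhoff big_ord0 addr0 /= birkhoff_cstD addrA
    -mulrDl.
  by rewrite lerDr mulr_ge0.
- have ln0 : (0 < n - l)%N by rewrite subn_gt0.
  have lxl : low b (iter l F x).
    by elim: (l) => // i Hi; rewrite iterS; exact: low_invariant.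
  have [|s [sN sn gn]] := IH (n - l)%N (iter l F x) _ ln0 lxl.
    by rewrite (leq_trans _ (_ : n <= k)%N) // ltn_subrL l0.
  have sn' : (s + l <= n)%N by rewrite addnC -leq_subRL // ltnW.
  exists s; split => //; first by rewrite (leq_trans sn) // leq_subr.
  have := @g_sub x l (n - l) Dx l0 ln0; rewrite subnKC ?(ltnW ln) //.
  move=> /le_trans; apply; apply: (le_trans (lerD gl gn)).
  have nE : (n - s = l + (n - l - s))%N by rewrite subnAC subnKC // leq_subRL //
    (leq_trans (leq_addr l s)).
  rewrite nE birkhoffD -iterD [(_ + l)%N]addnC.
  have := @birkhoff_ge0 (w N) l x (w0 N).
  rewrite -[X in _ -> _ <= _ * X%:R + _ + _](subnKC (ltnW ln)) natrD; lra.
exists 0%N; split => //; rewrite subn0 /= [birkhoff _ 0 _]/birkhoff big_ord0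
  addr0 nl.
by rewrite (le_trans gl) // lerDl birkhoff_ge0.
Qed.

(** The four [eps] are: the rate b + eps inside the windows, the charge of the bad points once [N]
    is large, and the final stretch, whose constant part and whose growing part cost one each. *)
Lemma ae_low_upper : {ae P, forall x, low b x ->
  \forall n \near \oo, g n x <= (b + 4 * eps) * n%:R}.
Proof.
have mh : measurable_fun setT h by exact: measurable_funD.
have ih : P.-integrable setT (EFin \o h).
  rewrite (_ : EFin \o h = (EFin \o cst (`|b| + eps)%R) \+ (EFin \o phi))%E //.
  by apply: integrableD => //; exact: finite_measure_integrable_cst.
have ae_w : {ae P, forall x, forall e : R, 0 < e ->
    exists k, forall n, birkhoff (w k) n x <= e * n%:R}.
  apply: ae_birkhoff_small ih _ => [k|k y|y].
  - by apply: measurable_funM => //; exact: measurable_indic.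
  - rewrite /w indicE; case: (_ \in _); rewrite ?mulr1 ?mulr0 ?h0 ?lexx //.
  - have [l [l0 yl]] : exists l, (0 < l)%N /\
    (low b y -> g l y <= (b + eps) * l%:R).
      have [[_ ly]|] := pselect (low b y); last by exists 1%N.
      have [i ie] : exists i : nat, i.+1%:R^-1 <= eps.
        have /ltW i_gt : eps^-1 < (Num.truncn eps^-1).+1%:R by exact:
          truncnS_gt.
        by exists (Num.truncn eps^-1); rewrite -[leRHS]invrK lef_pV2 ?posrE
          ?invr_gt0.
      have [l l0 yl] := ly i 1%N; exists l; split => // _.
      by rewrite (le_trans (ltW yl)) // ler_wpM2r // lerD2l.
    apply: (@cvg_near_cst _ _ _ _ _) => //; near=> k.
    rewrite /w indicE memNset ?mulr0 // => -[ly /(_ l)].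
    rewrite l0 (_ : (l <= k)%N) ?ltNge ?yl //; last by near: k;
      exact: nbhs_infty_ge.
    by move=> /(_ isT).
apply: filterS2 ae_w (ae_sublinear) => x xw xphi lx.
have [N HN] := xw _ eps0.
pose c := `|b| + eps.
(* The final stretch has at most [N] terms, so bounding the growing part of each by this fraction of
   n keeps their sum below eps n. *)
have e0 : 0 < eps / N.+1%:R by rewrite divr_gt0.
have [M _ HM] := xphi _ e0.
near=> n.
have n0 : (0 < n)%N by near: n; exact: nbhs_infty_gt.
have Mn : (M + N <= n)%N by near: n; exact: nbhs_infty_ge.
have cn : N%:R * c / eps <= n%:R by near: n; exact: nbhs_infty_ger.
have [s [sN sn gn]] := low_cover N n0 lx.
rewrite (le_trans gn) //.
have hs : birkhoff h s (iter (n - s) F x) <= N%:R * (c + eps / N.+1%:R * n%:R).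
  rewrite (@le_trans _ _ (\sum_(i < s) (c + eps / N.+1%:R * n%:R))) //.
    apply: ler_sum => i _; rewrite /h lerD2l -iterD.
    have iN : (M <= i + (n - s))%N.
      rewrite (leq_trans _ (leq_addl _ _)) // leq_subRL ?(leq_trans sn) //.
      by rewrite (leq_trans _ Mn) // addnC leq_add2l.
    rewrite (le_trans (HM _ iN)) // ler_wpM2l ?(ltW e0) // ler_nat.
    by rewrite -[leqRHS](subnKC sn) leq_add2r ltnW.
  rewrite sumr_const card_ord -[leLHS]mulr_natl ler_wpM2r ?ler_nat //.
  by rewrite addr_ge0 ?mulr_ge0 ?addr_ge0 // ?ltW.
have h1 : N%:R * (eps / N.+1%:R * n%:R) <= eps * n%:R.
  rewrite mulrA ler_wpM2r // mulrCA ger_pMr // ler_pdivrMr // mul1r ler_nat //.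
have h2 : N%:R * c <= eps * n%:R by rewrite [leRHS]mulrC -ler_pdivrMr.
have h3 := HN (n - s)%N.
have h4 : eps * (n - s)%:R <= eps * n%:R.
  by rewrite ler_wpM2l ?(ltW eps0) // ler_nat leq_subr.
move: hs h1 h2 h3 h4; rewrite mulrDr.
move: (N%:R * (_ * _)) (N%:R * c) (eps * (n - s)%:R) (birkhoff _ _ _)
  (birkhoff _ _ _) => *; lra.
Unshelve. all: by end_near. Qed.

End Cover.

Theorem kingman : {ae P, forall x, D x -> cvgn (fun n => g n x / n%:R)}.
Proof.
(* The exceptional set of [ae_low_upper] depends on the level and on eps, hence the restriction to
   rational levels and eps of the form 1 / (k + 1), enumerated through [pickle]. *)
have up : {ae P, forall x (q : rat) (k : nat), low (ratr q) x ->
    \forall n \near \oo, g n x <= (ratr q + 4 * k.+1%:R^-1) * n%:R}.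
  pose Q (i : nat) x := if unpickle i is Some q then forall k : nat, low
    (ratr q) x ->
    \forall n \near \oo, g n x <= (ratr q + 4 * k.+1%:R^-1) * n%:R else True.
  have aeQ i : {ae P, forall x, Q i x}.
    rewrite /Q; case: (unpickle i) => [q|]; last exact: aeW.
    by apply: ae_foralln => k; apply: ae_low_upper; rewrite invr_gt0.
  apply: filterS (ae_foralln aeQ) => x xQ q k.
  by have := xQ (pickle q); rewrite /Q pickleK; apply.
apply: filterS2 up ae_birkhoff_bounded => x xup [C xC] Dx.
have C0 : 0 <= C by have := xC 1%N; rewrite mulr1; apply: le_trans;
  rewrite birkhoff_ge0.
have gC n : (0 < n)%N -> `|g n x| <= C * n%:R.
  by move=> n0; rewrite (le_trans (subadditive_bound Dx n0)).
(* Up to its endpoint, [A] is the set of numbers above the liminf of g n x / n, so [inf A] is that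
   liminf and the candidate for the limit. *)
pose A := [set b : R | forall N : nat, exists2 n, (N <= n)%N & g n x < b *
  n%:R].
have A_low b : A b -> low b x.
  move=> Ab; split => // k N; have [n Nn gn] := Ab N.
  by exists n => //; rewrite (lt_le_trans gn) // ler_wpM2r // lerDl.
have A0 : A !=set0.
  exists (C + 1) => N; exists N.+1; rewrite // mulrDl mul1r.
  by rewrite (le_lt_trans (ler_norm _)) // (le_lt_trans (gC _ _)) // ltrDl.
have lbA : has_lbound A.
  exists (- C) => b Ab; have [n n0 gn] := Ab 1%N.
  have := gC _ n0; rewrite ler_norml => /andP[h _].
  rewrite leNgt; apply/negP => bC.
  have : b * n%:R <= - C * n%:R by rewrite ler_wpM2r // ltW.
  by rewrite mulNr => h'; move: (lt_le_trans gn h'); rewrite ltNge h.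
apply/cvg_ex; exists (inf A); apply/cvgrPdist_le => e e0.
have e40 : 0 < e / 2 by rewrite divr_gt0.
have [b Ab be] := inf_adherent e40 (conj A0 lbA).
have [q] := rat_in_itvoo be; rewrite in_itv /= => /andP[bq qe].
have [k ke] : exists k : nat, 4 * k.+1%:R^-1 <= e / 2.
  exists (Num.truncn (8 / e)).
  have /ltW h : 8 / e < (Num.truncn (8 / e)).+1%:R by exact: truncnS_gt.
  by rewrite ler_pdivrMr // mulrAC ler_pdivlMr // -ler_pdivrMl // mulrC;
    move: h; rewrite !ler_pdivrMr //; lra.
have Aq : A (ratr q).
  move=> N; have [n Nn gn] := Ab N; exists n => //.
  by rewrite (lt_le_trans gn) // ler_wpM2r // ltW.
have nA : ~ A (inf A - e) by move/(ge_inf lbA); rewrite lerBrDr gerDl leNgt e0.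
have [N HN] : exists N : nat, forall n, (N <= n)%N -> (inf A - e) * n%:R <= g n
  x.
  apply: contrapT => H; apply: nA => N; apply: contrapT => H'; apply: H.
  by exists N => n Nn; rewrite leNgt; apply/negP => gn; apply: H'; exists n.
near=> n.
have n0 : 0 < n%:R :> R by rewrite ltr0n; near: n; exact: nbhs_infty_gt.
have gn : g n x <= (ratr q + 4 * k.+1%:R^-1) * n%:R.
  by near: n; exact: (xup q k (A_low _ Aq)).
have gn' : (inf A - e) * n%:R <= g n x by apply: HN; near: n;
  exact: nbhs_infty_ge.
rewrite distrC ler_distl; apply/andP; split; first by rewrite ler_pdivlMr.
rewrite ler_pdivrMr // (le_trans gn) // ler_wpM2r ?(ltW n0) //.
by move: (ltW qe) ke; move: (4 * _) => t; lra.
Unshelve. all: by end_near. Qed.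

End Kingman.
End Integrable.
End Ergodic.

(** * One level of the filtration at a fixed point *)

Section Growth.
Variable R : realType.

Lemma cvg_ln_le (u : nat -> R) (l e : R) : (forall n, 0 < u n) -> 0 < e ->
  (fun n => ln (u n) / n%:R) @ \oo --> l ->
  \forall n \near \oo, u n <= expR (n%:R * (l + e)).
Proof.
move=> u0 e0 /cvgrPdist_le /(_ _ e0) H; near=> n.
have n0 : 0 < n%:R :> R by rewrite ltr0n; near: n; exact: nbhs_infty_gt.
have : `|l - ln (u n) / n%:R| <= e by near: n.
rewrite ler_distlC => /andP[_]; rewrite ler_pdivrMr // => h.
by rewrite -[u n]lnK ?posrE // ler_expR mulrC.
Unshelve. all: by end_near. Qed.

Lemma cvg_ln_ge (u : nat -> R) (l e : R) : (forall n, 0 < u n) -> 0 < e ->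
  (fun n => ln (u n) / n%:R) @ \oo --> l ->
  \forall n \near \oo, expR (n%:R * (l - e)) <= u n.
Proof.
move=> u0 e0 /cvgrPdist_le /(_ _ e0) H; near=> n.
have n0 : 0 < n%:R :> R by rewrite ltr0n; near: n; exact: nbhs_infty_gt.
have : `|l - ln (u n) / n%:R| <= e by near: n.
rewrite ler_distlC => /andP[+ _]; rewrite ler_pdivlMr // => h.
by rewrite -[u n]lnK ?posrE // ler_expR mulrC.
Unshelve. all: by end_near. Qed.

Lemma expR_squeeze (u : nat -> R) (l : R) :
  (forall e : R, 0 < e -> \forall n \near \oo, expR (n%:R * (l - e)) <= u n) ->
  (forall e : R, 0 < e -> \forall n \near \oo, u n <= expR (n%:R * (l + e))) ->
  (fun n => ln (u n) / n%:R) @ \oo --> l.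
Proof.
move=> lo hi; apply/cvgrPdist_le => e e0; near=> n.
have n0 : 0 < n%:R :> R by rewrite ltr0n; near: n; exact: nbhs_infty_gt.
have lon : expR (n%:R * (l - e)) <= u n by near: n; exact: lo.
have hin : u n <= expR (n%:R * (l + e)) by near: n; exact: hi.
have un : 0 < u n by rewrite (lt_le_trans _ lon) // expR_gt0.
rewrite ler_distlC ler_pdivlMr // ler_pdivrMr // ![_ * n%:R]mulrC.
by apply/andP; split; rewrite -ler_expR lnK ?posrE.
Unshelve. all: by end_near. Qed.

Lemma expR_growth_contra (l k c : R) : k < l ->
  (\forall n \near \oo, expR (n%:R * l) <= c * expR (n%:R * k)) -> False.
Proof.
move=> kl H; have lk : 0 < l - k by rewrite subr_gt0.
near \oo => n.
have h1 : expR (n%:R * l) <= c * expR (n%:R * k) by near: n.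
have h2 : c + 1 <= expR (n%:R * (l - k)) by near: n; exact: cst_le_expR.
have lE : expR (n%:R * l) = expR (n%:R * (l - k)) * expR (n%:R * k).
  by rewrite -expRD -mulrDr subrK.
move: h1; rewrite lE ler_pM2r ?expR_gt0 // => /(le_trans h2).
by rewrite gerDl ler10.
Unshelve. all: by end_near. Qed.

(** Neither a constant factor nor a shift of the index changes an exponential rate; this compares
    the rates at [z] and at [F z]. *)
Lemma growth_shift_le (u w : nat -> R) (l l' a : R) : 0 <= a ->
  (forall e : R, 0 < e -> \forall n \near \oo, expR (n%:R * (l - e)) <= u n) ->
  (forall e : R, 0 < e -> \forall n \near \oo, w n <= expR (n%:R * (l' + e))) ->
  (forall n, u n.+1 <= a * w n) -> l <= l'.
Proof.
move=> a0 ul wl uw; rewrite leNgt; apply/negP => ll.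
pose e := (l - l') / 3; have e0 : 0 < e by rewrite divr_gt0 // subr_gt0.
apply: (@expR_growth_contra (l - e) (l' + e) (expR (e - l) * a)).
  by rewrite /e; lra.
have H := near_succ (ul e e0); near=> n.
have h1 : expR (n.+1%:R * (l - e)) <= u n.+1 by near: n.
have h2 : w n <= expR (n%:R * (l' + e)) by near: n; exact: wl.
have -> : expR (n%:R * (l - e)) = expR (e - l) * expR (n.+1%:R * (l - e)).
  by rewrite -expRD -natr1; congr expR; ring.
rewrite -mulrA ler_wpM2l ?expR_ge0 // (le_trans h1) // (le_trans (uw n)) //.
by rewrite ler_wpM2l.
Unshelve. all: by end_near. Qed.

Lemma growth_shift_ge (u w : nat -> R) (l l' a : R) : 0 <= a ->
  (forall e : R, 0 < e -> \forall n \near \oo, u n <= expR (n%:R * (l + e))) ->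
  (forall e : R, 0 < e -> \forall n \near \oo, expR (n%:R * (l' - e)) <= w n) ->
  (forall n, w n <= a * u n.+1) -> l' <= l.
Proof.
move=> a0 ul wl uw; rewrite leNgt; apply/negP => ll.
pose e := (l' - l) / 3; have e0 : 0 < e by rewrite divr_gt0 // subr_gt0.
apply: (@expR_growth_contra (l' - e) (l + e) (a * expR (l + e))).
  by rewrite /e; lra.
have H := near_succ (ul e e0); near=> n.
have h1 : u n.+1 <= expR (n.+1%:R * (l + e)) by near: n.
have h2 : expR (n%:R * (l' - e)) <= w n by near: n; exact: wl.
rewrite (le_trans h2) // (le_trans (uw n)) // -mulrA ler_wpM2l //.
rewrite (le_trans h1) // -expRD ler_expR -natr1; lra.
Unshelve. all: by end_near. Qed.

(* With [c k] the growth rate of [vol k], the relevant gap is the one at [k]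
   equal to the multiplicity of the top rate plus one; minimizing over all [k]
   avoids selecting it and keeps the gap measurable. *)
Definition positive_or_one (x : R) : R := if 0 < x then x else 1.

Definition gap (m : nat) (c : nat -> R) : R :=
  \big[Num.min/1]_(k < m.+1) positive_or_one (k%:R * c 1%N - c k).

Lemma gap_gt0 m c : 0 < gap m c.
Proof.
rewrite /gap; elim/big_ind: _ => // [x y x0 y0|k _]; first by rewrite lt_min x0.
by rewrite /positive_or_one; case: ifPn.
Qed.

Lemma gap_le m c k : (k <= m)%N -> c k < k%:R * c 1%N ->
  gap m c <= k%:R * c 1%N - c k.
Proof.
move=> km ck; have k1 : (k < m.+1)%N by [].
rewrite /gap (bigD1 (Ordinal k1)) //= ge_min /positive_or_one.
by rewrite subr_gt0 ck lexx.
Qed.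

End Growth.

Section Step.
Variables (R : realType) (m : nat).
Variables (A L : nat -> 'M[R]_m) (Q : 'M[R]_m) (c : nat -> R).
Hypothesis A0 : A 0%N = 1%:M.
Hypothesis AL : forall n, A n.+1 = L n *m A n.
Hypothesis Lunit : forall n, L n \in unitmx.
Hypothesis L_le : forall e : R, 0 < e -> \forall n \near \oo,
  nrm (L n) <= expR (n%:R * e) /\ nrm (invmx (L n)) <= expR (n%:R * e).
Hypothesis Q_neq0 : Q != 0.
Hypothesis c_cvg : forall k : nat,
  (fun n => ln (vol k (A n *m Q)) / n%:R) @ \oo --> c k.

Let B n := A n *m Q.
Let chi := c 1%N.
Let delta := gap m c.

Lemma cocycle_unit n : A n \in unitmx.
Proof.
elim: n => [|n IH]; first by rewrite A0 unitmx1.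
by rewrite AL unitmx_mul Lunit.
Qed.

Lemma vol_cocycle_gt0 k n : 0 < vol k Q -> 0 < vol k (B n).
Proof.
move=> Qk; rewrite lt_neqAle vol_ge0 andbT eq_sym; apply: contraTneq Qk => B0.
rewrite -leNgt -[Q](mulKmx (cocycle_unit n)) (le_trans (vol_mulmx _ _ _)) //.
by rewrite -/(B n) B0 mulr0.
Qed.

Lemma vol_cocycle_eq0 k n : vol k Q = 0 -> vol k (B n) = 0.
Proof.
move=> Qk; apply/eqP; rewrite eq_le vol_ge0 andbT.
by rewrite (le_trans (vol_mulmx _ _ _)) // Qk mulr0.
Qed.

Let B_gt0 n : 0 < nrm (B n).
Proof.
rewrite -vol1; apply: vol_cocycle_gt0; rewrite vol1 lt_neqAle nrm_ge0 andbT.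
by apply: contra Q_neq0 => /eqP/esym/nrm_eq0 ->.
Qed.

Let chi_cvg : (fun n => ln (nrm (B n)) / n%:R) @ \oo --> chi.
Proof.
by have := c_cvg (k := 1%N); under eq_fun do rewrite vol1.
Qed.

Lemma step_upper e : 0 < e -> \forall n \near \oo,
  nrm (B n) <= expR (n%:R * (chi + e)).
Proof. by move=> e0; apply: cvg_ln_le. Qed.

Lemma step_exponent_le k : 0 < vol k Q -> c k <= k%:R * chi.
Proof.
move=> Qk; rewrite leNgt; apply/negP => ck.
have [K K0 HK] := vol_le_nrm R k m m.
pose e := (c k - k%:R * chi) / (2 * k.+1%:R).
have k0 : 0 < 2 * k.+1%:R :> R by rewrite mulr_gt0.
have e0 : 0 < e by rewrite divr_gt0 // subr_gt0.
have eE : (2 * k.+1%:R) * e = c k - k%:R * chi by rewrite mulrC divfK // gt_eqF.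
apply: (@expR_growth_contra _ (c k - e) (k%:R * (chi + e)) K).
  by move: eE e0; rewrite -natr1; lra.
have H1 := cvg_ln_ge (fun n => vol_cocycle_gt0 n Qk) e0 (@c_cvg k).
have H2 := step_upper e0.
near=> n; have h1 : expR (n%:R * (c k - e)) <= vol k (B n) by near: n.
have h2 : nrm (B n) <= expR (n%:R * (chi + e)) by near: n.
rewrite (le_trans h1) // (le_trans (HK _)) // ler_wpM2l ?(ltW K0) //.
by rewrite mulrCA expRM_natl lerXn2r ?nnegrE ?nrm_ge0 ?expR_ge0.
Unshelve. all: by end_near. Qed.

(** j + 1 is the multiplicity of the top rate: [p] holds at 0 because Q is nonzero and fails at m
    because there are no minors of size m + 1, and j + 1 is the first index where it fails. *)
Lemma step_index : exists j,
  [/\ (forall e : R, 0 < e ->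
        \forall n \near \oo, expR (n%:R * (j.+1%:R * chi - e)) <= vol j.+1
          (B n)) &
      (forall e : R, 0 < e -> \forall n \near \oo,
        vol j.+2 (B n) <= expR (n%:R * (j.+2%:R * chi - delta + e)))].
Proof.
pose p (k : nat) := (0 < vol k.+1 Q) && (c k.+1 == k.+1%:R * chi).
have pm : ~~ p m by rewrite /p vol_eq0 ?ltxx.
have [[|j] pj pmin] := ex_minnP (ex_intro (fun k => ~~ p k) m pm).
  by move: pj; rewrite /p vol1 mul1r eqxx andbT lt_neqAle nrm_ge0 andbT negbK
    => /eqP/esym/nrm_eq0 Q0; have := Q_neq0; rewrite Q0 eqxx.
have /andP[Qj /eqP cj] : p j.
  by apply: contraT => /pmin; rewrite ltnn.
exists j; split=> e e0.
  by have := cvg_ln_ge (fun n => vol_cocycle_gt0 n Qj) e0 (@c_cvg j.+1);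
    rewrite cj.
(* If [vol j.+2 Q] is zero, so is [vol j.+2 (B n)], and [c j.+2] carries no information since
   [ln 0 = 0]; the bound is then trivial. *)
have [Qj2|Qj2] := ltrP 0 (vol j.+2 Q); last first.
  near=> n; rewrite vol_cocycle_eq0 ?expR_ge0 //.
  by apply/eqP; rewrite eq_le Qj2 vol_ge0.
have jm : (j.+2 <= m)%N.
  by rewrite leqNgt; apply/negP => mj; rewrite vol_eq0 ?ltxx in Qj2.
have clt : c j.+2 < j.+2%:R * chi.
  rewrite lt_neqAle step_exponent_le // andbT.
  by move: pj; rewrite /p Qj2.
apply: filterS (cvg_ln_le (fun n => vol_cocycle_gt0 n Qj2) e0 (@c_cvg j.+2)) =>
  n.
move=> /le_trans; apply; rewrite ler_expR ler_wpM2l // lerD2r.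
have := gap_le jm clt; rewrite -/delta -/chi; lra.
Unshelve. all: by end_near. Qed.

Let Sl := slow_proj chi delta B.
Let delta0 : 0 < delta. Proof. exact: gap_gt0. Qed.
Let BL n : B n.+1 = L n *m B n.
Proof. by rewrite /B AL mulmxA. Qed.

Lemma step_cvg i k : (fun n => slow_ridge chi delta B n i k) @ \oo --> Sl i k.
Proof.
have [j [vol_ge vol_le]] := step_index.
exact: (slow_ridge_cvg delta0 BL Lunit step_upper vol_ge vol_le L_le).
Qed.

Lemma step_idem : Sl *m Sl = Sl.
Proof.
have [j [vol_ge vol_le]] := step_index.
exact: (slow_proj_idem delta0 BL Lunit step_upper vol_ge vol_le L_le).
Qed.

Lemma step_sym : Sl^T = Sl. Proof. exact: slow_proj_sym. Qed.

Lemma step_fixed (v : 'cV_m) : Sl *m v = v ->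
  \forall n \near \oo, nrm (B n *m v) <= expR (n%:R * (chi - delta / 16)).
Proof.
have [j [vol_ge vol_le]] := step_index.
exact: (slow_proj_fixed delta0 BL Lunit step_upper vol_ge vol_le L_le).
Qed.

Lemma step_moved (v : 'cV_m) : Sl *m v != v -> forall e : R, 0 < e ->
  \forall n \near \oo, expR (n%:R * (chi - e)) <= nrm (B n *m v).
Proof.
have [j [vol_ge vol_le]] := step_index.
exact: (slow_proj_moved delta0 BL Lunit step_upper vol_ge vol_le L_le).
Qed.

Hypothesis Q_idem : Q *m Q = Q.
Hypothesis Q_sym : Q^T = Q.

(** [B n] annihilates the range of 1 - Q, so [step_moved] rules out that [Sl] moves a vector of it.
    By symmetry [Sl] then commutes with [Q], and [Sl *m Q] is again an orthogonal projection. *)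
Lemma step_ker : Sl *m (1%:M - Q) = 1%:M - Q.
Proof.
have ker (v : 'cV_m) : Sl *m ((1%:M - Q) *m v) = (1%:M - Q) *m v.
  apply/eqP; apply: contraT => /step_moved /(_ 1 ltr01) H.
  near \oo => n; have : expR (n%:R * (chi - 1)) <= nrm
    (B n *m ((1%:M - Q) *m v)) by near: n.
  rewrite /B mulmxA -[A n *m Q *m _]mulmxA mulmxBr mulmx1 Q_idem subrr mulmx0
    mul0mx nrm0.
  by rewrite leNgt expR_gt0.
apply/matrixP => i k; have /colP/(_ i) := ker (delta_mx k ord0).
by rewrite mulmxA -!colE !mxE.
Unshelve. all: by end_near. Qed.

Lemma step_comm : Sl *m Q = Q *m Sl.
Proof.
have QT : (1%:M - Q)^T = 1%:M - Q by rewrite linearB /= trmx1 Q_sym.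
have : (1%:M - Q) *m Sl = Sl *m (1%:M - Q).
  by rewrite [RHS]step_ker; have := congr1 trmx step_ker;
    rewrite trmx_mul step_sym QT.
by rewrite mulmxBl mulmxBr mul1mx mulmx1 => /addrI/oppr_inj ->.
Qed.

(** Otherwise all columns of [Q] would be slow, and [B n = B n *m Q] would grow at a rate below
    chi. *)
Lemma step_proper : Sl *m Q != Q.
Proof.
apply/eqP => SQ.
have col_small k : \forall n \near \oo,
    nrm (B n *m col k Q) <= expR (n%:R * (chi - delta / 16)).
  by apply: step_fixed; rewrite colE mulmxA SQ.
have d16 : 0 < delta / 16 by rewrite divr_gt0.
apply: (@expR_growth_contra _ (chi - delta / 32) (chi - delta / 16) m%:R).
  by move: delta0; lra.
have all_small : \forall n \near \oo, forall k : 'I_m,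
    nrm (B n *m col k Q) <= expR (n%:R * (chi - delta / 16)).
  by apply: filter_forall => k.
have d32 : 0 < delta / 32 by rewrite divr_gt0.
have lo := cvg_ln_ge B_gt0 d32 chi_cvg.
near=> n.
have h1 : expR (n%:R * (chi - delta / 32)) <= nrm (B n) by near: n.
have h2 : forall k : 'I_m, nrm (B n *m col k Q) <= expR
  (n%:R * (chi - delta / 16)) by near: n.
rewrite (le_trans h1) // (_ : B n = B n *m Q);
  last by rewrite /B -mulmxA Q_idem.
rewrite /nrm exchange_big /= -[m in m%:R]card_ord mulr_natl -sumr_const.
apply: ler_sum => k _; rewrite (le_trans _ (h2 k)) // /nrm.
by apply: ler_sum => i _; rewrite big_ord1 colE mulmxA -colE
  [X in _ <= `|X|]mxE.
Unshelve. all: by end_near. Qed.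

End Step.

(** * One level of the filtration of a cocycle *)

Section MeasurableMatrix.
Context (d : measure_display) (Z : measurableType d) (R : realType).
Implicit Types (D : set Z).

Definition measurable_mx D (p q : nat) (f : Z -> 'M[R]_(p, q)) : Prop :=
  forall i j, measurable_fun D (fun z => f z i j).

(** Real powers are measurable, and the inverse of x is x times the inverse of x ^ 2, also at x = 0,
    where the inverse is 0. *)
Lemma measurable_inv D (f : Z -> R) : measurable_fun D f ->
  measurable_fun D (fun z => (f z)^-1).
Proof.
move=> mf; rewrite (_ : (fun z => _) = (fun z => f z * (f z ^+ 2) `^ (-1))).
  apply: measurable_funM => //; apply: (measurableT_comp
    (measurable_powR (-1))).
  exact: measurable_funX.
apply/funext => z; rewrite powR_inv1 ?sqr_ge0 // expr2 invfM mulrA.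
have [->|fz] := eqVneq (f z) 0; first by rewrite invr0 !mulr0.
by rewrite divff // mul1r.
Qed.

Lemma measurable_mx_cst D p q (M : 'M[R]_(p, q)) : measurable_mx D (fun=> M).
Proof. by move=> i j; exact: measurable_cst. Qed.

Lemma measurable_mxS D D' p q (f : Z -> 'M[R]_(p, q)) : measurable D -> D' `<=`
  D -> measurable_mx D f -> measurable_mx D' f.
Proof. by move=> mD D'D mf i j; exact: measurable_funS (mf i j). Qed.

Lemma measurable_mxD D p q (f g : Z -> 'M[R]_(p, q)) : measurable_mx D f ->
  measurable_mx D g ->
  measurable_mx D (fun z => f z + g z).
Proof.
move=> mf mg i j; rewrite (_ : (fun z => _) = (fun z => f z i j + g z i j)).
  exact: measurable_funD.
by apply/funext => z; rewrite mxE.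
Qed.

Lemma measurable_mxZ D p q (a : Z -> R) (g : Z -> 'M[R]_(p, q)) : measurable_fun
  D a -> measurable_mx D g ->
  measurable_mx D (fun z => a z *: g z).
Proof.
move=> ma mg i j; rewrite (_ : (fun z => _) = (fun z => a z * g z i j)).
  exact: measurable_funM.
by apply/funext => z; rewrite mxE.
Qed.

Lemma measurable_mx_mul D p q s (f : Z -> 'M[R]_(p, q)) (g : Z -> 'M[R]_(q, s))
  :
  measurable_mx D f -> measurable_mx D g -> measurable_mx D
    (fun z => f z *m g z).
Proof.
move=> mf mg i j; rewrite (_ : (fun z => _) =
  (fun z => \sum_k f z i k * g z k j)).
  by apply: measurable_sum => k; exact: measurable_funM.
by apply/funext => z; rewrite mxE.
Qed.

Lemma measurable_mx_sub D p q p' q' (f : Z -> 'M[R]_(p, q)) (a : 'I_p' -> 'I_p)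
  (b : 'I_q' -> 'I_q) :
  measurable_mx D f -> measurable_mx D (fun z => mxsub a b (f z)).
Proof.
move=> mf i j; rewrite (_ : (fun z => _) = (fun z => f z (a i) (b j))) //.
by apply/funext => z; rewrite mxE.
Qed.

Lemma measurable_mx_tr D p q (f : Z -> 'M[R]_(p, q)) : measurable_mx D f ->
  measurable_mx D (fun z => (f z)^T).
Proof.
move=> mf i j; rewrite (_ : (fun z => _) = (fun z => f z j i)) //.
by apply/funext => z; rewrite mxE.
Qed.

Lemma measurable_det D p (f : Z -> 'M[R]_p) : measurable_mx D f ->
  measurable_fun D (fun z => \det (f z)).
Proof.
move=> mf; apply: measurable_sum => s; apply: measurable_funM => //.
by apply: measurable_prod => i _; exact: mf.
Qed.

Lemma measurable_mx_inv D p (f : Z -> 'M[R]_p) :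
  (forall z, D z -> f z \in unitmx) ->
  measurable_mx D f -> measurable_mx D (fun z => invmx (f z)).
Proof.
move=> fu mf i j.
apply: (@eq_measurable_fun _ _ _ _ D (fun z => (\det (f z))^-1 * cofactor (f z)
  j i)).
  by move=> z; rewrite inE => Dz; rewrite /invmx fu // !mxE.
apply: measurable_funM; first exact/measurable_inv/measurable_det.
apply: measurable_funM => //; apply: measurable_det => a b.
rewrite (_ : (fun z => _) = (fun z => f z (lift j a) (lift i b))) //.
by apply/funext => z; rewrite !mxE.
Qed.

Lemma measurable_vol D k p q (f : Z -> 'M[R]_(p, q)) : measurable_mx D f ->
  measurable_fun D (fun z => vol k (f z)).
Proof.
move=> mf; apply: measurable_sum => a; apply: measurable_sum => b.
apply: measurableT_comp => //; apply: measurable_det; exact: measurable_mx_sub.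
Qed.

Lemma measurable_nrm D p q (f : Z -> 'M[R]_(p, q)) : measurable_mx D f ->
  measurable_fun D (fun z => nrm (f z)).
Proof.
move=> mf; apply: measurable_sum => a; apply: measurable_sum => b.
exact: measurableT_comp.
Qed.

Lemma measurable_gap D m (c : Z -> nat -> R) :
  (forall k, measurable_fun D (c^~ k)) ->
  measurable_fun D (fun z => gap m (c z)).
Proof.
move=> mc; rewrite /gap; elim: (index_enum _) => [|k s IH].
  by under eq_fun do rewrite big_nil; exact: measurable_cst.
under eq_fun do rewrite big_cons.
apply: measurable_minr => //.
have mpos : measurable_fun setT (@positive_or_one R).
  apply: measurable_fun_ifT => //.
  exact: (measurable_fun_ltr (measurable_cst _) (@measurable_id _ _ _)).
apply: (measurableT_comp mpos); apply: measurable_funB => //.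
by apply: measurable_funM => //; exact: mc.
Qed.

End MeasurableMatrix.

Section Projections.
Variable R : realType.

(** A diagonal entry is the sum of the squares of its row, hence at most 1, and then so is every
    entry. The bound is the same at all points, as an integrable majorant of the increments
    requires. *)
Lemma nrm_proj m (Q : 'M[R]_m) : Q *m Q = Q -> Q^T = Q -> nrm Q <= (m * m)%:R.
Proof.
move=> QQ QT; rewrite -[leRHS]mulr1; apply: nrm_le => i j.
have sqE a : Q a a = \sum_b Q a b ^+ 2.
  rewrite -[in LHS]QQ mxE; apply: eq_bigr => b _.
  by rewrite expr2; congr (_ * _); rewrite -[in LHS]QT mxE.
have sq_le a b : Q a b ^+ 2 <= Q a a.
  rewrite [leRHS]sqE (bigD1 b) //= lerDl.
  by apply: sumr_ge0 => c _; exact: sqr_ge0.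
have Qii : Q i i <= 1.
  have [//|Qi] := leP (Q i i) 1; have := sq_le i i.
  by rewrite expr2 -{3}[Q i i]mul1r ler_pM2r ?(lt_trans ltr01) // leNgt Qi.
rewrite -(@ler_pXn2r _ 2) ?nnegrE // expr1n real_normK ?num_real //.
exact: le_trans (sq_le i j) Qii.
Qed.

Lemma vol_proj_ge1 k m (Q : 'M[R]_m) : Q *m Q = Q -> 0 < vol k Q -> 1 <= vol k
  Q.
Proof.
move=> QQ Qk; have := vol_mulmx k Q Q; rewrite QQ -{1}[vol k Q]mul1r.
by rewrite ler_pM2r.
Qed.

Lemma ln_dist_le (a b x : R) : 0 < a -> 0 < b ->
  a <= b * expR x -> b <= a * expR x -> `|ln a - ln b| <= x.
Proof.
move=> a0 b0 ab ba; have ex := expR_gt0 x.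
have h1 : ln a <= ln b + x.
  by rewrite -[x in leRHS]expRK -lnM ?posrE // ler_ln ?posrE ?mulr_gt0.
have h2 : ln b <= ln a + x.
  by rewrite -[x in leRHS]expRK -lnM ?posrE // ler_ln ?posrE ?mulr_gt0.
by rewrite ler_norml lerBrDr lerBlDr addrC lerBlDr h2 addrC h1.
Qed.

Lemma mx_col_ext p q (M N : 'M[R]_(p, q)) :
  (forall v : 'cV_q, M *m v = N *m v) -> M = N.
Proof.
move=> MN; apply/matrixP => i j; have /colP/(_ i) := MN (delta_mx j ord0).
by rewrite -!colE !mxE.
Qed.

End Projections.

(** * Growth of a cocycle on an equivariant family of ranges *)

Section Cocycle.
Context (d : measure_display) (Z : measurableType d) (R : realType) (m : nat).
Variables (P : probability Z R) (F : Z -> Z) (A : Z -> 'M[R]_m) (phi : Z -> R).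

Fixpoint mxcocycle (n : nat) (z : Z) : 'M[R]_m :=
  if n is k.+1 then A (iter k F z) *m mxcocycle k z else 1%:M.

Lemma mxcocycleSr n z : mxcocycle n.+1 z = mxcocycle n (F z) *m A z.
Proof.
elim: n => [|n IH]; first by rewrite /= mulmx1 mul1mx.
by change (mxcocycle n.+2 z) with (A (iter n.+1 F z) *m mxcocycle n.+1 z);
  rewrite IH mulmxA iterSr.
Qed.

Lemma mxcocycleD n l z : mxcocycle (n + l) z = mxcocycle l (iter n F z) *m
  mxcocycle n z.
Proof.
elim: l => [|l IH]; first by rewrite addn0 mul1mx.
by rewrite addnS /= IH mulmxA addnC iterD.
Qed.

Hypothesis mF : measurable_fun setT F.
Hypothesis PF : forall S, measurable S -> P (F @^-1` S) = P S.
Hypothesis mA : measurable_mx setT A.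
Hypothesis Aunit : forall z, A z \in unitmx.
Hypothesis mphi : measurable_fun setT phi.
Hypothesis phi0 : forall z, 0 <= phi z.
Hypothesis iphi : P.-integrable setT (EFin \o phi).
Hypothesis A_le : forall z, nrm (A z) <= expR (phi z).
Hypothesis AV_le : forall z, nrm (invmx (A z)) <= expR (phi z).

Lemma measurable_mxcocycle n : measurable_mx setT (mxcocycle n).
Proof.
elim: n => [|n IH]; first exact: measurable_mx_cst.
apply: measurable_mx_mul => //= i j.
exact: measurableT_comp (mA i j) (measurable_iter mF n).
Qed.

(** All points whose forward orbit avoids a measurable null set that contains the complement of
    [E]. *)
Lemma invariant_core (E : Z -> Prop) : {ae P, forall z, E z} ->
  exists D, [/\ measurable D, D `<=` E, (forall z, D z -> D (F z)) &
    {ae P, forall z, D z}].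
Proof.
move=> [N [mN N0 EN]].
exists (\bigcap_n (iter n F @^-1` (~` N))).
have mi n : measurable (iter n F @^-1` N).
  by rewrite -[X in measurable X]setTI; exact: measurable_iter.
split.
- apply: bigcapT_measurable => n; rewrite preimage_setC; exact/measurableC/mi.
- move=> z /(_ 0%N I) /= zN; apply: contrapT => Ez; exact/zN/EN.
- by move=> z zD n _ /=; rewrite -iterSr; exact: (zD n.+1 I).
- exists (\bigcup_n (iter n F @^-1` N)); split.
  + exact: bigcupT_measurable.
  + apply/negligibleP; first exact: bigcupT_measurable.
    apply: negligible_bigcup => n; apply/negligibleP; first exact: mi.
    by have := iter_preserving mF PF n mN; rewrite N0.
  + move=> z /= /existsNP[n /not_implyP[_ /contrapT zn]]; by exists n.
Qed.

(** [pf_img] and [pf_pre] state that [A z] maps the range of [Q z] onto the range of [Q (F z)], one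
    inclusion each. An identity between [Q (F z) *m A z] and [A z *m Q z] would be too much to ask
    of orthogonal projections. *)
Record proj_family (D : set Z) (Q : Z -> 'M[R]_m) : Prop := ProjFamily {
  pf_meas : measurable D;
  pf_inv : forall z, D z -> D (F z);
  pf_ae : {ae P, forall z, D z};
  pf_measurable : measurable_mx D Q;
  pf_idem : forall z, D z -> Q z *m Q z = Q z;
  pf_sym : forall z, D z -> (Q z)^T = Q z;
  pf_img : forall z, D z -> Q (F z) *m (A z *m Q z) = A z *m Q z;
  pf_pre : forall z, D z -> Q z *m (invmx (A z) *m Q (F z)) = invmx (A z) *m Q
    (F z) }.

Section LevelStep.
Variables (D : set Z) (Q : Z -> 'M[R]_m).
Hypothesis DQ : proj_family D Q.

Let Bn n z := mxcocycle n z *m Q z.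

Lemma mxcocycle_img n z : D z -> Q (iter n F z) *m Bn n z = Bn n z.
Proof.
move=> Dz; rewrite /Bn; elim: n => [|n IH].
  by rewrite /= mul1mx (pf_idem DQ).
have Dn : D (iter n F z) by elim: (n) => // k Dk; exact: (pf_inv DQ).
rewrite /= -[A _ *m _ *m _]mulmxA; set W := mxcocycle n z *m Q z in IH *.
by rewrite -IH [A _ *m (_ *m W)]mulmxA mulmxA (pf_img DQ).
Qed.

Lemma Bn_succ n z : D z -> Bn n.+1 z = Bn n (F z) *m (A z *m Q z).
Proof. by move=> Dz; rewrite /Bn mxcocycleSr -!mulmxA (pf_img DQ). Qed.

Lemma Bn_pred n z : D z -> Bn n (F z) = Bn n.+1 z *m (invmx (A z) *m Q (F z)).
Proof.
move=> Dz; rewrite /Bn mxcocycleSr -!mulmxA (pf_pre DQ) // mulKVmx //.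
Qed.

Lemma Bn_add n l z : D z -> Bn (n + l) z = Bn l (iter n F z) *m Bn n z.
Proof. by move=> Dz; rewrite /Bn mxcocycleD -mulmxA -/(Bn n z) -{1}mxcocycle_img
  // mulmxA. Qed.

(** Each of [Q z] and [Q (F z)] is a product with the other one as a factor, so positivity of
    [vol k] is invariant along orbits. *)
Lemma vol_family_gt0 k z : D z -> (0 < vol k (Q (F z))) = (0 < vol k (Q z)).
Proof.
move=> Dz; apply/idP/idP; rewrite !lt_neqAle !vol_ge0 !andbT ![0 == _]eq_sym.
  apply: contra => /eqP Q0; rewrite -(pf_idem DQ (pf_inv DQ Dz)).
  rewrite -{1}[Q (F z)](mulKVmx (Aunit z)) -(pf_pre DQ) // eq_le vol_ge0 andbT.
  rewrite -mulmxA (le_trans (vol_mulmx _ _ _)) // mulrC.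
  rewrite (le_trans (ler_wpM2r (vol_ge0 _ _) (vol_mulmx _ _ _))) //.
  by rewrite (le_trans (ler_wpM2r (vol_ge0 _ _)
    (ler_wpM2r (vol_ge0 _ _) (vol_mulmx _ _ _)))) // Q0; lra.
apply: contra => /eqP Q0; rewrite -[Q z](mulKmx (Aunit z)) -(pf_img DQ) //.
rewrite eq_le vol_ge0 andbT (le_trans (vol_mulmx _ _ _)) //.
rewrite (le_trans (ler_wpM2l (vol_ge0 _ _) (vol_mulmx _ _ _))) //.
by rewrite Q0 mul0r mulr0.
Qed.

Lemma vol_step_le k : exists2 c : R, 0 <= c & forall z, D z ->
  vol k (A z *m Q z) <= expR (c + k%:R * phi z) /\
  vol k (invmx (A z) *m Q (F z)) <= expR (c + k%:R * phi z).
Proof.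
have [K K0 HK] := vol_le_nrm R k m m.
exists (K * (m * m)%:R ^+ k) => [|z Dz]; first by rewrite mulr_ge0 ?exprn_ge0
  ?(ltW K0).
have bound (M Q' : 'M[R]_m) : nrm M <= expR (phi z) -> nrm Q' <= (m * m)%:R ->
    vol k (M *m Q') <= expR (K * (m * m)%:R ^+ k + k%:R * phi z).
  move=> M_le Q_le; rewrite (le_trans (HK _)) //.
  rewrite (@le_trans _ _ (K * (expR (phi z) * (m * m)%:R) ^+ k)) //.
    rewrite ler_wpM2l ?(ltW K0) // lerXn2r ?nnegrE ?nrm_ge0 ?mulr_ge0 ?expR_ge0
      //.
    by rewrite (le_trans (nrmM _ _)) // ler_pM ?nrm_ge0.
  rewrite exprMn -expRM_natl mulrCA mulrC expRD ler_wpM2r ?expR_ge0 //.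
  by rewrite (le_trans _ (expR_ge1Dx _)) // lerDr.
split; apply: bound => //; first by apply: nrm_proj;
  [exact: (pf_idem DQ)|exact: (pf_sym DQ)].
by apply: nrm_proj; [apply: (pf_idem DQ)|apply: (pf_sym DQ)];
  exact: (pf_inv DQ).
Qed.

(* Since [ln 0 = 0], [gk k] vanishes identically where [Q z] has rank less
   than [k]. *)
Let gk k n z := ln (vol k (Bn n z)).

Let Bn_gt0 k n z : D z -> (0 < vol k (Bn n z)) = (0 < vol k (Q z)).
Proof.
move=> Dz; have un : mxcocycle n z \in unitmx.
  by elim: n => [|n IH]; rewrite ?unitmx1 //= unitmx_mul Aunit.
apply/idP/idP; rewrite !lt_neqAle !vol_ge0 !andbT ![0 == _]eq_sym.
  apply: contra => /eqP Q0; rewrite eq_le vol_ge0 andbT.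
  by rewrite (le_trans (vol_mulmx _ _ _)) // Q0 mulr0.
apply: contra => /eqP Q0; rewrite -[Q z](mulKmx un) eq_le vol_ge0 andbT.
by rewrite (le_trans (vol_mulmx _ _ _)) // -/(Bn n z) Q0 mulr0.
Qed.

Let ln_vol0 k n z : D z -> ~~ (0 < vol k (Q z)) -> gk k n z = 0.
Proof. by move=> Dz; rewrite -(Bn_gt0 k n Dz) -leNgt => /ln0. Qed.

Lemma ae_vol_cvg k : {ae P, forall z, D z -> cvgn (fun n => gk k n z / n%:R)}.
Proof.
have [c c0 Hc] := vol_step_le k.
pose phik z : R := c + k%:R * phi z.
have phik0 z : 0 <= phik z by rewrite addr_ge0 // mulr_ge0.
have mphik : measurable_fun setT phik.
  by apply: measurable_funD => //; exact: measurable_funM.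
have iphik : P.-integrable setT (EFin \o phik).
  rewrite (_ : EFin \o phik = (EFin \o cst c) \+
    (fun z => k%:R%:E * (EFin \o phi) z))%E //.
  apply: integrableD => //; first exact: finite_measure_integrable_cst.
  exact: integrableZl.
have dich z : D z -> 0 < vol k (Q z) \/ ~~ (0 < vol k (Q z)).
  by move=> _; case: (0 < _); [left|right].
apply: (kingman mF PF mphik phik0 iphik (pf_meas DQ) (pf_inv DQ)).
- move=> n; apply: (measurableT_comp (@measurable_ln R)); apply: measurable_vol.
  apply: measurable_mx_mul; last exact: (pf_measurable DQ).
  by apply: (measurable_mxS _ _ (measurable_mxcocycle n)).
- move=> z n l Dz _ _; have Dn i : D (iter i F z).
    by elim: i => // i Di; exact: (pf_inv DQ).
  have Qn i : (0 < vol k (Q (iter i F z))) = (0 < vol k (Q z)).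
    by elim: i => // i IH; rewrite iterS vol_family_gt0.
  have [Qz|Qz] := dich z Dz; last by rewrite !ln_vol0 ?Qn ?addr0 ?Dn.
  rewrite -lnM ?posrE ?Bn_gt0 ?Qn // ler_ln ?posrE ?Bn_gt0 ?mulr_gt0 ?Bn_gt0 ?Qn
    //.
  by rewrite Bn_add // mulrC vol_mulmx.
- move=> z n Dz _; have DF := pf_inv DQ Dz.
  have [Qz|Qz] := dich z Dz; last by rewrite !ln_vol0 ?subrr ?normr0
    ?vol_family_gt0.
  have [h1 h2] := Hc z Dz.
  have q1 : 0 < vol k (Bn n.+1 z) by rewrite Bn_gt0.
  have q2 : 0 < vol k (Bn n (F z)) by rewrite Bn_gt0 // vol_family_gt0.
  apply: ln_dist_le => //.
    by rewrite Bn_succ // (le_trans (vol_mulmx _ _ _)) // ler_wpM2l ?vol_ge0.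
  by rewrite Bn_pred // (le_trans (vol_mulmx _ _ _)) // ler_wpM2l ?vol_ge0.
- move=> z Dz; have [Qz|Qz] := dich z Dz; last by rewrite ln_vol0 ?normr0.
  have [h1 h2] := Hc z Dz.
  have -> : gk k 1%N z = ln (vol k (A z *m Q z)) - ln 1.
    by rewrite ln1 subr0 /gk /Bn /= mulmx1.
  have q1 : 0 < vol k (A z *m Q z).
    by have := Bn_gt0 k 1 Dz; rewrite /Bn /= mulmx1 => ->.
  apply: ln_dist_le; rewrite // ?mul1r //.
  (* The first term also has to be bounded from below by an integrable function. Idempotency
     supplies this: a positive volume of [Q z] is at least 1. *)
  rewrite (le_trans (vol_proj_ge1 (pf_idem DQ Dz) Qz)) //.
  have {1}-> : Q z = (invmx (A z) *m Q (F z)) *m (A z *m Q z).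
    by rewrite -mulmxA (pf_img DQ) // mulKmx.
  by rewrite (le_trans (vol_mulmx _ _ _)) // mulrC ler_wpM2l ?vol_ge0.
Qed.

Let c z k : R := limn (fun n => gk k n z / n%:R).
Let good z := [/\ D z, (forall k, cvgn (fun n => gk k n z / n%:R)) &
  forall e : R, 0 < e -> \forall n \near \oo, phi (iter n F z) <= e * n%:R].

Let ae_good : {ae P, forall z, good z}.
Proof.
have H := ae_foralln ae_vol_cvg.
apply: filterS3 (pf_ae DQ) H (ae_sublinear mF PF mphi phi0 iphi) => z Dz h1 h2.
by split => // k; exact: h1.
Qed.

Let step_L_le z : good z -> forall e : R, 0 < e -> \forall n \near \oo,
  nrm (A (iter n F z)) <= expR (n%:R * e) /\
  nrm (invmx (A (iter n F z))) <= expR (n%:R * e).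
Proof.
move=> [_ _ sub] e e0; apply: filterS (sub e e0) => n h; rewrite mulrC.
by split; [apply: le_trans (A_le _) _|apply: le_trans (AV_le _) _];
  rewrite ler_expR.
Qed.

Let step_c_cvg z : good z -> forall k,
  (fun n => ln (vol k (mxcocycle n z *m Q z)) / n%:R) @ \oo --> c z k.
Proof. by move=> [_ h _] k; exact: h. Qed.

Let chi z := c z 1%N.
Let Sl z := slow_proj (chi z) (gap m (c z)) (Bn^~ z).
Let Q' z := Sl z *m Q z.
Let kap z := gap m (c z) / 16.

Let kap0 z : 0 < kap z. Proof. by rewrite divr_gt0 // gap_gt0. Qed.

(** The results at a fixed point assume a nonzero [Q z]; where [Q z] is zero, so is [Q' z]. Hence
    the case distinction here and below. *)
Let Q'_idem z : good z -> Q' z *m Q' z = Q' z.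
Proof.
move=> gz; have [Dz _ _] := gz; have [Q0|Q0] := eqVneq (Q z) 0.
  by rewrite /Q' Q0 mulmx0 mul0mx.
have comm : Sl z *m Q z = Q z *m Sl z.
  by apply: (step_comm (A := mxcocycle^~ z) (L := fun n => A (iter n F z))) =>
    //;
    [exact: step_L_le|exact: step_c_cvg|exact: (pf_idem DQ)|exact: (pf_sym DQ)].
have idem : Sl z *m Sl z = Sl z.
  by apply: (step_idem (A := mxcocycle^~ z) (L := fun n => A (iter n F z))
    (Q := Q z)) => //;
    [exact: step_L_le|exact: step_c_cvg].
by rewrite /Q' {1}comm -mulmxA [Sl z *m (_ *m _)]mulmxA idem comm mulmxA
  (pf_idem DQ).
Qed.

Let Q'_sym z : good z -> (Q' z)^T = Q' z.
Proof.
move=> gz; have [Dz _ _] := gz; have [Q0|Q0] := eqVneq (Q z) 0.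
  by rewrite /Q' Q0 mulmx0 trmx0.
rewrite /Q' trmx_mul (pf_sym DQ) // /Sl slow_proj_sym; symmetry.
by apply: (step_comm (A := mxcocycle^~ z) (L := fun n => A (iter n F z))) => //;
    [exact: step_L_le|exact: step_c_cvg|exact: (pf_idem DQ)|exact: (pf_sym DQ)].
Qed.

Let Q'_subl z : good z -> Q z *m Q' z = Q' z.
Proof.
move=> gz; have [Dz _ _] := gz; have [Q0|Q0] := eqVneq (Q z) 0.
  by rewrite /Q' Q0 mulmx0 mul0mx.
have comm : Sl z *m Q z = Q z *m Sl z.
  by apply: (step_comm (A := mxcocycle^~ z) (L := fun n => A (iter n F z))) =>
    //;
    [exact: step_L_le|exact: step_c_cvg|exact: (pf_idem DQ)|exact: (pf_sym DQ)].
by rewrite /Q' comm mulmxA (pf_idem DQ).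
Qed.

Let Q'_subr z : good z -> Q' z *m Q z = Q' z.
Proof. by move=> [Dz _ _]; rewrite /Q' -mulmxA (pf_idem DQ). Qed.

Let Q'_proper z : good z -> Q z != 0 -> Q' z != Q z.
Proof.
move=> gz Q0; have [Dz _ _] := gz.
by apply: (step_proper (A := mxcocycle^~ z) (L := fun n => A (iter n F z))) =>
  //;
  [exact: step_L_le|exact: step_c_cvg|exact: (pf_idem DQ)].
Qed.

Let Q'_fixed z v : good z -> Q' z *m v = v :> 'cV_m ->
  \forall n \near \oo, nrm (mxcocycle n z *m v) <= expR
    (n%:R * (chi z - kap z)).
Proof.
move=> gz Qv; have [Dz _ _] := gz; have [Q0|Q0] := eqVneq (Q z) 0.
  by apply: nearW => n; rewrite -Qv /Q' Q0 mulmx0 mul0mx mulmx0 nrm0 expR_ge0.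
have Qv' : Q z *m v = v by rewrite -Qv mulmxA Q'_subl.
have Sv : Sl z *m v = v by rewrite -{1}Qv' mulmxA.
have H : \forall n \near \oo, nrm (Bn n z *m v) <= expR
  (n%:R * (chi z - kap z)).
  by apply: (step_fixed (L := fun n => A (iter n F z)) _ _ _ _ Q0) => //;
    [exact: step_L_le|exact: step_c_cvg].
by apply: filterS H => n; rewrite /Bn -mulmxA Qv'.
Qed.

Let Q'_moved z v : good z -> Q z *m v = v :> 'cV_m -> Q' z *m v != v ->
  forall e : R, 0 < e ->
  \forall n \near \oo, expR (n%:R * (chi z - e)) <= nrm (mxcocycle n z *m v).
Proof.
move=> gz Qv Q'v e e0; have [Dz _ _] := gz; have [Q0|Q0] := eqVneq (Q z) 0.
  by move: Q'v; rewrite -Qv /Q' Q0 !mulmx0 !mul0mx eqxx.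
have Sv : Sl z *m v != v by move: Q'v; rewrite /Q' -mulmxA Qv.
have H : \forall n \near \oo, expR (n%:R * (chi z - e)) <= nrm (Bn n z *m v).
  by apply: (step_moved (L := fun n => A (iter n F z)) _ _ _ _ Q0) => //;
    [exact: step_L_le|exact: step_c_cvg].
by apply: filterS H => n; rewrite /Bn -mulmxA Qv.
Qed.

Let Bn_upper z : good z -> Q z != 0 -> forall e : R, 0 < e ->
  \forall n \near \oo, nrm (Bn n z) <= expR (n%:R * (chi z + e)).
Proof.
move=> gz Q0 e e0.
by apply: (step_upper (L := fun n => A (iter n F z)) _ _ _ Q0) => //;
  exact: step_c_cvg.
Qed.

Let chi_inv z : good z -> good (F z) -> chi (F z) = chi z.
Proof.
move=> gz gF; have [Dz _ _] := gz; have [DF _ _] := gF.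
have [Qz|Qz] := boolP (0 < vol 1 (Q z)); last first.
  rewrite /chi /c; congr (lim _); suff -> : (fun n => gk 1 n (F z) / n%:R) =
      (fun n => gk 1 n z / n%:R) by [].
  by apply/funext => n; rewrite !ln_vol0 // vol_family_gt0.
have nz0 y : D y -> 0 < vol 1 (Q y) -> Q y != 0.
  by move=> _; apply: contraTneq => ->; rewrite vol1 nrm0 ltxx.
have QF : 0 < vol 1 (Q (F z)) by rewrite vol_family_gt0.
have up y : good y -> 0 < vol 1 (Q y) -> forall e : R, 0 < e ->
    \forall n \near \oo, nrm (Bn n y) <= expR (n%:R * (chi y + e)).
  by move=> gy Qy; apply: Bn_upper => //; apply: nz0 => //; have [] := gy.
have lo y : good y -> 0 < vol 1 (Q y) -> forall e : R, 0 < e ->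
    \forall n \near \oo, expR (n%:R * (chi y - e)) <= nrm (Bn n y).
  move=> gy Qy e e0; have [Dy _ _] := gy.
  have B0 n : 0 < vol 1 (Bn n y) by rewrite Bn_gt0.
  have H : \forall n \near \oo, expR (n%:R * (chi y - e)) <= vol 1 (Bn n y).
    by apply: cvg_ln_ge => //; exact: step_c_cvg.
  by apply: filterS H => n; rewrite vol1.
apply/le_anti/andP; split.
  apply: (growth_shift_ge (nrm_ge0 (invmx (A z) *m Q (F z))) (up z gz Qz)
    (lo _ gF QF)).
  by move=> n; rewrite Bn_pred // mulrC nrmM.
apply: (growth_shift_le (nrm_ge0 (A z *m Q z)) (lo z gz Qz) (up _ gF QF)).
by move=> n; rewrite Bn_succ // mulrC nrmM.
Qed.

(** [v] and [A z *m v] have the same growth up to a shift of the index. A vector fixed by [Q'] has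
    rate at most chi - kap and a moved one at least chi, with the same chi at [z] and at [F z], so
    the two cases cannot be exchanged. *)
Let Q'_equiv z v : good z -> good (F z) -> Q z *m v = v :> 'cV_m ->
  (Q' z *m v == v) = (Q' (F z) *m (A z *m v) == A z *m v).
Proof.
move=> gz gF Qv; have [Dz _ _] := gz.
have QFv : Q (F z) *m (A z *m v) = A z *m v.
  by rewrite -{1}Qv [A z *m (_ *m _)]mulmxA mulmxA (pf_img DQ) // -mulmxA Qv.
have shift n : nrm (mxcocycle n.+1 z *m v) = nrm
  (mxcocycle n (F z) *m (A z *m v)).
  by rewrite mxcocycleSr mulmxA.
have weaken (u : nat -> R) l e : 0 < e ->
  (\forall n \near \oo, u n <= expR (n%:R * l)) ->
    \forall n \near \oo, u n <= expR (n%:R * (l + e)).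
  move=> e0; apply: filterS => n /le_trans; apply.
  by rewrite ler_expR ler_wpM2l // lerDl ltW.
apply/eqP/eqP => H; apply/eqP; apply: contraT => H'.
  have lo := Q'_moved gF QFv H'; have hi := Q'_fixed gz H.
  have : chi (F z) <= chi z - kap z.
    apply: (growth_shift_ge ler01 (fun e e0 => weaken _ _ e e0 hi) lo) => n.
    by rewrite mul1r shift.
  by rewrite chi_inv // lerBrDr gerDl leNgt kap0.
have lo := Q'_moved gz Qv H'; have hi := Q'_fixed gF H.
have : chi z <= chi (F z) - kap (F z).
  apply: (growth_shift_le ler01 lo (fun e e0 => weaken _ _ e e0 hi)) => n.
  by rewrite mul1r shift.
by rewrite chi_inv // lerBrDr gerDl leNgt kap0.
Qed.

Let Q'_measurable D' : measurable D' -> (forall z, D' z -> good z) ->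
  measurable_fun D' chi /\ measurable_mx D' Q'.
Proof.
move=> mD' D'g; have D'D : D' `<=` D by move=> z /D'g [].
have mBn n : measurable_mx D' (Bn n).
  apply: (measurable_mxS (pf_meas DQ) D'D); apply: measurable_mx_mul;
    last exact: (pf_measurable DQ).
  by apply: (measurable_mxS _ _ (measurable_mxcocycle n)).
have mc k : measurable_fun D' (c^~ k).
  apply: (@measurable_fun_cvg _ _ _ _ (fun n z => gk k n z / n%:R)) =>
    [n|z D'z].
    apply: measurable_funM => //; apply: (measurableT_comp (@measurable_ln R)).
    exact: measurable_vol.
  by have [_ h _] := D'g z D'z; exact: h.
split; first exact: mc.
apply: measurable_mx_mul; last exact: (measurable_mxS (pf_meas DQ) D'D
  (pf_measurable DQ)).
move=> i j; apply: (@measurable_fun_cvg _ _ _ _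
  (fun n z => slow_ridge (chi z) (gap m (c z)) (Bn^~ z) n i j)) => [n|z D'z].
  have mC : measurable_mx D' (fun z => expR (n%:R * (gap m (c z) / 2 - chi z))
    *: Bn n z).
    apply: measurable_mxZ => //; apply: (measurableT_comp (@measurable_expR R)).
    apply: measurable_funM => //; apply: measurable_funB; last exact: mc.
    by apply: measurable_funM => //; exact: measurable_gap.
  apply: measurable_mx_inv => [z _|]; first exact: ridge_unit.
  by apply: measurable_mxD; [exact: measurable_mx_cst|apply: measurable_mx_mul
    => //; exact: measurable_mx_tr].
have gz := D'g z D'z; have [Dz _ _] := gz; have [Q0|Q0] := eqVneq (Q z) 0.
  have E : (fun n => slow_ridge (chi z) (gap m (c z)) (Bn^~ z) n i j) =
      (fun n => ridge (0 : 'M[R]_m) i j).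
    by apply/funext => n; rewrite /slow_ridge /Bn Q0 mulmx0 scaler0.
  by rewrite /Sl mxE E lim_cst //; exact: cvg_cst.
by apply: (step_cvg (A := mxcocycle^~ z) (L := fun n => A (iter n F z)) _ _ _ _
  Q0) => //;
  [exact: step_L_le|exact: step_c_cvg].
Qed.

Theorem level_step : exists D1 Q1 (chi1 : Z -> R),
  [/\ proj_family D1 Q1, D1 `<=` D, measurable_fun D1 chi1 & forall z, D1 z ->
   [/\ chi1 (F z) = chi1 z, Q1 z *m Q z = Q1 z, Q z *m Q1 z = Q1 z,
    (Q z != 0 -> Q1 z != Q z) &
    (forall v : 'cV_m, Q z *m v = v -> Q1 z *m v != v ->
      (fun n => ln (nrm (mxcocycle n z *m v)) / n%:R) @ \oo --> chi1 z) /\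
    (forall v : 'cV_m, Q1 z *m v = v -> exists2 k : R, 0 < k &
      \forall n \near \oo, nrm (mxcocycle n z *m v) <= expR
        (n%:R * (chi1 z - k)))]].
Proof.
have [D1 [mD1 D1g D1F aeD1]] := invariant_core ae_good.
have [mchi mQ'] := Q'_measurable mD1 D1g.
exists D1, Q', chi; split => //; last 1 first.
- move=> z D1z; have gz := D1g z D1z; have gF := D1g _ (D1F z D1z).
  split; [exact: chi_inv|exact: Q'_subr|exact: Q'_subl|exact: Q'_proper|split].
    move=> v Qv Q'v; apply: expR_squeeze; first exact: Q'_moved.
    move=> e e0; have Q0 : Q z != 0.
      by apply: contraNneq Q'v => Q0; rewrite -Qv Q0 /Q' !mul0mx mulmx0.
    have e20 : 0 < e / 2 by rewrite divr_gt0.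
    have up := Bn_upper gz Q0 e20; near=> n.
    have h1 : nrm (Bn n z) <= expR (n%:R * (chi z + e / 2)) by near: n.
    have h2 : nrm v <= expR (n%:R * (e / 2)) by near: n; exact: cst_le_expR.
    rewrite -{1}Qv mulmxA (le_trans (nrmM _ _)) //.
    rewrite (@le_trans _ _ (expR (n%:R * (chi z + e / 2)) * expR
      (n%:R * (e / 2)))) //.
      by rewrite ler_pM ?nrm_ge0.
    by rewrite -expRD -mulrDr -addrA -splitr.
  by move=> v Q'v; exists (kap z); [exact: kap0|exact: Q'_fixed].
- split => // z D1z; have gz := D1g z D1z; have gF := D1g _ (D1F z D1z);
  have [Dz _ _] := gz.
  + exact: Q'_idem.
  + exact: Q'_sym.
  + apply: mx_col_ext => v; rewrite -(mulmxA (Q' (F z))) -(mulmxA (A z)).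
    apply/eqP; rewrite -Q'_equiv //.
      by rewrite mulmxA Q'_idem.
    by rewrite mulmxA Q'_subl.
  + apply: mx_col_ext => v; rewrite -(mulmxA (Q' z)) -(mulmxA (invmx (A z))).
    set w := Q' (F z) *m v; apply/eqP.
    rewrite Q'_equiv // ?mulKVmx //; first by rewrite /w mulmxA Q'_idem.
    have Qw : Q (F z) *m w = w by rewrite /w mulmxA Q'_subl.
    by rewrite -{1}Qw [invmx _ *m _]mulmxA mulmxA (pf_pre DQ) // -mulmxA Qw.
- by move=> z /D1g [].
Unshelve. all: by end_near. Qed.

End LevelStep.
End Cocycle.

(** * The filtration *)

Section Filtration.
Context (d : measure_display) (Z : measurableType d) (R : realType) (m : nat).
Variables (P : probability Z R) (F : Z -> Z) (A : Z -> 'M[R]_m) (phi : Z -> R).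
Hypothesis mF : measurable_fun setT F.
Hypothesis PF : forall S, measurable S -> P (F @^-1` S) = P S.
Hypothesis mA : measurable_mx setT A.
Hypothesis Aunit : forall z, A z \in unitmx.
Hypothesis mphi : measurable_fun setT phi.
Hypothesis phi0 : forall z, 0 <= phi z.
Hypothesis iphi : P.-integrable setT (EFin \o phi).
Hypothesis A_le : forall z, nrm (A z) <= expR (phi z).
Hypothesis AV_le : forall z, nrm (invmx (A z)) <= expR (phi z).

(** A family is bundled with its properties so that [choice] can iterate [level_step]. *)
Let family := {DQ : set Z * (Z -> 'M[R]_m) | proj_family P F A DQ.1 DQ.2}.

Let link (s : family) (t : family * (Z -> R)) : Prop :=
  let Q := (sval s).2 in let D1 := (sval t.1).1 in
  let Q1 := (sval t.1).2 in let chi := t.2 in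
  [/\ D1 `<=` (sval s).1, measurable_fun D1 chi & forall z, D1 z ->
   [/\ chi (F z) = chi z, Q1 z *m Q z = Q1 z, Q z *m Q1 z = Q1 z,
    (Q z != 0 -> Q1 z != Q z) &
    (forall v : 'cV_m, Q z *m v = v -> Q1 z *m v != v ->
      (fun n => ln (nrm (mxcocycle F A n z *m v)) / n%:R) @ \oo --> chi z) /\
    (forall v : 'cV_m, Q1 z *m v = v -> exists2 k : R, 0 < k &
      \forall n \near \oo, nrm (mxcocycle F A n z *m v) <= expR
        (n%:R * (chi z - k)))]].

Let family_step (s : family) : exists t, link s t.
Proof.
have [D1 [Q1 [chi [DQ1 D1D mchi H]]]] :=
  level_step mF PF mA Aunit mphi phi0 iphi A_le AV_le (svalP s).
by exists (exist (fun DQ => proj_family P F A DQ.1 DQ.2) (D1, Q1) DQ1, chi).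
Qed.

Let family0 : proj_family P F A setT (fun=> 1%:M).
Proof.
split=> //; first exact: aeW.
- by move=> z _; rewrite mul1mx.
- by move=> z _; rewrite trmx1.
- by move=> z _; rewrite mul1mx.
- by move=> z _; rewrite mul1mx.
Qed.

Theorem filtration : exists (D : set Z) (Q : nat -> Z -> 'M[R]_m)
  (chi : nat -> Z -> R),
  [/\ (forall i, proj_family P F A D (Q i)),
    (forall i, measurable_fun D (chi i)),
      (forall z, D z -> Q 0%N z = 1%:M /\ Q m z = 0) &
   forall i z, D z ->
   [/\ chi i (F z) = chi i z, Q i.+1 z *m Q i z = Q i.+1 z, Q i z *m Q i.+1 z =
     Q i.+1 z,
    (Q i z != 0 -> Q i.+1 z != Q i z) &
    (forall v : 'cV_m, Q i z *m v = v -> Q i.+1 z *m v != v ->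
      (fun n => ln (nrm (mxcocycle F A n z *m v)) / n%:R) @ \oo --> chi i z) /\
    (Q i.+1 z != 0 -> chi i.+1 z < chi i z)]].
Proof.
have [f fP] := choice family_step.
pose s := fix s (i : nat) : family := if i is k.+1 then (f (s k)).1 else
  exist (fun DQ => proj_family P F A DQ.1 DQ.2) (setT, fun=> 1%:M) family0.
(* Each level may lose a null set; the countable intersection is one domain for all levels. *)
pose D := \bigcap_i (sval (s i)).1.
pose Q i := (sval (s i)).2; pose chi i := (f (s i)).2.
have sP i : proj_family P F A (sval (s i)).1 (Q i) by exact: (svalP (s i)).
have linkP i : link (s i) (s i.+1, chi i).
  by have := fP (s i); rewrite /chi /=; case: (f (s i)).
have mD : measurable D by apply: bigcapT_measurable => i;
  exact: (pf_meas (sP i)).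
have DS i : D `<=` (sval (s i)).1 by move=> z; apply.
have DP i : proj_family P F A D (Q i).
  split=> //.
  - by move=> z Dz k _; apply: (pf_inv (sP k)); exact: Dz.
  - by apply: filterS (ae_foralln (fun k => pf_ae (sP k))) => z H k _.
  - exact: measurable_mxS (pf_meas (sP i)) (DS i) (pf_measurable (sP i)).
  - by move=> z Dz; apply: (pf_idem (sP i)); exact: DS Dz.
  - by move=> z Dz; apply: (pf_sym (sP i)); exact: DS Dz.
  - by move=> z Dz; apply: (pf_img (sP i)); exact: DS Dz.
  - by move=> z Dz; apply: (pf_pre (sP i)); exact: DS Dz.
exists D, Q, chi; split => //.
- move=> i; have [_ mchi _] := linkP i.
  exact: measurable_funS (pf_meas (sP i.+1)) (DS i.+1) mchi.
- move=> z Dz; split=> //; apply/eqP.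
  (* As long as [Q i z] is nonzero its range shrinks strictly, so the rank drops with every level;
     once it is zero it remains zero. *)
  have rk i : (\rank (Q i z) <= m - i)%N.
    elim: i => [|i IH]; first by rewrite subn0 rank_leq_row.
    have [_ _ /(_ z (DS i.+1 _ Dz))[_ Qr Ql prop _]] := linkP i.
    change (Q i.+1 z *m Q i z = Q i.+1 z) in Qr.
    change (Q i z *m Q i.+1 z = Q i.+1 z) in Ql.
    change (Q i z != 0 -> Q i.+1 z != Q i z) in prop.
    have [Q0|Q0] := eqVneq (Q i z) 0.
      by rewrite -Qr Q0 mulmx0 mxrank0.
    have : (\rank (Q i.+1 z) < \rank (Q i z))%N.
      have sub : (Q i.+1 z <= Q i z)%MS by rewrite -{1}Qr submxMl.
      rewrite ltn_neqAle mxrankS // andbT; apply: contra (prop Q0) => rkE.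
      have [X QX] : exists X, Q i z = X *m Q i.+1 z.
        by apply/submxP; rewrite -(geq_leqif (mxrank_leqif_sup sub)) (eqP rkE).
      apply/eqP; by rewrite -[LHS]Ql [in LHS]QX -mulmxA (pf_idem (DP i.+1) Dz).
    by move=> /leq_trans/(_ IH); rewrite subnS; case: (m - i)%N.
  by rewrite -mxrank_eq0 -leqn0 -(subnn m) rk.
move=> i z Dz; have [_ _ /(_ z (DS i.+1 _ Dz))[h1 h2 h3 h4 [h5 h6]]] := linkP i.
split => //; split => // Q0.
have [_ _ /(_ z (DS i.+2 _ Dz))[_ g2 g3 g4 [g5 _]]] := linkP i.+1.
(* Such a vector has rate exactly [chi i.+1 z] by the next level and rate at most [chi i z - k] by
   the present one. *)
have [v Qv Q'v] : exists2 v : 'cV_m, Q i.+1 z *m v = v & Q i.+2 z *m v != v.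
  apply: contrapT => H; move: (g4 Q0) => /eqP; apply; rewrite -g2.
  apply: mx_col_ext => v; rewrite -mulmxA.
  apply: contrapT => /eqP H'; apply: H; exists (Q i.+1 z *m v) => //.
  by rewrite mulmxA (pf_idem (DP i.+1) Dz).
have v0 : v != 0 by apply: contraNneq Q'v => ->; rewrite mulmx0.
have [k k0 vk] := h6 v Qv.
have mxcocycle_pos n : 0 < nrm (mxcocycle F A n z *m v).
  rewrite lt_neqAle nrm_ge0 andbT eq_sym; apply: contra v0 => /eqP/nrm_eq0 Av.
  have un : mxcocycle F A n z \in unitmx.
    by elim: (n) => [|l IH]; rewrite ?unitmx1 //= unitmx_mul Aunit.
  by rewrite -[v](mulKmx un) Av mulmx0.
have k20 : 0 < k / 2 by rewrite divr_gt0.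
have lo := cvg_ln_ge mxcocycle_pos k20 (g5 v Qv Q'v).
rewrite ltNge; apply/negP => chi_le.
apply: (@expR_growth_contra _ (chi i.+1 z - k / 2) (chi i z - k) 1).
  by move: chi_le k0; lra.
by apply: filterS2 lo vk => n /le_trans h /h; rewrite mul1r.
Qed.

End Filtration.

(** * Grassmannian *)

Section EuclideanNorm.
Variables (R : realType) (m : nat).
Implicit Types (u v : 'cV[R]_m) (M : 'M[R]_m).

Lemma enorm_ge0 v : 0 <= enorm v.
Proof. exact: sqrtr_ge0. Qed.

Lemma enorm_sqr v : enorm v ^+ 2 = sqn v.
Proof. by rewrite /enorm sqr_sqrtr -?sqnE ?sqn_ge0. Qed.

Lemma enorm_le_nrm v : enorm v <= nrm v.
Proof.
rewrite -(@ler_pXn2r _ 2) ?nnegrE ?enorm_ge0 ?nrm_ge0 // enorm_sqr.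
exact: sqn_le_nrm.
Qed.

Lemma nrm_le_enorm v : nrm v <= m%:R * enorm v.
Proof. by apply: nrm_le_sqn; rewrite ?enorm_ge0 // enorm_sqr. Qed.

Lemma enormZ a v : enorm (a *: v) = `|a| * enorm v.
Proof.
rewrite /enorm -sqrtr_sqr -sqrtrM ?sqr_ge0 // mulr_sumr; congr Num.sqrt.
by apply: eq_bigr => i _; rewrite mxE exprMn.
Qed.

Lemma enorm_eq0 v : enorm v = 0 -> v = 0.
Proof. by move=> v0; apply: sqn_eq0; rewrite -enorm_sqr v0 expr0n. Qed.

Lemma enorm_delta (j : 'I_m) : enorm (delta_mx j ord0 : 'cV[R]_m) = 1.
Proof.
rewrite /enorm (bigD1 j) //= mxE !eqxx expr1n big1 ?addr0 ?sqrtr1 // => i ij.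
by rewrite mxE (negbTE ij) expr0n.
Qed.

Lemma opnorm_has_ubound M :
  has_ubound [set enorm (M *m v) | v in [set v : 'cV[R]_m | enorm v = 1]].
Proof.
exists (nrm M * m%:R) => _ [v v1 <-]; rewrite (le_trans (enorm_le_nrm _)) //.
rewrite (le_trans (nrmM _ _)) // ler_wpM2l ?nrm_ge0 //.
by rewrite (le_trans (nrm_le_enorm v)) // v1 mulr1.
Qed.

Lemma nrm_le_opnorm M : nrm M <= (m * m)%:R * opnorm M.
Proof.
apply: nrm_le => i j.
apply: (@le_trans _ _ (enorm (M *m delta_mx j ord0))).
  rewrite -colE -(@ler_pXn2r _ 2) ?nnegrE ?enorm_ge0 // enorm_sqr sqnE.
  rewrite (bigD1 i) //= mxE real_normK ?num_real // lerDl.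
  by apply: sumr_ge0 => k _; exact: sqr_ge0.
apply: (ub_le_sup (opnorm_has_ubound M)); exists (delta_mx j ord0) => //=.
exact: enorm_delta.
Qed.

Lemma logp_opnorm_ge0 M : 0 <= logp_opnorm M.
Proof. by rewrite /logp_opnorm le_max lexx. Qed.

(** The summand m * m absorbs the constant of [nrm_le_opnorm], since x <= expR x. *)
Lemma nrm_le_logp M : nrm M <= expR (logp_opnorm M + (m * m)%:R).
Proof.
have op0 : 0 <= (m * m)%:R :> R by [].
have [M0|M0] := eqVneq (nrm M) 0; first by rewrite M0 expR_ge0.
have op_gt0 : 0 < opnorm M.
  rewrite ltNge; apply/negP => opM.
  have := nrm_le_opnorm M; have : (m * m)%:R * opnorm M <= 0 by rewrite
    mulr_ge0_le0.
  by move=> /[swap] /le_trans /[apply]; rewrite le_eqVlt (negbTE M0) ltNge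
    nrm_ge0.
rewrite (le_trans (nrm_le_opnorm M)) // mulrC expRD ler_pM ?(ltW op_gt0) //.
  by rewrite -[leLHS]lnK ?posrE // ler_expR /logp_opnorm le_max lexx orbT.
by rewrite (le_trans _ (expR_ge1Dx _)) // lerDr.
Qed.

End EuclideanNorm.

Section Grassmannian.
Variables (R : realType) (m : nat).
Implicit Types (M N : 'M[R]_m).

Lemma mem_mx_img M (V : {vspace 'cV[R]_m}) w :
  reflect (exists2 v, v \in V & w = M *m v) (w \in mx_img M V).
Proof.
by apply: (iffP memv_imgP) => -[v Vv ->]; exists v => //; rewrite lfunE.
Qed.

Lemma mem_proj_img M w : M *m M = M -> (w \in mx_img M fullv) = (M *m w == w).
Proof.
move=> MM; apply/mem_mx_img/eqP => [[v _ ->]|<-]; first by rewrite mulmxA MM.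
by exists w; rewrite ?memvf.
Qed.

Lemma mx_img_neq0 M : M != 0 -> Gr (mx_img M fullv).
Proof.
move=> M0; apply/andP; split.
  rewrite lt0n dimv_eq0; apply: contra M0 => /eqP img0; apply/eqP.
  apply: mx_col_ext => v; rewrite mul0mx; apply/eqP.
  by rewrite -memv0 -img0; apply/mem_mx_img; exists v; rewrite ?memvf.
by rewrite (leq_trans (dimvS (subvf _))) // dimvf /dim /= muln1.
Qed.

Lemma unit_sphere_img M : M *m M = M -> M != 0 ->
  unit_sphere (mx_img M fullv) !=set0.
Proof.
move=> MM M0.
have [v Mv] : exists v : 'cV_m, M *m v != 0.
  apply: contrapT => H; move/eqP: M0; apply; apply: mx_col_ext => v.
  by rewrite mul0mx; apply: contrapT => /eqP Mv; apply: H; exists v.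
have Mv0 : enorm (M *m v) != 0 by apply: contra Mv => /eqP/enorm_eq0 ->.
exists ((enorm (M *m v))^-1 *: (M *m v)); split.
  by rewrite memvZ //; apply/mem_mx_img; exists v; rewrite ?memvf.
by rewrite enormZ normfV ger0_norm ?enorm_ge0 // mulVf.
Qed.

(** The terms m and 3 m ^ 3 are the two errors added up in [CE], from projecting and from
    normalizing; the term 1 makes C at least 1, so that C eta < 1 forces eta <= 1. *)
Let C : R := 1 + m%:R + 3 * m%:R ^+ 3.

(** The nearby point is [N *m a], normalized: it is close to [M *m a = a], so its length is close to
    1. *)
Lemma edist_unit_sphere M N (a : 'cV_m) : M *m M = M -> N *m N = N ->
  C * nrm (M - N) < 1 -> unit_sphere (mx_img M fullv) a ->
  edist_set a (unit_sphere (mx_img N fullv)) <= C * nrm (M - N).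
Proof.
move=> MM NN small [/mem_mx_img aM a1]; set eta := nrm (M - N) in small *.
have {}aM : M *m a = a by case: aM => v _ ->; rewrite mulmxA MM.
have eta0 : 0 <= eta by exact: nrm_ge0.
have m0 : 0 <= m%:R :> R by [].
have na : nrm a <= m%:R by have := nrm_le_enorm a; rewrite a1 mulr1.
pose b := N *m a; pose t := enorm b.
have t0 : 0 <= t by exact: enorm_ge0.
have nb : nrm b <= m%:R * t by exact: nrm_le_enorm.
have ab : nrm (a - b) <= eta * m%:R.
  rewrite -{1}aM /b -mulmxBl (le_trans (nrmM _ _)) // ler_wpM2l //.
have C1 : 0 <= C - 1.
  by have := exprn_ge0 3 m0; move: m0; rewrite /C; move: (_ ^+ 3) => y; lra.
have eta1 : eta <= 1.
  have : 0 <= (C - 1) * eta by rewrite mulr_ge0.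
  by move: small; rewrite mulrBl mul1r; lra.
have em : eta * m%:R <= m%:R by rewrite ler_piMl.
have nb' : nrm b <= m%:R + m%:R.
  rewrite (_ : b = a - (a - b)); last by rewrite opprB addrC subrK.
  by rewrite (le_trans (nrmB _ _)) // lerD // (le_trans ab).
(* Lengths are compared through their squares, factored coordinate by coordinate as differences
   times sums. *)
have t2 : `|t ^+ 2 - 1| <= eta * m%:R * (3 * m%:R).
  have a1' : 1 = sqn a by rewrite -enorm_sqr a1 expr1n.
  rewrite enorm_sqr [X in `|_ - X|]a1' !sqnE -sumrB.
  rewrite (le_trans (ler_norm_sum _ _ _)) //.
  rewrite (@le_trans _ _ (\sum_i `|(a - b) i ord0| * nrm (a + b))) //.
    apply: ler_sum => i _; rewrite subr_sqr normrM.
    rewrite (_ : b i ord0 - a i ord0 = - (a - b) i ord0);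
      last by rewrite !mxE opprB.
    rewrite normrN ler_wpM2l // (_ : b i ord0 + a i ord0 = (a + b) i ord0)
      ?ler_nrm //.
    by rewrite [RHS]mxE addrC.
  have sE : \sum_i `|(a - b) i ord0| = nrm (a - b).
    by apply: eq_bigr => i _; rewrite big_ord1.
  rewrite -mulr_suml sE ler_pM ?nrm_ge0 //.
  rewrite (le_trans (nrmD _ _)) // (le_trans (lerD na nb')) //.
  by rewrite le_eqVlt; apply/orP; left; apply/eqP; ring.
have t1 : `|t - 1| <= eta * m%:R * (3 * m%:R).
  rewrite (le_trans _ t2) // (_ : t ^+ 2 - 1 = (t - 1) * (t + 1)); last by ring.
  rewrite normrM ler_peMr //.
  by rewrite ger0_norm ?addr_ge0 // lerDr.
have CE : C * eta = eta + eta * m%:R + m%:R * (eta * m%:R * (3 * m%:R)).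
  by rewrite /C; ring.
have tpos : 0 < t.
  rewrite lt_neqAle t0 andbT eq_sym; apply/eqP => t00.
  have b0 : b = 0 by exact: enorm_eq0.
  have a_small : 1 <= eta * m%:R.
    by rewrite -{1}a1 (le_trans (enorm_le_nrm _)) // -{1}[a]subr0 -b0.
  have : 0 <= m%:R * (eta * m%:R * (3 * m%:R)) by rewrite !mulr_ge0.
  by move: small; rewrite CE; move: a_small eta0; lra.
rewrite /edist_set; apply: (@le_trans _ _ (enorm (a - t^-1 *: b))).
  apply: ge_inf; first by exists 0 => _ [c _ <-]; exact: enorm_ge0.
  exists (t^-1 *: b) => //; split.
    by rewrite memvZ //; apply/mem_mx_img; exists a; rewrite ?memvf.
  by rewrite enormZ normfV ger0_norm // mulVf // gt_eqF.
rewrite (le_trans (enorm_le_nrm _)) //.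
have -> : a - t^-1 *: b = (a - b) + (1 - t^-1) *: b.
  by rewrite scalerBl scale1r addrA subrK.
rewrite (le_trans (nrmD _ _)) // nrmZ CE.
have : `|1 - t^-1| * nrm b <= m%:R * (eta * m%:R * (3 * m%:R)).
  have -> : 1 - t^-1 = (t - 1) / t by rewrite mulrBl divff ?gt_eqF // mul1r.
  have nbt : t^-1 * nrm b <= m%:R by rewrite mulrC ler_pdivrMr.
  rewrite normrM normfV (ger0_norm t0) -[_ / _ * nrm b]mulrA mulrC.
  by apply: ler_pM => //; rewrite ?mulr_ge0 ?invr_ge0 ?nrm_ge0.
by move: ab eta0; lra.
Qed.

Lemma dist_Gr_proj M N : M *m M = M -> N *m N = N -> M != 0 -> N != 0 ->
  C * nrm (M - N) < 1 ->
  dist_Gr (mx_img M fullv) (mx_img N fullv) <= C * nrm (M - N).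
Proof.
move=> MM NN M0 N0 small; rewrite /dist_Gr /hausdorff_dist ge_max; apply/andP;
  split.
  apply: ge_sup; first by have [a aM] := unit_sphere_img MM M0;
    exists (edist_set a (unit_sphere (mx_img N fullv))); exists a.
  by move=> _ [a aM <-]; exact: edist_unit_sphere.
have NMc : nrm (M - N) = nrm (N - M) by rewrite -nrmN opprB.
apply: ge_sup; first by have [a aN] := unit_sphere_img NN N0;
  exists (edist_set a (unit_sphere (mx_img M fullv))); exists a.
by move=> _ [a aN <-]; rewrite NMc; apply: edist_unit_sphere => //;
  rewrite -NMc.
Qed.

Lemma Gr_open_proj U M : Gr_open U -> M *m M = M -> M != 0 ->
  U (mx_img M fullv) -> exists2 s : R, 0 < s & forall N, N *m N = N -> N != 0 ->
    nrm (M - N) < s -> U (mx_img N fullv).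
Proof.
move=> [_ oU] MM M0 UM; have [e e0 He] := oU _ UM.
have C0 : 0 < C by rewrite /C -addrA ltr_pwDl // addr_ge0 ?mulr_ge0 ?exprn_ge0.
exists (Num.min 1 e / C) => [|N NN N0]; first by rewrite divr_gt0 // lt_min
  ltr01.
rewrite ltr_pdivlMr // mulrC lt_min => /andP[s1 se].
apply: He; first exact: mx_img_neq0.
by rewrite (le_lt_trans _ se) // dist_Gr_proj.
Qed.

Lemma rat_mx_dense (X : 'M[R]_m) (s : R) : 0 < s ->
  exists N : 'M[rat]_m, nrm (X - map_mx ratr N) < s.
Proof.
move=> s0; pose e := s / ((m * m).+1%:R).
have e0 : 0 < e by rewrite divr_gt0.
have /choice[f Hf] : forall ij : 'I_m * 'I_m, exists q : rat,
    `|X ij.1 ij.2 - ratr q| <= e.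
  move=> [i j] /=; have [q] : exists q, ratr q \in `]X i j - e, X i j + e[.
    by apply: rat_in_itvoo; rewrite ltrBlDr -addrA ltrDl addr_gt0.
  rewrite in_itv /= => /andP[h1 h2]; exists q.
  by rewrite ler_distl; apply/andP; split; move: (ltW h1) (ltW h2); lra.
exists (\matrix_(i, j) f (i, j)).
apply: (@le_lt_trans _ _ ((m * m)%:R * e)).
  by apply: nrm_le => i j; rewrite !mxE; exact: (Hf (i, j)).
by rewrite /e mulrA ltr_pdivrMr // mulrC ltr_pM2l // ltr_nat.
Qed.

(** The balls of radius 1 / (k + 1) around rational matrices are countably many, and each has a
    measurable preimage because [nrm] is measurable in the entries. *)
Lemma measurable_nrm_open (d : measure_display) (Z : measurableType d)
    (D : set Z) (Q : Z -> 'M[R]_m) (O : set 'M[R]_m) : measurable D ->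
      measurable_mx D Q ->
  (forall X, O X -> exists2 s : R, 0 < s & forall Y, nrm (X - Y) < s -> O Y) ->
  measurable (D `&` Q @^-1` O).
Proof.
move=> mD mQ oO.
pose ball (Nk : 'M[rat]_m * nat) : set 'M[R]_m :=
  [set X | nrm (X - map_mx ratr Nk.1) < Nk.2.+1%:R^-1].
have -> : D `&` Q @^-1` O = \bigcup_(Nk in [set Nk | ball Nk `<=` O])
  (D `&` Q @^-1` ball Nk).
  apply/seteqP; split=> z /=; last by move=> [Nk NkO [Dz Qz]]; split=> //;
    exact: NkO.
  move=> [Dz /oO[s s0 sO]].
  have [k ks] : exists k : nat, k.+1%:R^-1 <= s / 2.
    have s20 : 0 < s / 2 by rewrite divr_gt0.
    have /ltW i_gt : (s / 2)^-1 < (Num.truncn (s / 2)^-1).+1%:R by exact: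
      truncnS_gt.
    by exists (Num.truncn (s / 2)^-1); rewrite -[leRHS]invrK lef_pV2 ?posrE
      ?invr_gt0.
  have k0 : 0 < k.+1%:R^-1 :> R by rewrite invr_gt0.
  have [N HN] := rat_mx_dense (Q z) k0.
  exists (N, k) => //= Y; rewrite /ball /= => HY; apply: sO.
  rewrite (_ : Q z - Y = (Q z - map_mx ratr N) - (Y - map_mx ratr N));
    last by rewrite opprB addrA subrK.
  by rewrite (le_lt_trans (nrmB _ _)) //; move: ks HN HY; move: (_^-1) => y;
    lra.
rewrite bigcup_mkcond; apply: countable_bigcupT_measurable;
  first exact: countableP.
move=> Nk; case: ifP => // _.
rewrite (_ : D `&` _ = D `&` [set z | nrm (Q z - map_mx ratr Nk.1) <
  Nk.2.+1%:R^-1]) //.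
apply: (@measurable_fun_ltr _ _ _ _ _ (cst _) _ _ mD [set true]) => //.
apply: (@measurable_nrm _ _ _ D _ _ (fun z => Q z - map_mx ratr Nk.1)).
by apply: measurable_mxD => //; exact: measurable_mx_cst.
Qed.

Lemma Gr_measurable_proj (d : measure_display) (Z : measurableType d)
    (D : set Z) (Q : Z -> 'M[R]_m) : measurable D -> measurable_mx D Q ->
  (forall z, D z -> Q z *m Q z = Q z) -> (forall z, D z -> Q z != 0) ->
  Gr_measurable_fun D (fun z => mx_img (Q z) fullv).
Proof.
move=> mD mQ QQ Q0; have GrQ z : D z -> Gr (mx_img (Q z) fullv).
  by move=> /Q0; exact: mx_img_neq0.
split=> //; suff sub : @Gr_borel R m `<=`
    [set S | measurable (D `&` (fun z => mx_img (Q z) fullv) @^-1` S)] by exact: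
      sub.
apply: smallest_sub => [|U oU].
  split.
  - by rewrite /= preimage_set0 setI0.
  - move=> W mW /=; rewrite (_ : _ `&` _ = D `\`
    (D `&` (fun z => mx_img (Q z) fullv) @^-1` W)).
      exact: measurableD.
    apply/seteqP; split=> z /=; first by move=> [Dz [_ nW]]; split=> // -[].
    by move=> [Dz nW]; split=> //; split; [exact: GrQ|move=> ?; exact: nW].
  - move=> W mW /=; rewrite preimage_bigcup setI_bigcupr.
    by apply: bigcupT_measurable.
(* The idempotents do not form an open set. [O] is an open set of matrices whose nonzero idempotents
   are exactly those with range in [U]. *)
pose O := [set X : 'M[R]_m | exists2 s : R, 0 < s & forall N, N *m N = N -> N !=
  0 ->
    nrm (X - N) < s -> U (mx_img N fullv)].
rewrite /= (_ : D `&` _ = D `&` Q @^-1` O); last first.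
  apply/seteqP; split=> z /= [Dz Uz]; split=> //.
    exact: (Gr_open_proj oU (QQ z Dz) (Q0 z Dz)).
  by case: Uz => s s0; apply => //; [exact: QQ|exact: Q0|rewrite subrr nrm0].
apply: measurable_nrm_open => // X [s s0 sU].
exists (s / 2) => [|Y XY]; first by rewrite divr_gt0.
exists (s / 2) => [|N NN N0 YN]; first by rewrite divr_gt0.
apply: sU => //; rewrite (_ : X - N = (X - Y) + (Y - N));
  last by rewrite addrA subrK.
by rewrite (le_lt_trans (nrmD _ _)) // [s]splitr ltrD.
Qed.

End Grassmannian.

(** * Skew product over the shift *)

From mathcomp Require Import finmap.

Section Words.
Variable n : nat.

Lemma cylinderP (w : seq 'I_n.+1) (omega : words n) :
  cylinder w omega <-> forall i, (i < size w)%N -> omega i = nth ord0 w i.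
Proof.
split=> [H i iw|H]; first by rewrite -[in RHS]H nth_mkseq.
apply: (@eq_from_nth _ ord0); rewrite ?size_mkseq // => i iw.
by rewrite nth_mkseq // H.
Qed.

Lemma cylinder_cons (a : 'I_n.+1) (w : seq 'I_n.+1) :
  cylinder (a :: w) = cylinder [:: a] `&` @shift_word n @^-1` cylinder w.
Proof.
apply/seteqP; split=> omega /=.
  move=> /cylinderP H; split; apply/cylinderP => i iw.
    by move: iw; case: i => // _; exact: (H 0%N).
  exact: (H i.+1).
by move=> [/cylinderP H1 /cylinderP H2]; apply/cylinderP => -[_|i iw];
  [exact: (H1 0%N)|exact: H2].
Qed.

Lemma cylinderI (w w' : seq 'I_n.+1) : (size w <= size w')%N ->
  cylinder w `&` cylinder w' = cylinder w' \/ cylinder w `&` cylinder w' = set0.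
Proof.
move=> ww'; have [[omega [/cylinderP ow /cylinderP ow']]|H] :=
  pselect (exists omega, (cylinder w `&` cylinder w') omega).
  left; apply/seteqP; split=> [omega' []|omega' cw'] //; split=> //.
  apply/cylinderP => i iw; move/cylinderP: cw' => cw'.
  by rewrite -ow // ow' ?cw' // (leq_trans iw).
by right; apply/seteqP; split=> // omega ww; apply: H; exists omega.
Qed.

Definition cylinders : set (set (words n)) :=
  [set C | C = set0 \/ exists w, C = cylinder w].

Lemma setI_cylinders : setI_closed cylinders.
Proof.
move=> _ _ [->|[w ->]] [->|[w' ->]]; rewrite ?set0I ?setI0; try by left.
have [ww'|/ltnW ww'] := leqP (size w) (size w').
  by have [->|->] := cylinderI ww'; [right; exists w'|left].
by rewrite setIC; have [->|->] := cylinderI ww'; [right; exists w|left].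
Qed.

Lemma open_cylinder w : open (@cylinder n w).
Proof.
exists [set cylinder w]; last by rewrite bigcup_set1.
by move=> _ ->; apply: (@finI_from1 _ _ _ id); exists w.
Qed.

(** A basic neighbourhood involves finitely many cylinders, hence only the first [K] letters, and so
    contains the cylinder of the prefix of length [K]. *)
Lemma open_words_bigcup (U : set (words n)) : open U ->
  U = \bigcup_(w in [set w | cylinder w `<=` U]) cylinder w.
Proof.
move=> [D' D'fin UE]; apply/seteqP; split=> omega; last by move=> [w wU ow];
  exact: wU.
rewrite -{1}UE => -[I D'I Iomega]; have IU : I `<=` U by move=> x Ix;
  rewrite -UE; exists I.
have [E EC IE] : finI_from (range (@cylinder n)) id I := D'fin I D'I.
have /choice[wd Hwd] : forall C : set (words n), exists w, C \in E -> C =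
  cylinder w.
  move=> C; have [CE|CE] := boolP (C \in E); last by exists [::].
  by have /set_mem[w _ <-] := EC _ CE; exists w.
pose K := \max_(C <- E) size (wd C).
have HK C : C \in E -> forall omega', (forall i, (i < K)%N -> omega' i = omega
  i) -> C omega'.
  move=> CE omega' oo'; rewrite (Hwd C CE); apply/cylinderP => i iC.
  have : C omega by move: Iomega; rewrite -IE; apply.
  rewrite {1}(Hwd C CE) => /cylinderP <- //; apply: oo'.
  by rewrite (leq_trans iC) // /K (big_rem C) //= leq_maxl.
exists (prefix_word omega K); last by apply/cylinderP => i;
  rewrite size_mkseq => iK; rewrite nth_mkseq.
move=> omega' /cylinderP; rewrite size_mkseq => H; apply: IU;
  rewrite -IE => C CE.
by apply: (HK C CE) => i iK; rewrite H // nth_mkseq.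
Qed.

(** A generating family closed under intersection is what [measure_unique] requires. Unions of
    cylinders are countable unions, as there are countably many finite words. *)
Lemma measurable_words : @measurable _ (words n) = <<s cylinders >>.
Proof.
apply/seteqP; split.
  apply: smallest_sub; first exact: smallest_sigma_algebra.
  move=> U /open_words_bigcup ->.
  have mC w : <<s cylinders >> (cylinder w).
    by apply: sub_sigma_algebra; right; exists w.
  rewrite bigcup_mkcond.
  apply: (@countable_bigcupT_measurable _ (g_sigma_algebraType cylinders));
    first exact: countableP.
  by move=> w; case: ifP => _; [exact: mC|apply: sub_sigma_algebra; left].
apply: smallest_sub; first exact: smallest_sigma_algebra.
move=> C [->|[w ->]]; first exact: measurable0.
by apply: sub_sigma_algebra; exact: open_cylinder.
Qed.

Lemma measurable_cylinder w : measurable (@cylinder n w).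
Proof. by rewrite measurable_words; apply: sub_sigma_algebra; right;
  exists w. Qed.

Lemma measurable_shift : measurable_fun setT (@shift_word n).
Proof.
apply: (measurability _ measurable_words) => _ [C [->|[w ->]] <-].
  by rewrite preimage_set0 setI0.
rewrite setTI (_ : _ @^-1` _ = \bigcup_(a : 'I_n.+1) cylinder (a :: w)).
  by apply: countable_bigcupT_measurable => // a; exact: measurable_cylinder.
apply/seteqP; split=> omega /=.
  move=> ow; exists (omega 0%N) => //; rewrite cylinder_cons; split;
    last exact: ow.
  by apply/cylinderP => -[].
by move=> [a _]; rewrite cylinder_cons => -[].
Qed.

Lemma cylinder1P (a : 'I_n.+1) (omega : words n) : cylinder [:: a] omega <->
  omega 0%N = a.
Proof.
split=> [/cylinderP/(_ 0%N isT)//|<-]; by apply/cylinderP => -[].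
Qed.

End Words.

Section BernoulliShift.
Variables (R : realType) (n : nat) (p : 'I_n.+1 -> R).
Hypothesis hp : prob_vector p.
Variable B : probability (words n) R.
Hypothesis hB : is_bernoulli p B.

(** Both sides are finite measures in [C], and on cylinders they agree because the weight of a word
    is a product over its letters. *)
Lemma bernoulli_shift (a : 'I_n.+1) (C : set (words n)) : measurable C ->
  B (cylinder [:: a] `&` @shift_word n @^-1` C) = ((p a)%:E * B C)%E.
Proof.
move=> mC; have pa : 0 <= p a by case: hp.
suff : pushforward (mrestr B (measurable_cylinder [:: a])) (@shift_word n) C =
    mscale (NngNum pa) B C.
  by rewrite /pushforward /mrestr /mscale /= setIC.
apply: (@measure_unique _ R _ (@cylinders n) (fun=> setT) (@measurable_words n)
  (@setI_cylinders n) _ _ (pushforward (mrestr B (measurable_cylinder [:: a]))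
    (@shift_word n))
  (mscale (NngNum pa) B)) => //.
- by move=> _; right; exists [::]; apply/seteqP; split=> // omega _;
  apply/cylinderP.
- by rewrite bigcup_const //; exists 0%N.
- exact: measurable_shift.
- move=> mf _ [->|[w ->]]; first by rewrite !measure0.
  change (B (@shift_word n @^-1` cylinder w `&` cylinder [:: a]) =
    ((p a)%:E * B (cylinder w))%E).
  by rewrite setIC -cylinder_cons !hB big_cons EFinM.
- move=> mf _; change (B (@shift_word n @^-1` setT `&` cylinder [:: a]) <
  +oo)%E.
  rewrite preimage_setT setTI.
  by rewrite (le_lt_trans (probability_le1 _ (measurable_cylinder _))) // ltry.
Qed.

End BernoulliShift.

Section BaseSystem.
Context (disp : measure_display) (X : measurableType disp) (R : realType)
  (n : nat).
Variables (mu : probability X R) (p : 'I_n.+1 -> R)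
  (B : probability (words n) R).
Variable T : 'I_n.+1 -> X -> X.
Hypothesis hp : prob_vector p.
Hypothesis hB : is_bernoulli p B.
Hypothesis hT : forall i, measure_preserving mu (T i).

Definition base_map (z : words n * X) : words n * X :=
  (shift_word z.1, traj_map T z.1 1 z.2).

Lemma iter_base_map k (omega : words n) (x : X) :
  iter k base_map (omega, x) = (iter k (@shift_word n) omega, traj_map T omega k
    x).
Proof.
elim: k => [//|k IH]; rewrite iterS IH /base_map /= traj_mapS.
by congr (_, _); rewrite traj_mapS iter_shift_word.
Qed.

Let preimage_base_map (C : set (words n)) (E : set X) :
  base_map @^-1` (C `*` E) = \bigcup_(a : 'I_n.+1)
    ((cylinder [:: a] `&` @shift_word n @^-1` C) `*` (T a @^-1` E)).
Proof.
apply/seteqP; split=> -[omega x] /=.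
  by move=> [oC xE]; exists (omega 0%N).
by move=> [a _ [[/cylinder1P oa oC] xE]]; split => //; move: xE; rewrite -oa.
Qed.

Lemma measurable_base_map : measurable_fun setT base_map.
Proof.
apply: measurable_fun_pair.
  exact: measurableT_comp (@measurable_shift n) (@measurable_fst _ _ _ _).
move=> _ E mE; rewrite setTI.
rewrite (_ : _ @^-1` E = base_map @^-1` (setT `*` E)); last first.
  by apply/seteqP; split=> z /=; [move=> ?; split|case].
rewrite preimage_base_map; apply: countable_bigcupT_measurable => // a.
rewrite preimage_setT setIT; apply: measurableX;
  first exact: measurable_cylinder.
by rewrite -[X in measurable X]setTI; exact: (hT a).1.
Qed.

(** Split by the first letter, the preimage of a rectangle is a disjoint union of rectangles of mass
    p a times that of the original one, and the p a add up to 1. Rectangles determine the product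
    measure. *)
Lemma base_map_preserving (S : set (words n * X)) : measurable S ->
  (B \x mu)%E (base_map @^-1` S) = (B \x mu)%E S.
Proof.
move=> mS; symmetry; transitivity (pushforward (B \x mu)%E base_map S);
  last by [].
apply: (@product_measure_unique _ _ _ _ _ B mu
  (pushforward (B \x mu)%E base_map)) => //.
  exact: measurable_base_map.
move=> mf C E mC mE; change ((B \x mu)%E (base_map @^-1` (C `*` E)) =
  (B C * mu E)%E).
have mshift : measurable (@shift_word n @^-1` C).
  by rewrite -[X in measurable X]setTI; exact: measurable_shift.
have mcyl a : measurable (cylinder [:: a] `&` @shift_word n @^-1` C).
  by apply: measurableI => //; exact: measurable_cylinder.
have mTE a : measurable (T a @^-1` E).
  by rewrite -[X in measurable X]setTI; exact: (hT a).1.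
rewrite preimage_base_map (_ : \bigcup_a _ = \big[setU/set0]_(a < n.+1)
    ((cylinder [:: a] `&` @shift_word n @^-1` C) `*` (T a @^-1` E)));
      last first.
  by rewrite -bigcup_pred; congr (\bigcup_(t in _) _); apply/seteqP.
rewrite measure_bigsetU_ord; last 2 first.
- by move=> a; exact: measurableX.
- apply/trivIsetP => a b _ _ ab; apply/seteqP; split=> // -[omega x] /=.
  move=> [[[/cylinder1P oa _] _] [[/cylinder1P ob _] _]].
  by move: ab; rewrite -oa -ob eqxx.
rewrite (eq_bigr (fun a => (p a)%:E * (B C * mu E))%E); last first.
  move=> a _; apply: etrans (@product_measure1E _ _ _ _ _ B mu _ _ (mcyl a)
    (mTE a)) _.
  rewrite muleA; congr (_ * _)%E; first exact: bernoulli_shift.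
  exact: (hT a).2.
have BE : (B C * mu E)%E \is a fin_num.
  by rewrite fin_numM // ge0_fin_numE // (le_lt_trans (probability_le1 _ _)) //
    ltry.
rewrite -(fineK BE) -ge0_sume_distrl.
  by rewrite sumEFin hp.2 mul1e.
by move=> a _; rewrite lee_fin hp.1.
Qed.

Lemma integrable_snd (f : X -> \bar R) : mu.-integrable setT f ->
  (B \x mu)%E.-integrable setT (f \o snd).
Proof.
move=> /integrableP[mf foo]; apply/integrable12ltyP.
  exact: measurableT_comp mf (@measurable_snd _ _ _ _).
by rewrite /= integral_cst //= probability_setT mule1.
Qed.

End BaseSystem.

(** * Flags *)

Section Flags.
Context (d : measure_display) (Z : measurableType d) (R : realType) (m : nat).
Variables (P : probability Z R) (F : Z -> Z) (A : Z -> 'M[R]_m).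
Variables (D : set Z) (Q : nat -> Z -> 'M[R]_m) (chi : nat -> Z -> R).
Hypothesis m_gt0 : (0 < m)%N.
Hypothesis Aunit : forall z, A z \in unitmx.
Hypothesis DQ : forall i, proj_family P F A D (Q i).
Hypothesis mchi : forall i, measurable_fun D (chi i).
Hypothesis Q_ends : forall z, D z -> Q 0%N z = 1%:M /\ Q m z = 0.
Hypothesis Q_chain : forall i z, D z ->
   [/\ chi i (F z) = chi i z, Q i.+1 z *m Q i z = Q i.+1 z, Q i z *m Q i.+1 z =
     Q i.+1 z,
    (Q i z != 0 -> Q i.+1 z != Q i z) &
    (forall v : 'cV_m, Q i z *m v = v -> Q i.+1 z *m v != v ->
      (fun n => ln (nrm (mxcocycle F A n z *m v)) / n%:R) @ \oo --> chi i z) /\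
    (Q i.+1 z != 0 -> chi i.+1 z < chi i z)].

(** This is r: level [i] carries an exponent exactly when [Q i z] is nonzero. The search succeeds
    because [Q m z] is zero. *)
Definition depth (z : Z) : nat := find (fun i => Q i z == 0) (iota 0 m.+1).

Lemma depth_eq0 z i : D z -> (Q i z == 0) = (depth z <= i)%N.
Proof.
move=> Dz; have [_ Qm] := Q_ends Dz.
have has0 : has (fun i => Q i z == 0) (iota 0 m.+1).
  by apply/hasP; exists m; rewrite ?Qm // mem_iota leq0n add0n ltnSn.
have dm : (depth z < m.+1)%N by move: has0; rewrite has_find size_iota.
have Qd : Q (depth z) z = 0.
  by have := nth_find 0 has0; rewrite -/(depth z) nth_iota // add0n => /eqP.
have Q_down k : Q (depth z + k)%N z = 0.
  elim: k => [|k IH]; first by rewrite addn0.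
  by rewrite addnS; have [_ <- _ _ _] := Q_chain (depth z + k) Dz;
    rewrite IH mulmx0.
have [di|id] := leqP (depth z) i; first by rewrite -(subnKC di) Q_down eqxx.
have := before_find 0 id; rewrite nth_iota ?add0n ?(ltn_trans id) //.
Qed.

Lemma depth_gt0 z : D z -> (0 < depth z)%N.
Proof.
move=> Dz; rewrite ltnNge -depth_eq0 // (Q_ends Dz).1.
apply/eqP => /matrixP/(_ (Ordinal m_gt0) (Ordinal m_gt0))/eqP.
by rewrite !mxE eqxx oner_eq0.
Qed.

Lemma depth_inv z : D z -> depth (F z) = depth z.
Proof.
move=> Dz; have DF := pf_inv (DQ 0) Dz.
suff QF i : (Q i (F z) == 0) = (Q i z == 0).
  by apply/eqP; rewrite eqn_leq -(depth_eq0 _ DF) QF depth_eq0 // leqnn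
    -(depth_eq0 _ Dz) -QF depth_eq0 // leqnn.
apply/eqP/eqP => Q0.
  by rewrite -[Q i z](mulKmx (Aunit z)) -(pf_img (DQ i) Dz) Q0 mul0mx mulmx0.
by rewrite -[Q i (F z)](mulKVmx (Aunit z)) -(pf_pre (DQ i) Dz) Q0 mul0mx mulmx0.
Qed.

(** Levels are numbered downwards from the top rate but the flag upwards from zero, so index [k]
    belongs to level [depth z - k]. *)
Definition flag (k : nat) (z : Z) : {vspace 'cV[R]_m} :=
  mx_img (Q (depth z - k) z) fullv.

Definition exponent (k : nat) (z : Z) : R := chi (depth z - k) z.

Lemma mem_flag k z v : D z -> (v \in flag k z) = (Q (depth z - k) z *m v == v).
Proof. by move=> Dz; rewrite mem_proj_img // (pf_idem (DQ _) Dz). Qed.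

Lemma flag0 z : D z -> flag 0 z = 0%VS.
Proof.
move=> Dz; apply/eqP; rewrite -subv0; apply/subvP => v.
rewrite mem_flag // subn0 (_ : Q (depth z) z = 0); last first.
  by apply/eqP; rewrite depth_eq0.
by rewrite mul0mx eq_sym memv0.
Qed.

Lemma flag_depth z : D z -> flag (depth z) z = fullv.
Proof.
move=> Dz; apply/eqP; rewrite eqEsubv subvf; apply/subvP => v _.
by rewrite mem_flag // subnn (Q_ends Dz).1 mul1mx.
Qed.

Lemma flag_incr k z : D z -> (k < depth z)%N ->
  (flag k z <= flag k.+1 z)%VS /\ flag k z <> flag k.+1 z.
Proof.
move=> Dz kd; pose i := (depth z - k.+1)%N.
have iE : (depth z - k = i.+1)%N by rewrite /i subnSK.
have [_ h1 h2 h3 _] := Q_chain i Dz.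
have Qi0 : Q i z != 0 by rewrite depth_eq0 // -ltnNge /i ltn_subrL
  (leq_ltn_trans _ kd).
split=> [|flagE].
  apply/subvP => v; rewrite !mem_flag // iE -/i => /eqP Qv.
  by rewrite -Qv mulmxA h2.
have /eqP := h3 Qi0; apply; rewrite -h1; apply: mx_col_ext => v.
apply/eqP; rewrite -mulmxA -iE -mem_flag // flagE mem_flag // -/i mulmxA.
by rewrite (pf_idem (DQ i) Dz).
Qed.

Lemma exponent_incr k z : D z -> (0 < k)%N -> (k < depth z)%N ->
  exponent k z < exponent k.+1 z.
Proof.
move=> Dz k0 kd; pose i := (depth z - k.+1)%N.
have iE : (depth z - k = i.+1)%N by rewrite /i subnSK.
rewrite /exponent iE -/i; have [_ _ _ _ [_]] := Q_chain i Dz; apply.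
by rewrite depth_eq0 // -iE -ltnNge ltn_subrL k0 (leq_ltn_trans _ kd).
Qed.

Lemma flag_inv k z : D z -> mx_img (A z) (flag k z) = flag k (F z).
Proof.
move=> Dz; have DF := pf_inv (DQ 0) Dz.
rewrite /flag depth_inv //; set i := (_ - k)%N.
apply/eqP; rewrite eqEsubv; apply/andP; split; apply/subvP => w.
  move=> /mem_mx_img[v]; rewrite mem_proj_img ?(pf_idem (DQ i)) // => /eqP Qv
    ->.
  rewrite mem_proj_img ?(pf_idem (DQ i)) // -Qv; apply/eqP.
  by rewrite (mulmxA (A z)) mulmxA (pf_img (DQ i) Dz).
rewrite mem_proj_img ?(pf_idem (DQ i)) // => /eqP Qw.
apply/mem_mx_img; exists (invmx (A z) *m w); last by rewrite mulKVmx.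
rewrite mem_proj_img ?(pf_idem (DQ i)) //; apply/eqP.
by rewrite -Qw (mulmxA (invmx _)) mulmxA (pf_pre (DQ i) Dz).
Qed.

Lemma exponent_inv k z : D z -> exponent k (F z) = exponent k z.
Proof.
move=> Dz; rewrite /exponent depth_inv //.
by have [-> _ _ _ _] := Q_chain (depth z - k) Dz.
Qed.

Lemma mxcocycle_enorm_cvg k z (v : 'cV_m) : D z -> (0 < k <= depth z)%N ->
  v \in flag k z -> v \notin flag k.-1 z ->
  (fun n => n%:R^-1 * ln (enorm (mxcocycle F A n z *m v))) @ \oo --> exponent k
    z.
Proof.
move=> Dz /andP[k0 kd]; rewrite !mem_flag // => /eqP Qv.
(* Positive [k] makes [k] and [k.-1] consecutive levels, so [v] lies in the range at one level and
   not at the next. *)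
have -> : (depth z - k.-1 = (depth z - k).+1)%N.
  by case: k k0 kd {Qv} => // k _ kd; rewrite subnSK.
move=> Q'v; have [_ _ _ _ [+ _]] := Q_chain (depth z - k) Dz.
move=> /(_ v Qv Q'v) H; rewrite -/(exponent k z) in H.
have v0 : v != 0 by apply: contraNneq Q'v => ->; rewrite mulmx0.
have pos n : 0 < nrm (mxcocycle F A n z *m v).
  rewrite lt_neqAle nrm_ge0 andbT eq_sym; apply: contra v0 => /eqP/nrm_eq0 Av.
  have un : mxcocycle F A n z \in unitmx.
    by elim: (n) => [|l IH]; rewrite ?unitmx1 //= unitmx_mul Aunit.
  by rewrite -[v](mulKmx un) Av mulmx0.
rewrite (_ : (fun n => _) = (fun n => ln (enorm (mxcocycle F A n z *m v)) /
  n%:R)); last first.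
  by apply/funext => n; rewrite mulrC.
apply: expR_squeeze => e e0.
  have e20 : 0 < e / 2 by rewrite divr_gt0.
  have lo := cvg_ln_ge pos e20 H; near=> n.
  have h1 : expR (n%:R * (exponent k z - e / 2)) <= nrm (mxcocycle F A n z *m v)
    by near: n.
  have h2 : m%:R <= expR (n%:R * (e / 2)) by near: n; exact: cst_le_expR.
  have := le_trans h1 (nrm_le_enorm _) => h3.
  have : expR (n%:R * (exponent k z - e / 2)) <=
      expR (n%:R * (e / 2)) * enorm (mxcocycle F A n z *m v).
    by rewrite (le_trans h3) // ler_wpM2r // enorm_ge0.
  rewrite -ler_pdivrMl ?expR_gt0 // -expRN -expRD; apply: le_trans.
  by rewrite ler_expR le_eqVlt; apply/orP; left; apply/eqP; field.
apply: filterS (cvg_ln_le pos e0 H) => n; apply: le_trans; exact: enorm_le_nrm.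
Unshelve. all: by end_near. Qed.

Lemma measurable_depth_level i : measurable (D `&` [set z | depth z = i]).
Proof.
have mD := pf_meas (DQ 0).
have mle j : measurable (D `&` [set z | (depth z <= j)%N]).
  rewrite (_ : _ `&` _ = D `&` [set z | nrm (Q j z) == 0]).
    apply: (@measurable_fun_eqr _ _ _ _ _ (cst 0) _ _ mD [set true]) => //.
    exact/measurable_nrm/(pf_measurable (DQ j)).
  apply/seteqP; split=> z /= [Dz H]; split=> //.
    by move: H; rewrite -depth_eq0 // => /eqP ->; rewrite nrm0.
  by rewrite -depth_eq0 //; apply/eqP/nrm_eq0/eqP.
case: i => [|i].
  rewrite (_ : [set z | depth z = 0%N] = [set z | (depth z <= 0)%N]) //.
  by apply/seteqP; split=> z /=; rewrite leqn0 => /eqP.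
rewrite (_ : _ `&` _ = (D `&` [set z | (depth z <= i.+1)%N]) `\`
    (D `&` [set z | (depth z <= i)%N])); first exact: measurableD.
apply/seteqP; split=> z /=.
  by move=> [Dz ->]; split; [split|move=> [_]; rewrite ltnn].
move=> [[Dz d1] d2]; split=> //; apply/eqP; rewrite eqn_leq d1 ltnNge.
by apply/negP => d3; apply: d2.
Qed.

Lemma measurable_depth : measurable_fun D depth.
Proof.
move=> _ Y _; rewrite (_ : D `&` _ = \bigcup_(i in Y)
  (D `&` [set z | depth z = i])).
  by apply: bigcup_measurable => i _; exact: measurable_depth_level.
apply/seteqP; split=> z /=; first by move=> [Dz Yz]; exists (depth z).
by move=> [i Yi [Dz zi]]; split=> //; rewrite /= zi.
Qed.

Let Dk k := D `&` [set z | (k <= depth z)%N].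

(* On each level set of [depth] the index [depth z - k] is constant. *)
Lemma measurable_depth_split k (S : set Z) (T : nat -> set Z) :
  (forall i, (k <= i)%N -> measurable ((D `&` [set z | depth z = i]) `&` T i))
    ->
  (forall z, Dk k z -> S z <-> T (depth z) z) -> measurable (Dk k `&` S).
Proof.
move=> mT ST; rewrite (_ : Dk k `&` S = \bigcup_(i in [set i | (k <= i)%N])
    ((D `&` [set z | depth z = i]) `&` T i)).
  by apply: bigcup_measurable => i; exact: mT.
apply/seteqP; split=> z /=.
  by move=> [Dkz Sz]; have [Dz kz] := Dkz; exists (depth z) => //; split=> //;
    exact/ST.
by move=> [i ki [[Dz zi] Tz]]; rewrite /= in zi; subst i; split;
  [split|apply/ST].
Qed.

Lemma measurable_exponent k : measurable_fun (Dk k) (exponent k).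
Proof.
move=> _ Y mY.
apply: (measurable_depth_split (T := fun i => chi (i - k) @^-1` Y)) => // i ki.
have -> : (D `&` [set z | depth z = i]) `&` chi (i - k) @^-1` Y =
  (D `&` [set z | depth z = i]) `&` (D `&` chi (i - k) @^-1` Y).
  apply/seteqP; split=> z /=; first by move=> [[Dz zi] cz]; split.
  by move=> [[Dz zi] [_ cz]]; split.
apply: measurableI; first exact: measurable_depth_level.
by apply: mchi => //; exact: (pf_meas (DQ 0)).
Qed.

Lemma Gr_measurable_flag k : (0 < k)%N -> Gr_measurable_fun (Dk k) (flag k).
Proof.
move=> k0; have Q_neq0 i z : D z -> depth z = i -> (k <= i)%N -> Q (i - k) z !=
  0.
  by move=> Dz <- kd; rewrite depth_eq0 // -ltnNge ltn_subrL k0 (leq_trans k0).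
split=> [z [Dz kz]|S mS]; first exact/mx_img_neq0/Q_neq0.
apply: (measurable_depth_split (T := fun i =>
  (fun z => mx_img (Q (i - k) z) fullv) @^-1` S)) => // i ki.
have [_ H] := @Gr_measurable_proj R m _ _ (D `&` [set z | depth z = i])
  (Q (i - k))
  (measurable_depth_level i) (measurable_mxS (pf_meas (DQ 0)) (@subIsetl _ _ _)
    (pf_measurable (DQ (i - k))))
  (fun z Dz => pf_idem (DQ (i - k)) Dz.1) (fun z Dz => Q_neq0 i z Dz.1 Dz.2 ki).
exact: H.
Qed.

End Flags.

Lemma borel_measurable_mx (d : measure_display) (Z : measurableType d)
  (R : realType) (m : nat)
    (L : Z -> 'M[R]_m) :
  measurable_fun setT (L : Z -> borel 'M[R]_m) -> measurable_mx setT L.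
Proof.
move=> mL i j; apply: (measurability _ (RGenOInfty.measurableE R)).
move=> _ [_ [x ->] <-].
rewrite (_ : _ @^-1` _ = L @^-1` [set M : 'M[R]_m | x < M i j]); last first.
  by apply/seteqP; split=> z /=; rewrite in_itv /= andbT.
apply: mL => //; apply: sub_sigma_algebra.
rewrite (_ : [set M | _] = (fun M : 'M[R]_m => M i j) @^-1` [set y | x < y]) //.
by apply: open_comp => [M _|]; [exact: coord_continuous|exact: open_gt].
Qed.

Theorem theorem3p3 (R : realType) (disp : measure_display)
    (X : topMeasurableType disp) (hX : compact [set: X])
    (mu : probability X R)
    (n : nat) (p : 'I_n.+1 -> R) (hp : prob_vector p)
    (B : probability (words n) R) (hB : is_bernoulli p B)
    (T : 'I_n.+1 -> X -> X) (hT : forall i, measure_preserving mu (T i))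
    (m : nat) (hm : (0 < m)%N) (L : X -> 'M[R]_m)
    (hLunit : forall x, L x \in unitmx)
    (hLmeas : measurable_fun [set: X] (L : X -> borel 'M[R]_m))
    (hLint : mu.-integrable [set: X] (fun x => (logp_opnorm (L x))%:E))
    (hLVint : mu.-integrable [set: X]
                (fun x => (logp_opnorm (invmx (L x)))%:E)) :
  exists (D : set (words n * X)) (r : words n * X -> nat)
         (lambda : nat -> words n * X -> R)
         (V : nat -> words n * X -> {vspace 'cV[R]_m}),
    [/\ measurable D /\ {ae (B \x mu)%E, forall z, D z},
        (forall z v, D z -> D (skew_map T L (z, v)).1),
        (forall omega x, D (omega, x) ->
          [/\ (0 < r (omega, x))%N,
              (forall k, (1 <= k)%N -> (k < r (omega, x))%N ->
                 lambda k (omega, x) < lambda k.+1 (omega, x)),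
              [/\ V 0%N (omega, x) = 0%VS,
                  V (r (omega, x)) (omega, x) = fullv &
                  (forall k, (k < r (omega, x))%N ->
                    (V k (omega, x) <= V k.+1 (omega, x))%VS /\
                    V k (omega, x) <> V k.+1 (omega, x))],
              (forall j, r (iter j (@shift_word n) omega,
                            traj_map T omega j x) = r (omega, x)) &
              (forall k, (1 <= k <= r (omega, x))%N ->
                [/\ (forall j, lambda k (iter j (@shift_word n) omega,
                                         traj_map T omega j x)
                               = lambda k (omega, x)),
                    (forall j,
                      mx_img (L (traj_map T omega j x))
                        (V k (iter j (@shift_word n) omega,
                              traj_map T omega j x))
                      = V k (iter j.+1 (@shift_word n) omega,
                             traj_map T omega j.+1 x)) &
                    (forall v : 'cV[R]_m,
                      v \in V k (omega, x) -> v \notin V k.-1 (omega, x) ->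
                      (fun i : nat =>
                         i%:R^-1 * ln (enorm (cocycle T L omega x i *m v)))
                        @ \oo --> lambda k (omega, x))])]) &
        [/\ measurable_fun D r,
            (forall k, (1 <= k)%N ->
              measurable_fun (D `&` [set z | (k <= r z)%N]) (lambda k)) &
            (forall k, (1 <= k)%N ->
              Gr_measurable_fun (D `&` [set z | (k <= r z)%N]) (V k))]].
Proof.
pose F := base_map T; pose A (z : words n * X) := L z.2.
(* One integrable majorant serves both [L] and its inverse; the summand m * m comes from
   [nrm_le_logp]. *)
pose f (x : X) : R := logp_opnorm (L x) + logp_opnorm (invmx (L x)) +
  (m * m)%:R.
pose phi (z : words n * X) : R := f z.2.
have mF : measurable_fun setT F by exact: measurable_base_map hT.
have PF S : measurable S -> (B \x mu)%E (F @^-1` S) = (B \x mu)%E S.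
  exact: (base_map_preserving hp hB hT).
have mL : measurable_mx setT L by exact: borel_measurable_mx.
have mA : measurable_mx setT A.
  by move=> i j; exact: measurableT_comp (mL i j) (@measurable_snd _ _ _ _).
have Aunit z : A z \in unitmx by exact: hLunit.
have intf : mu.-integrable setT (EFin \o f).
  rewrite (_ : EFin \o f = (fun x => (logp_opnorm (L x))%:E) \+
    (fun x => (logp_opnorm (invmx (L x)))%:E) \+ (EFin \o cst (m * m)%:R))%E //.
  by apply: integrableD => //; [exact: integrableD|exact:
    finite_measure_integrable_cst].
have iphi : (B \x mu)%E.-integrable setT (EFin \o phi) by exact: integrable_snd
  intf.
have mphi : measurable_fun setT phi.
  by apply/measurable_EFinP; case/integrableP: iphi.
have phi0 z : 0 <= phi z by rewrite !addr_ge0 ?logp_opnorm_ge0.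
have A_le z : nrm (A z) <= expR (phi z).
  rewrite (le_trans (nrm_le_logp _)) // ler_expR /phi /f lerD2r lerDl.
  exact: logp_opnorm_ge0.
have AV_le z : nrm (invmx (A z)) <= expR (phi z).
  rewrite (le_trans (nrm_le_logp _)) // ler_expR /phi /f lerD2r lerDr.
  exact: logp_opnorm_ge0.
have [D [Q [chi [DQ mchi Q_ends Q_chain]]]] :=
  filtration mF PF mA Aunit mphi phi0 iphi A_le AV_le.
have DF z : D z -> D (F z) by exact: (pf_inv (DQ 0%N)).
have Diter k z : D z -> D (iter k F z) by elim: k => // k IH /IH; exact: DF.
have mxcocycleE omega x k : mxcocycle F A k (omega, x) = cocycle T L omega x k.
  by elim: k => //= k ->; rewrite /A iter_base_map.
have depth_iter k z : D z -> depth Q (iter k F z) = depth Q z.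
  move=> Dz; elim: k => // k IH.
  by rewrite iterS (depth_inv Aunit DQ Q_ends Q_chain) //; exact: Diter.
have exponent_iter i k z : D z -> exponent Q chi i (iter k F z) = exponent Q chi
  i z.
  move=> Dz; elim: k => // k IH.
  by rewrite iterS (exponent_inv Aunit DQ Q_ends Q_chain) //; exact: Diter.
exists D, (depth Q), (exponent Q chi), (flag Q); split.
- by split; [exact: (pf_meas (DQ 0%N))|exact: (pf_ae (DQ 0%N))].
- by move=> z v Dz; exact: DF.
- move=> omega x Dz; split.
  + exact: (depth_gt0 hm Q_ends Q_chain).
  + by move=> k k0 kd; apply: (exponent_incr Q_ends Q_chain).
  + split; [exact: (flag0 DQ Q_ends Q_chain)|exact: (flag_depth DQ Q_ends)|].
    by move=> k kd; apply: (flag_incr DQ Q_ends Q_chain).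
  + by move=> j; rewrite -iter_base_map depth_iter.
  + move=> k kd; split=> [j|j|v vk vk'].
    * by rewrite -iter_base_map exponent_iter.
    * rewrite -!iter_base_map iterS -(flag_inv Aunit DQ Q_ends Q_chain).
        by rewrite /A iter_base_map.
      exact: Diter.
    * have := mxcocycle_enorm_cvg Aunit DQ Q_chain Dz kd vk vk'.
      by under eq_fun do rewrite mxcocycleE.
- split.
  + exact: (measurable_depth DQ Q_ends Q_chain).
  + by move=> k k0; exact: (measurable_exponent DQ mchi Q_ends Q_chain).
  + by move=> k k0; exact: (Gr_measurable_flag DQ Q_ends Q_chain).
Qed.
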